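(* Let $\Gamma=\Gamma(G)$ be the commuting graph of a finite group $G$ with nontrivial centre and suppose that $\Gamma$ has an isolated edge $\{v,w\}$. Then one of the following holds: (i) $G\cong \mathrm{SL}(2,3)$ and $\Gamma(G)=3K_2+4K_4$. (ii) $G\cong \mathrm{SL}(2,5)$ and $\Gamma(G)=15K_2+10K_4+6K_8$. (iii) $G\cong \mathrm{GL}(2,3)$ or $J$, and $\Gamma(G)=6K_2+4K_4+3K_6$. (iv) $G\cong Q_8$ or $D_8$, and $\Gamma(G)=3K_2$. (v) $G\cong D_{2^k}$, $SD_{2^k}$ or $Q_{2^k}$ with $k\ge 4$, and $\Gamma(G)=2^{k-2}K_2+K_{2^{k-1}-2}$. (vi) $G$ has an abelian normal subgroup $N\neq 1$ of odd order with $G/N\cong\mathrm{GL}(2,3)$ or $J$, the preimage of $\mathrm{SL}(2,3)$ in $G$ centralises $N$, $v$ acts on $N$ by inversion, and $\Gamma(G)=\left(\frac{|V(\Gamma)|+2}{8}\right)K_2+\Delta$, with $\Delta$ connected of diameter four. (vii) $G\cong N\rtimes H$ where $N\neq 1$ is an abelian group of odd order, $H$ is isomorphic to one of $\mathbb{Z}_4$, $D_4$, $D_8$, $Q_8$, or $D_{2^k}$, $SD_{2^k}$, $Q_{2^k}$ with $k\ge 4$, the group induced by the action of $H$ on $N$ via conjugation is $\mathbb{Z}_2$ or $\mathbb{Z}_2\times\mathbb{Z}_2$, $v$ acts on $N$ by inversion, and either (a) $\Gamma(G)=\left(\frac{|V(\Gamma)|+2}{4}\right)K_2+K_k$ where $k=(|V(\Gamma)|-2)/2$,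 or (b) $\Gamma(G)=\left(\frac{|V(\Gamma)|+2}{8}\right)K_2+\Delta$, with $\Delta$ connected of diameter at most three.
   Context: For a group $G$ with centre $Z(G)$, the commuting graph $\Gamma(G)$ is the simple graph with vertex set $G\setminus Z(G)$ in which two distinct vertices $x,y$ are adjacent if and only if $xy=yx$. $V(\Gamma)$ is the vertex set of $\Gamma$. An edge $\{v,w\}$ is isolated if $\{v,w\}$ is the vertex set of a connected component. $K_i$ is the complete graph on $i$ vertices, $nK_i$ is the disjoint union of $n$ copies of $K_i$, and $+$ denotes disjoint union. An element $v$ acts on $N$ by inversion if $v^{-1}nv=n^{-1}$ for all $n\in N$. Write $x^y=y^{-1}xy$. Groups: $J=\langle a,b,c,\gamma\mid a^3=b^3=c^2=abc=\gamma^2,\ a^\gamma=b\rangle$, a non-split extension of $\mathrm{SL}(2,3)=\langle a,b,c\mid a^3=b^3=c^2=abc\rangle$ by $\langle\gamma\rangle\cong\mathbb{Z}_4$ (it has order $48$ and is SmallGroup(48,28) in GAP). $D_{2n}=\langle a,b\mid a^n=b^2=1,\ a^b=a^{-1}\rangle$ for $n\ge 2$ is the dihedral group of order $2n$ (so $D_4\cong\mathbb{Z}_2\times\mathbb{Z}_2$). $SD_{2n}=\langle a,b\mid a^n=b^2=1,\ a^b=a^{n/2-1}\rangle$ for $n=2^k\ge 8$ is the semidihedral group of order $2n$. $Q_{4n}=\langle a,b\mid a^{2n}=b^4=1,\ a^n=b^2,\ a^b=a^{-1}\rangle$ for $n\ge 2$ is the generalised quaternion group of order $4n$. The preimage of $\mathrm{SL}(2,3)$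 in $G$ means the preimage, under $G\to G/N$, of the subgroup $\mathrm{SL}(2,3)$ of $\mathrm{GL}(2,3)$ or of the subgroup $\mathrm{SL}(2,3)=\langle a,b,c\rangle$ of $J$. *)

(* Defs.v *)
From HB Require Import structures.
From mathcomp Require Import all_boot all_order all_algebra.
From mathcomp Require Import all_fingroup all_solvable.

Set Implicit Arguments.
Unset Strict Implicit.
Unset Printing Implicit Defensive.

Import GroupScope.

(** * Finite simple graphs *)

Record sgraph := SGraph {
  svertex :> finType;
  sedge : rel svertex;
  sedge_sym : symmetric sedge;
  sedge_irr : irreflexive sedge }.

Definition giso (A B : sgraph) : Prop :=
  exists2 f : A -> B,
    bijective f & forall x y : A, sedge (f x) (f y) = sedge x y.

Section Complete.
Variable n : nat.
Definition complete_rel (i j : 'I_n) := i != j.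
Fact complete_sym : symmetric complete_rel.
Proof. by move=> i j; rewrite /complete_rel eq_sym. Qed.
Fact complete_irr : irreflexive complete_rel.
Proof. by move=> i; rewrite /complete_rel eqxx. Qed.
Definition complete_graph := SGraph complete_sym complete_irr.
End Complete.

Section Union.
Variables A B : sgraph.
Definition gunion_rel (x y : A + B) :=
  match x, y with
  | inl a, inl a' => sedge a a'
  | inr b, inr b' => sedge b b'
  | _, _ => false
  end.
Fact gunion_sym : symmetric gunion_rel.
Proof. by move=> [a|b] [a'|b'] //=; rewrite sedge_sym. Qed.
Fact gunion_irr : irreflexive gunion_rel.
Proof. by move=> [a|b] /=; rewrite sedge_irr. Qed.
Definition gunion := SGraph gunion_sym gunion_irr.
End Union.

Section Copies.
Variables (n : nat) (A : sgraph).
Definition gcopies_rel (x y : 'I_n * A) := (x.1 == y.1) && sedge x.2 y.2.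
Fact gcopies_sym : symmetric gcopies_rel.
Proof. by move=> x y; rewrite /gcopies_rel eq_sym sedge_sym. Qed.
Fact gcopies_irr : irreflexive gcopies_rel.
Proof. by move=> x; rewrite /gcopies_rel sedge_irr andbF. Qed.
Definition gcopies := SGraph gcopies_sym gcopies_irr.
End Copies.

Declare Scope graph_scope.
Delimit Scope graph_scope with graph.
Bind Scope graph_scope with sgraph.
Notation "''K_' n" := (complete_graph n)
  (at level 0, n at level 2, format "''K_' n") : graph_scope.
Notation "n * A" := (gcopies n%N A) : graph_scope.
Notation "A + B" := (gunion A B) : graph_scope.
Notation "A ~= B" := (giso A%graph B%graph) (at level 70) : type_scope.

Definition gconnected (A : sgraph) : Prop :=
  0 < #|A| /\ forall x y : A, connect (@sedge A) x y.

Definition walk (A : sgraph) (n : nat) (x y : A) : bool :=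
  [exists p : n.-tuple A, path (@sedge A) x p && (last x p == y)].

(* A shortest walk has fewer than #|A| edges, so [gdist x y] is the usual
   distance when x and y are connected, and #|A| (standing for infinity)
   otherwise. *)
Definition gdist (A : sgraph) (x y : A) : nat :=
  find (fun n => walk n x y) (iota 0 #|A|).

Definition gdiam (A : sgraph) : nat := \max_(x : A) \max_(y : A) gdist x y.

Definition isolated_edge (A : sgraph) (v w : A) : Prop :=
  sedge v w /\ [set x | connect (@sedge A) v x] = [set v; w].

(** * The commuting graph *)

Section CommutingGraph.
Variables (gT : finGroupType) (G : {group gT}).
Definition noncentral := {x : gT | x \in G :\: 'Z(G)}.
Definition commuting_rel (x y : noncentral) :=
  (x != y) && (val x * val y == val y * val x).
Fact commuting_sym : symmetric commuting_rel.
Proof. by move=> x y; rewrite /commuting_rel eq_sym [_ * _ == _]eq_sym. Qed.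
Fact commuting_irr : irreflexive commuting_rel.
Proof. by move=> x; rewrite /commuting_rel eqxx. Qed.
Definition commuting_graph := SGraph commuting_sym commuting_irr.
End CommutingGraph.

(** * The groups *)

Definition SLgroup (n : nat) (R : finComUnitRingType) : {set {'GL_n[R]}} :=
  [set u | (\det (GLval u) == 1)%R].

Notation "''SL_' n ( p )" := (SLgroup n 'F_p)
  (at level 0, n at level 2, p at level 10, format "''SL_' n ( p )")
  : group_scope.

Fact SLgroup_group_set n (R : finComUnitRingType) : group_set (SLgroup n R).
Proof.
apply/group_setP; split=> [|u v]; first by rewrite inE GL_1E det1.
by rewrite !inE GL_ME det_mulmx => /eqP-> /eqP->; rewrite GRing.mulr1.
Qed.
Canonical SLgroup_group n R := Group (SLgroup_group_set n R).

(* Elements satisfying the defining relations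
   a^3 = b^3 = c^2 = abc = g^2, a^g = b of J. *)
Definition J_relations (gT : finGroupType) (a b c g : gT) : Prop :=
  [/\ a ^+ 3 = b ^+ 3, b ^+ 3 = c ^+ 2, c ^+ 2 = a * b * c,
      a * b * c = g ^+ 2 & a ^ g = b].

(* J has order 48, so being the largest finite group with this presentation,
   which is what [\isog Grp] says, amounts to being isomorphic to J. *)
Definition isog_J (gT : finGroupType) (K : {set gT}) : Prop :=
  K \isog Grp (a : b : c : g :
    a ^+ 3 = b ^+ 3 = g ^+ 2, c ^+ 2 = a * b * c = g ^+ 2, a ^ g = b).

Definition acts_by_inversion (gT : finGroupType) (v : gT) (N : {set gT}) :=
  {in N, forall n, n ^ v = n^-1}.

(** The preimage of SL(2,3) in G centralises N, with G / N identified with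
    GL(2,3), respectively J, by some isomorphism.  For J such an isomorphism is
    given by the images of the generators, and SL(2,3) is <a, b, c>. *)

Definition GL23_quotient_SL_centralises (gT : finGroupType)
    (G N : {group gT}) : Prop :=
  exists2 f : {morphism G / N >-> {'GL_2(3)}},
    isom (G / N) 'GL_2(3) f
  & coset N @*^-1 (f @*^-1 'SL_2(3)) \subset 'C(N).

Definition J_quotient_SL_centralises (gT : finGroupType)
    (G N : {group gT}) : Prop :=
  isog_J (G / N) /\
  exists a b c g : coset_of N,
    [/\ J_relations a b c g, <<[set a; b; c; g]>> = G / N
      & coset N @*^-1 <<[set a; b; c]>> \subset 'C(N)].

Definition isog_D_SD_Q (gT : finGroupType) (K : {set gT}) (k : nat) :=
  [\/ K \isog 'D_(2 ^ k), K \isog 'SD_(2 ^ k) | K \isog 'Q_(2 ^ k)].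

(* Main.v *)
Require Import Defs.
From HB Require Import structures.
From mathcomp Require Import all_boot all_order all_algebra.
From mathcomp Require Import all_fingroup all_solvable.

Set Implicit Arguments.
Unset Strict Implicit.
Unset Printing Implicit Defensive.

Import GroupScope.

(* The isolated edge {v, w} is the set C_G(v) \ Z(G), so |Z(G)| = 2 and
   |C_G(v)| = 4. Hence a Sylow 2-subgroup T containing C_G(v) has order four or
   is dihedral, semidihedral or quaternion. Studying the fusion of involutions
   in G/Z(G), and passing to G/Z(G) by induction, leaves three cases: G has a
   normal 2-complement N; T is quaternion of order 8 and the involutions of
   T/Z(G) are conjugate; |T| = 16 and G has a normal quaternion subgroup of
   order 8 whose noncentral cosets of Z(G) are conjugate in G/Z(G). As v acts
   without fixed points on every normal subgroup of odd order, it inverts them.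
   In the second case, counting the involutions in each coset of the normaliser
   of the fused four-group gives |G/Z(G)| = 12 or 60; in the third, G/O(G) has
   order 48. Suitable generators satisfy a presentation of SL(2,3), SL(2,5),
   GL(2,3) or J, and coset enumeration bounds the orders of the presented
   groups. The elements with centraliser of order four form the isolated edges.
   The others form complete components when all centralisers are abelian, and
   are otherwise joined through elements centralising N. *)

(** * Normal complements *)

(** The obstacle is to control fusion in [G / Z(G)] with nothing deeper than transfer to an abelian
    Sylow subgroup. If [#|T|] is at least 16, [T / Z(G)] is dihedral with central involution [s],
    and the image of [v] is a noncentral involution whose centraliser again has order four. Every
    involution not conjugate to it commutes with [s]. As [s] is itself such an involution, its
    conjugates commute pairwise and generate a normal elementary abelian 2-subgroup [E] of
    [G / Z(G)]. Either [E] has order two, and then [G / Z(G)] satisfies the same hypotheses as [G],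
    or [E] is a four-group, which forces [#|T| = 16]. The named groups are recognised inside direct
    products: pairs of corresponding generators satisfy the same relations, so an upper bound on the
    order of the group that they generate makes both projections injective. Isolated edges enter
    through orders of centralisers because these survive in quotients by odd normal subgroups [N]:
    all elements of a coset of [N] containing [v] are conjugate to [v]. *)

Lemma Burnside_fusion (gT : finGroupType) p (G P : {group gT}) a y :
  p.-Sylow(G) P -> 'N_G(P) \subset 'C(P) -> a \in P -> y \in G -> a ^ y \in P ->
  a ^ y = a.
Proof.
move=> sylP cNP Pa Gy Pay; have sPG := pHall_sub sylP.
have aP : abelian P by apply: subset_trans cNP; rewrite subsetI sPG normG.
have sPC : P \subset 'C_G[a ^ y] by rewrite subsetI sPG sub_cent1 (subsetP aP).
have sPyC : P :^ y \subset 'C_G[a ^ y].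
  by rewrite subsetI -{1}(conjGid Gy) conjSg sPG cent1J conjSg sub_cent1 (subsetP aP).
have syl1 := pHall_subl sPC (subsetIl G _) sylP.
have syl2 : p.-Sylow('C_G[a ^ y]) (P :^ y).
  by apply: (pHall_subl sPyC (subsetIl G _)); rewrite pHallJ.
(* [P] and [P :^ y] are both Sylow in the centraliser of [a ^ y], so some [c] in it makes [y * c]
   normalise [P]. Then [y * c] fixes [a], while [c] fixes [a ^ y]. *)
have [c /setIP[Gc /cent1P cc] eP] := Sylow_trans syl2 syl1.
have Nyc : y * c \in 'N_G(P).
  by rewrite inE groupM // inE conjsgM -eP subxx.
have := centP (subsetP cNP _ Nyc) a Pa => cyc.
have e : a ^ (y * c) = a by apply/conjg_fixP/commgP/commute_sym.
by rewrite conjgM in e; rewrite -[RHS]e; apply/esym/conjg_fixP/commgP/commute_sym.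
Qed.

(* Transfer to the abelian group [P] acts on [P] as the power map of exponent
   |G : P|, so its kernel meets [P] trivially. *)
Lemma Burnside_normal_complement (gT : finGroupType) p (G P : {group gT}) :
  p.-Sylow(G) P -> 'N_G(P) \subset 'C(P) ->
  exists K : {group gT}, [/\ K <| G, p^'.-group K & #|G : K| = #|P|].
Proof.
move=> sylP cNP; have [sPG pP p'i] := and3P sylP.
have aP : abelian P by apply: subset_trans cNP; rewrite subsetI sPG normG.
have aA : abelian (idm P @* P) by rewrite morphim_idm.
have sub : idm P @* P \subset P by rewrite morphim_idm.
have Ag g i : g \in P -> g ^+ i \in idm P @* P by move=> Pg; rewrite morphim_idm // groupX.
pose V := transfer_morphism G aA.
have VP g : g \in P -> V g = FiniteModule.fmod aA (g ^+ #|G : P|).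
  move=> Pg; have Gg := subsetP sPG g Pg.
  have trX := transversalP (rcosets_cycle_partition sPG Gg).
  rewrite /V /= (transfer_cycle_expansion sPG aA Gg trX).
  rewrite -(sum_index_rcosets_cycle sPG Gg trX) /=.
  set X := transversal _ _ in trX *.
  have sXG := subsetP (transversal_sub trX).
  (* Each factor of the transfer is a conjugate, lying in [P], of a power of [g], hence equals that
     power by [Burnside_fusion]; the exponents are cycle lengths on the cosets and add up to the
     index. *)
  transitivity (\sum_(x in X) FiniteModule.fmod aA (g ^+ #|<[g]> : P :* x|))%R.
    apply: eq_bigr => x Xx; congr (FiniteModule.fmod _ _).
    apply: (Burnside_fusion sylP); rewrite ?groupX ?groupV ?sXG //.
    have := mulg_exp_card_rcosets P g x.
    by rewrite mem_rcoset conjgE invgK mulgA.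
  apply/esym; apply: (big_morph (fun n => FiniteModule.fmod aA (g ^+ n))) => [m n|].
    by rewrite expgD FiniteModule.fmodM ?Ag.
  by rewrite expg0 FiniteModule.fmod1.
pose K := 'ker V.
have nK : K <| G by apply: ker_normal.
have tiKP : K :&: P = 1.
  apply/trivgP/subsetP=> g /setIP[Kg Pg]; rewrite inE.
  have /mker : g \in 'ker V by [].
  rewrite VP // => /(congr1 val); rewrite FiniteModule.fmodK ?Ag //.
  move/eqP; rewrite -[val _]/1 -order_dvdn => d1.
  have d2 := order_dvdG Pg.
  have cop : coprime #|P| #|G : P| by rewrite (pnat_coprime pP).
  by rewrite -order_eq1 -dvdn1 -(eqP cop) dvdn_gcd d1 d2.
(* The target of the transfer is a copy of [P], so the kernel has index at most [#|P|]; meeting [P]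
   trivially, it has exactly this index. *)
have oV : #|G : K| <= #|P|.
  rewrite -card_quotient ?normal_norm // (card_isog (first_isog V)).
  apply: leq_trans (max_card _) _.
  rewrite -cardsT -(card_in_imset (in2W (@FiniteModule.fmod_inj _ _ aA))).
  apply/subset_leq_card/subsetP=> _ /imsetP[u _ ->].
  by apply: (subsetP sub); apply: FiniteModule.fmodP.
have eo : #|G : K| = #|P|.
  apply/eqP; rewrite eqn_leq oV /= -(leq_pmul2l (cardG_gt0 K)) Lagrange ?normal_sub //.
  by rewrite -TI_cardMg // subset_leq_card // mul_subG // normal_sub.
exists ('ker V)%G; split=> //.
rewrite /pgroup; suff -> : #|K| = #|G : P| by [].
apply/eqP; rewrite -(eqn_pmul2r (cardG_gt0 P)) -{1}eo Lagrange ?normal_sub //.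
by rewrite mulnC Lagrange.
Qed.

(* The map [n |-> n^-1 * n ^ v] is injective on [N], hence onto, and [v]
   inverts each of its values. *)
Lemma fixfree_inversion (gT : finGroupType) (N : {group gT}) (v : gT) :
  v \in 'N(N) -> v ^+ 2 \in 'C(N) -> 'C_N[v] = 1 -> acts_by_inversion v N.
Proof.
move=> nNv cv2 cNv.
pose f n := n^-1 * n ^ v.
have injf : {in N &, injective f}.
  move=> x y Nx Ny efxy; apply/eqP; rewrite eq_mulgV1; apply/eqP/set1P.
  rewrite -set1gE -cNv inE groupM ?groupV //=; apply/cent1P/commgP.
  rewrite /commg conjMg conjVg invMg invgK.
  have -> : x ^ v = x * (y^-1 * y ^ v) by rewrite -[_ * y ^ v]efxy mulKVg.
  by move: (y ^ v) => z; rewrite !mulgA mulgK mulgKV mulgV.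
have fN : f @: N = N.
  apply/eqP; rewrite eqEcard (card_in_imset injf) leqnn andbT.
  by apply/subsetP=> _ /imsetP[n Nn ->]; rewrite groupM ?groupV // memJ_norm.
move=> n; rewrite -{1}fN => /imsetP[m Nm ->].
have mv2 : m ^ (v ^+ 2) = m by rewrite conjgE -(centP cv2 m Nm) mulKg.
by rewrite /f invMg invgK conjMg conjVg -conjgM -[v * v]expg2 mv2.
Qed.

Lemma inversion_abelian (gT : finGroupType) (N : {group gT}) (v : gT) :
  acts_by_inversion v N -> abelian N.
Proof.
move=> iN; apply/centsP=> x Nx y Ny.
by apply: invg_inj; rewrite -(iN _ (groupM Nx Ny)) conjMg !iN // invMg.
Qed.

Lemma two_inversions_cent (gT : finGroupType) (N : {group gT}) (u v : gT) :
  acts_by_inversion u N -> acts_by_inversion v N -> u * v \in 'C(N).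
Proof.
move=> iu iv; apply/centP=> n Nn; apply/esym/commgP.
by rewrite /commg conjgM iu // conjVg iv // invgK mulVg.
Qed.

Lemma odd_square_surj (gT : finGroupType) (N : {group gT}) x :
  odd #|N| -> x \in N -> exists2 y, y \in N & x = y ^+ 2.
Proof.
move=> oN Nx; exists (x ^+ (#[x].+1)./2); first exact: groupX.
have ox : odd #[x] by apply: dvdn_odd oN; apply: order_dvdG.
rewrite -expgM muln2 -[_.*2]add0n -[0%N]/(nat_of_bool (~~ true)) -ox -oddS odd_double_half.
by rewrite expgS expg_order mulg1.
Qed.

(** Since [v] inverts [m], [v ^ m] is [v * m ^+ 2], and in a group of odd order every [n] is such a
    square. This is the tool for lifting conjugacy and centralisers from [G / N] to [G]. *)
Lemma inversion_coset_conj (gT : finGroupType) (N : {group gT}) (v n : gT) :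
  odd #|N| -> acts_by_inversion v N -> n \in N ->
  exists2 m, m \in N & v * n = v ^ m.
Proof.
move=> oN iv Nn; have [m Nm ->] := odd_square_surj oN Nn; exists m => //.
have e : m^-1 * v = v * m by rewrite conjgC conjVg iv // invgK.
by rewrite [RHS]conjgE expg2 !mulgA e.
Qed.

(** In the dihedral group generated by [v] and [w], [w = v * r] with [v] inverting [<[r]>], so odd
    order of [r] is the situation of [inversion_coset_conj]. *)
Lemma conj_of_odd_product (gT : finGroupType) (v w : gT) :
  v ^+ 2 = 1 -> w ^+ 2 = 1 -> odd #[v * w] -> exists2 g, g \in <[v * w]> & w = v ^ g.
Proof.
move=> v2 w2 ow; set r := v * w in ow *.
have vV : v^-1 = v by apply/eqP; rewrite eq_invg_mul -expg2 v2.
have wV : w^-1 = w by apply/eqP; rewrite eq_invg_mul -expg2 w2.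
have iv : acts_by_inversion v <[r]>.
  move=> _ /cycleP[k ->]; rewrite conjXg -expgVn; congr (_ ^+ _).
  by rewrite conjgE /r invMg wV vV !mulgA -[v * v]expg2 v2 mul1g.
have [m rm vm] := inversion_coset_conj ow iv (cycle_id r).
by exists m => //; rewrite -vm /r mulgA -expg2 v2 mul1g.
Qed.


(** * Two-groups with a centraliser of order four *)

Lemma dvdn4 d : d %| 4 -> [\/ d = 1%N, d = 2%N | d = 4%N].
Proof.
case/(dvdn_pfactor d 2 (isT : prime 2)) => [[|[|[|k]]]] // _ ->.
  exact: Or31.
  exact: Or32.
  exact: Or33.
Qed.

Lemma center_sub_cent1 (gT : finGroupType) (G : {group gT}) x :
  x \in G -> 'Z(G) \subset 'C[x].
Proof. by move=> Gx; rewrite -cent_set1 subIset // centS ?orbT // sub1set. Qed.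

(* If [v] does not centralise the normal four-group [U], then some
   [W > U] centralising [U] is centralised by [v] modulo [U]; the
   commutators [~ v, w] all lie in C_U(v), which is too small for them. *)
Lemma no_normal_four (gT : finGroupType) (T U : {group gT}) (v : gT) :
  2.-group T -> v \in T -> #|'C_T[v]| = 4 -> 16 <= #|T| ->
  U <| T -> #|U| = 4 -> ~~ 2.-abelem U.
Proof.
move=> pT Tv cTv T16 nUT oU; apply/negP=> abU.
have [sUT nUT'] := andP nUT.
have aU := abelem_abelian abU.
have exU y : y \in U -> y ^+ 2 = 1.
  by move=> Uy; case/abelemP: abU => // _; apply.
have iT : (#|v ^: T| * 4 = #|T|)%N by rewrite -index_cent1 -cTv mulnC Lagrange ?subsetIl.
have cls4 : 4 <= #|v ^: T| by rewrite -(leq_pmul2r (isT : 0 < 4)) iT.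
(* Otherwise [U] would be the centraliser of [v], and the class of [v], of size at least four, would
   fit into its three nonidentity elements. *)
have nCv : v \notin 'C(U).
  apply/negP=> cUv; have eU : U :=: 'C_T[v].
    apply/eqP; rewrite eqEcard oU cTv andbT subsetI sUT /=.
    by rewrite sub_cent1.
  have Uv : v \in U by rewrite eU inE Tv cent1id.
  have : v ^: T \subset U^#.
    apply/subsetP=> _ /imsetP[g Tg ->]; rewrite !inE conjg_eq1 memJ_norm ?(subsetP nUT') // Uv andbT.
    by apply: contraTneq cls4 => ->; rewrite class1G cards1.
  by move/subset_leq_card/(leq_trans cls4); rewrite cardsDS ?sub1G // cards1 oU.
pose Z1 := (U :&: 'Z(T))%G.
have Z1gt1 : 2 <= #|Z1|.
  by rewrite cardG_gt1 meet_center_nil ?(pgroup_nil pT) // -cardG_gt1 oU.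
have [u Uu cuv] : exists2 u, u \in U & u \notin 'C[v].
  by apply/subsetPn; rewrite sub_cent1.
(* The class of [u] stays in [U] but avoids the central part [Z1], which leaves at most two
   elements. *)
have clsu : #|u ^: T| <= 2.
  have : u ^: T \subset U :\: Z1.
    apply/subsetP=> _ /imsetP[g Tg ->]; have Uug : u ^ g \in U by rewrite memJ_norm ?(subsetP nUT').
    rewrite in_setD Uug andbT inE Uug /= memJ_norm ?(subsetP (gFnorm _ _)) //.
    by apply: contra cuv => /setIP[_ /centP/(_ v Tv)]; move/cent1P; rewrite cent1C.
  move/subset_leq_card; rewrite cardsDS ?subsetIl // oU => /leq_trans; apply.
  by rewrite leq_subLR; rewrite (leq_add2r 2 2).
pose M := 'C_T(U)%G.
(* An element centralising [u] also centralises [Z1], hence more than half of [U], hence [U]. *)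
have cM : 'C_T[u] \subset M.
  apply/subsetP=> g /setIP[Tg cgu]; rewrite inE Tg /= -sub_cent1.
  have s1 : Z1 \proper 'C_U[g].
    rewrite properE; apply/andP; split.
      by rewrite subsetI subsetIl subIset // center_sub_cent1 ?orbT.
    apply/subsetPn; exists u; first by rewrite inE Uu cent1C.
    rewrite inE Uu /=; apply: contra cuv => /setIP[_ /centP/(_ v Tv)].
    by move/cent1P; rewrite cent1C.
  have : #|'C_U[g]| %| 4 by rewrite -oU cardSg ?subsetIl.
  have := leq_ltn_trans Z1gt1 (proper_card s1).
  move=> gt2 /dvdn4[e|e|e]; rewrite ?e // in gt2.
  by rewrite -(_ : 'C_U[g] = U) ?subsetIr //; apply/eqP; rewrite eqEcard subsetIl e oU.
have sMT : M \subset T by apply: subsetIl.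
have nvM : v \notin M by rewrite inE Tv.
have nMT : M <| T by rewrite /normal sMT normsI ?normG ?norms_cent.
have M8 : 8 <= #|M|.
  have := subset_leq_card cM; apply: leq_trans.
  rewrite -(leq_pmul2r (isT : 0 < 2)); apply: leq_trans T16 _.
  by rewrite -(Lagrange (subsetIl T 'C[u])) leq_mul2l index_cent1 clsu orbT.
have sZM : 'Z(T) \subset M by rewrite setIS // centS.
have F2 : #|'C_M[v]| <= 2.
  have p1 : 'C_M[v] \proper 'C_T[v].
    rewrite properE setSI //=; apply/subsetPn; exists v; first by rewrite inE Tv cent1id.
    by rewrite inE negb_and nvM.
  have : #|'C_M[v]| %| 4 by rewrite -cTv cardSg ?proper_sub.
  by have := proper_card p1; rewrite cTv => lt4 /dvdn4[] e; rewrite e // in lt4 *.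
have defF : 'C_M[v] = 'Z(T).
  apply/eqP; rewrite eq_sym eqEcard subsetI sZM /=; apply/andP; split.
    exact: center_sub_cent1.
  apply: leq_trans F2 (leq_trans Z1gt1 _); exact/subset_leq_card/subsetIr.
have iM : #|T : M| = 2.
  have iMle : #|T : M| <= 2.
    by rewrite (leq_trans _ clsu) // -index_cent1 dvdn_leq ?indexgS.
  have iM1 : #|T : M| != 1%N by rewrite indexg_eq1; apply/subsetPn; exists v.
  by case: #|T : M| (indexg_gt0 T M) iM1 iMle => [|[|[|n]]].
have v2Z : v ^+ 2 \in 'Z(T).
  rewrite -defF inE; apply/andP; split; last exact: groupX (cent1id v).
  have nMv := subsetP (normal_norm nMT) v Tv.
  apply: coset_idr; first exact: groupX.
  by rewrite morphX // -iM -card_quotient ?normal_norm // expg_cardG // mem_quotient.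
have sUM : U \subset M by rewrite subsetI sUT.
have [wb Mwb wb1] : exists2 wb, wb \in M / U :&: 'Z(T / U) & wb != 1.
  apply/trivgPn; rewrite meet_center_nil ?quotient_normal ?quotient_nil ?(pgroup_nil pT) //.
  rewrite -subG1 quotient_sub1 ?(subset_trans sMT nUT') //.
  by apply: contraL M8 => /subset_leq_card; rewrite oU -ltnNge ltnS => /leq_trans; apply.
case/setIP: Mwb => Mwb Zwb.
pose W := (coset U @*^-1 <[wb]>)%G.
have sUW : U \subset W by rewrite sub_cosetpre.
have sWM : W \subset M.
  by rewrite sub_cosetpre_quo ?cycle_subG // (normalS sUM sMT nUT).
have W8 : 8 <= #|W|.
  rewrite card_cosetpre oU (@leq_pmul2l 4 2) //.
  by rewrite -/(#[wb]) ltnNge leq_eqVlt ltnS leqn0 -[_ == 0]negbK -lt0n order_gt0 orbF order_eq1.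
(* ['C_W[v]] has order at most two, so [v] has at least four conjugates under [W] and there are four
   commutators [[~ v, w]]. They are shown to lie in ['C_M[v]], which is too small. *)
have : 4 <= #|[set v^-1 * y | y in v ^: W]|.
  rewrite card_imset; last exact: mulgI.
  rewrite -index_cent1 -(leq_pmul2r (isT : 0 < 2)) (leq_trans W8) //.
  rewrite -(Lagrange (subsetIl W 'C[v])) mulnC leq_mul2l; apply/orP; right.
  by rewrite (leq_trans _ F2) // subset_leq_card // setSI.
apply/negP; rewrite -ltnNge ltnS; apply: (@leq_trans #|'C_M[v]|); last exact: leq_trans F2 _.
apply/subset_leq_card/subsetP=> _ /imsetP[_ /imsetP[w Ww ->] ->].
have Tw : w \in T by apply: (subsetP sMT); apply: (subsetP sWM).
have nUw := subsetP nUT' _ Tw; have nUv := subsetP nUT' _ Tv.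
rewrite -commgEl; set y := [~ v, w].
have Uy : y \in U.
  apply: coset_idr; first by rewrite groupR.
  rewrite morphR //=; apply/eqP/commgP.
  have : coset U w \in 'Z(T / U).
    have := mem_quotient U Ww; rewrite cosetpreK => /cycleP[k ->]; exact: groupX.
  by case/setIP=> _ /centP/(_ _ (mem_quotient U Tv))/commute_sym.
rewrite inE (subsetP sUM _ Uy); apply/cent1P.
have vw : v ^ w = v * y by rewrite /y commgEl mulKVg.
(* As [v ^+ 2] is central, [(v * y) ^+ 2 = v ^+ 2]; with [y ^+ 2 = 1] this says that [y] commutes
   with [v]. *)
have : (v ^ w) ^+ 2 = v ^+ 2.
  by rewrite -conjXg conjgE; case/setIP: v2Z => _ /centP/(_ w Tw) ->; rewrite mulKg.
rewrite vw !expg2 -mulgA => /mulgI; rewrite mulgA => e.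
have yV : y^-1 = y by apply/eqP; rewrite eq_invg_mul -expg2 exU.
by rewrite /commute -[in RHS]e -[RHS]mulgA -expg2 exU // mulg1.
Qed.

(** A noncyclic abelian normal subgroup would contain a normal four-group in its ['Ohm_1], against
    [no_normal_four]; 2-groups without such subgroups are cyclic or extremal. That argument works
    from order 16 on, so order eight is settled as the extraspecial case. *)
Lemma two_group_extremal (gT : finGroupType) (T : {group gT}) (v : gT) :
  2.-group T -> v \in T -> #|'C_T[v]| = 4 -> ~~ abelian T -> extremal2 T.
Proof.
move=> pT Tv cTv naT; have [n oT] := p_natP pT.
have ext8 : n <= 3 -> extremal2 T.
  move=> n3; have esT : extraspecial T by apply: (p3group_extraspecial pT); rewrite // oT pfactorK.
  have n3' : n = 3.
    apply/eqP; rewrite eqn_leq n3; have := min_card_extraspecial pT esT.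
    by rewrite oT leq_exp2l.
  rewrite n3' in oT; case/orP: (card_isog8_extraspecial oT esT) => iso; rewrite /extremal2 !inE.
    by apply/orP; left; apply/eqP/dihedral_classP; exists 3.
  by apply/orP; right; apply/orP; right; apply/eqP/quaternion_classP; exists 3.
have [/ext8 // | n4] := leqP n 3.
have T16 : 16 <= #|T| by rewrite oT (@leq_exp2l 2 4).
have [X nXT aX | cT | /and3P[]//] := normal_rank1_structure pT; last by rewrite cyclic_abelian in naT.
have [sXT nXT'] := andP nXT; have pX := pgroupS sXT pT.
apply: contraT => ncX; have abO := Ohm1_abelem pX aX.
have nOT : 'Ohm_1(X) <| T by apply: gFnormal_trans.
have rX : 2 <= logn 2 #|'Ohm_1(X)|.
  rewrite ltnNge -p_rank_abelem // p_rank_Ohm1 -(rank_pgroup pX).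
  by rewrite -abelian_rank1_cyclic.
have [U [sUO nUT oU]] := normal_pgroup pT nOT rX.
by have := no_normal_four pT Tv cTv T16 nUT oU; rewrite (abelemS sUO).
Qed.

(** The last clause treats the three families at once: elements outside [X] act on it as the power
    [-1], or [2 ^ (n - 2) - 1] in the semidihedral case, and both are inversion modulo the
    centre. *)
Lemma extremal2_cyclic (gT : finGroupType) (T : {group gT}) :
  extremal2 T -> ~~ abelian T ->
  exists X : {group gT},
    [/\ cyclic X, X \subset T, #|T : X| = 2,
        #|'Z(T)| = 2 /\ 'Z(T) \subset X
      & {in X & T :\: X, forall y z, y * y ^ z \in 'Z(T)}].
Proof.
move=> ext naT.
have [n [x [y [genT sdy]]]] : exists n x y, extremal_generators T 2 n (x, y) /\
    ((extremal_class T == SemiDihedral) ==> (#[y] == 2)).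
  move: (ext); rewrite /extremal2 !inE => /or3P[] /eqP c; rewrite c.
      have/dihedral_classP[n n1 iso] := c.
      by have [[x y] g _] := generators_2dihedral n1 iso; exists n, x, y.
    have/semidihedral_classP[n n1 iso] := c.
    by have [[x y] g [oy _]] := generators_semidihedral n1 iso; exists n, x, y; rewrite oy.
  have/quaternion_classP[n n1 iso] := c.
  by have [[x y] g _] := generators_quaternion n1 iso; exists n, x, y.
have [[_ _ _ act] _ [Zs _ _ _] _ _] := extremal2_structure genT ext sdy.
have [oT Tx ox _] := genT.
have n2 : 2 < n.
  rewrite ltnNge; apply: contra naT => n2; apply: (@p2group_abelian _ 2).
    by rewrite /pgroup oT pnatX.
  by rewrite oT pfactorK.
rewrite n2 in Zs; have [defZ oZ] := Zs.
exists <[x]>%G; split; rewrite ?cycle_cyclic ?cycle_subG //.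
    rewrite -divgS ?cycle_subG // -orderE oT ox -(subnKC n2) /= expnS mulnK ?expn_gt0 //.
  by split=> //; rewrite defZ cycleX.
move=> u z Xu Xz; rewrite (act u z Xu Xz) /=; case: ifP => _; last by rewrite mulgV group1.
rewrite -expgS prednK ?expn_gt0 // defZ.
by case/cycleP: Xu => k ->; rewrite -expgM mulnC expgM mem_cycle.
Qed.

Lemma extremal2_isog (gT : finGroupType) (T : {group gT}) :
  extremal2 T -> exists2 k, #|T| = (2 ^ k)%N & isog_D_SD_Q T k.
Proof.
rewrite /extremal2 !inE => /or3P[] /eqP.
    case/dihedral_classP=> n n1 iso; exists n; last exact: Or31.
    by rewrite (card_isog iso) card_2dihedral.
  case/semidihedral_classP=> n n1 iso; exists n; last exact: Or32.
  by rewrite (card_isog iso) card_semidihedral.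
case/quaternion_classP=> n n1 iso; exists n; last exact: Or33.
by rewrite (card_isog iso) card_quaternion.
Qed.

(** * Centralisers of order four *)

Lemma index2_lcoset (gT : finGroupType) (K H : {group gT}) x y :
  H \subset K -> #|K : H| = 2 -> x \in K :\: H -> y \in K :\: H -> x^-1 * y \in H.
Proof.
move=> sHK iKH /setDP[Kx nHx]; suff -> : K :\: H = x *: H by rewrite mem_lcoset.
apply/esym/eqP; rewrite eqEcard card_lcoset cardsDS // -(Lagrange sHK) iKH.
rewrite muln2 -addnn addnK leqnn andbT; apply/subsetP=> _ /lcosetP[h Hh ->].
by have Kh := subsetP sHK h Hh; rewrite inE groupMr // nHx groupM.
Qed.

Lemma index2_cosets (gT : finGroupType) (K H : {group gT}) x y :
  H \subset K -> #|K : H| = 2 -> x \in K :\: H -> y \in K ->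
  y \in H \/ exists2 h, h \in H & y = x * h.
Proof.
move=> sHK iKH Kx Ky; have [|nHy] := boolP (y \in H); [by left | right].
by exists (x^-1 * y); rewrite ?mulKVg // (index2_lcoset sHK iKH) // inE nHy.
Qed.

(** The group-theoretic form of an isolated edge at [v]. Unlike the edge itself it can be handed
    down to [G / Z(G)] and to quotients by odd normal subgroups. *)
Definition cent4 (gT : finGroupType) (G : {group gT}) (v : gT) : Prop :=
  [/\ #|'Z(G)| = 2, v \in G, v \notin 'Z(G) & #|'C_G[v]| = 4].

Section Cent4.
Variables (gT : finGroupType) (G : {group gT}) (v : gT).
Hypothesis cGv : cent4 G v.
Let Z := 'Z(G)%G.

Lemma cent4_sub : 'Z(G) \subset 'C_G[v].
Proof. by case: cGv => *; rewrite subsetI center_sub center_sub_cent1. Qed.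

Lemma cent4_index : #|'C_G[v] : Z| = 2.
Proof. by case: cGv => oZ _ _ oC; rewrite -divgS ?cent4_sub //= oC oZ. Qed.

Lemma cent4_mem : v \in 'C_G[v] :\: Z.
Proof. by case: cGv => _ Gv nZv _; rewrite in_setD nZv inE Gv cent1id. Qed.

Lemma cent4_cosets y : y \in 'C_G[v] -> y \in Z \/ exists2 z, z \in Z & y = v * z.
Proof. exact: index2_cosets cent4_sub cent4_index cent4_mem. Qed.

Lemma cent4_sqr : v ^+ 2 \in Z.
Proof.
have [] := @cent4_cosets (v ^+ 2); rewrite //.
  by case: cGv => _ Gv _ _; rewrite groupX // inE Gv cent1id.
case=> z Zz; rewrite expg2 => /mulgI vz; case: cGv => _ _ /negP[].
by rewrite vz.
Qed.

Lemma center2_gen : exists t, [/\ t != 1, t ^+ 2 = 1 & forall z, z \in Z -> z = 1 \/ z = t].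
Proof.
case: cGv => oZ _ _ _; have /cyclicP[t eZ] : cyclic Z by rewrite prime_cyclic //= oZ.
have ot : #[t] = 2 by rewrite orderE -eZ.
exists t; split; first by rewrite -order_eq1 ot.
  by rewrite -ot expg_order.
by move=> z; rewrite eZ cycle2g // !inE => /orP[] /eqP; [left | right].
Qed.

Lemma center_expn2 z : z \in Z -> z ^+ 2 = 1.
Proof. by have [t [_ t2 zP]] := center2_gen; case/zP=> ->; rewrite ?expg1n. Qed.

Lemma cent4_Sylow : exists2 T : {group gT}, 2.-Sylow(G) T & 'C_G[v] \subset T.
Proof.
have pC : 2.-group 'C_G[v] by case: cGv => _ _ _ oC; rewrite /pgroup oC.
by have [T sylT sCT] := Sylow_superset (subsetIl G 'C[v]) pC; exists T.
Qed.

Variable T : {group gT}.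
Hypotheses (sylT : 2.-Sylow(G) T) (sCT : 'C_G[v] \subset T).

Lemma cent4_SylowC : 'C_T[v] = 'C_G[v].
Proof.
apply/eqP; rewrite eqEsubset setSI ?(pHall_sub sylT) //=.
by rewrite subsetI sCT subsetIr.
Qed.

Lemma cent4_T : v \in T.
Proof. by case/setDP: cent4_mem => Cv _; apply: (subsetP sCT). Qed.

Lemma cent4_card4 : abelian T -> #|T| = 4.
Proof.
move=> aT; case: cGv => _ _ _ <-; rewrite -cent4_SylowC.
by rewrite (setIidPl _) // -cent_set1 (subset_trans aT) // centS // sub1set cent4_T.
Qed.

Lemma cent4_extremal : 4 < #|T| -> extremal2 T.
Proof.
move=> T4; apply: (two_group_extremal (pHall_pgroup sylT) cent4_T).
  by rewrite cent4_SylowC; case: cGv.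
by apply: contraL T4 => /cent4_card4 ->.
Qed.

Lemma cent4_nonabelian : 4 < #|T| -> ~~ abelian T.
Proof. by apply: contraL => /cent4_card4 ->. Qed.

Lemma cent4_centerT : 4 < #|T| -> 'Z(T) = 'Z(G).
Proof.
move=> T4; have [X [_ _ _ [oZT _] _]] := extremal2_cyclic (cent4_extremal T4) (cent4_nonabelian T4).
apply/esym/eqP; rewrite eqEcard oZT; case: cGv => -> _ _ _; rewrite andbT.
rewrite subsetI (subset_trans cent4_sub sCT) /= subIset // centS ?orbT //.
exact: pHall_sub sylT.
Qed.

Lemma nZG : G \subset 'N(Z). Proof. exact: gFnorm. Qed.

(* The preimage P of the centraliser of v modulo Z maps to Z under g |-> [v, g],
   with kernel C_G(v). *)
Lemma card_quo_cent_le : #|'C_(G / Z)[coset Z v]| <= 4.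
Proof.
case: (cGv) => oZ Gv _ oC.
pose P := (G :&: coset Z @*^-1 'C_(G / Z)[coset Z v])%G.
have sZP : Z \subset P by rewrite subsetI center_sub sub_cosetpre.
have -> : 'C_(G / Z)[coset Z v] = P / Z.
  by rewrite quotientGI ?center_sub // cosetpreK setIA setIid.
rewrite card_quotient; last by rewrite subIset ?nZG.
rewrite -divgS // oZ leq_divLR //=; last by rewrite -oZ cardSg.
rewrite -(Lagrange (subsetIl P 'C[v])) (leq_mul (n1 := 4) (n2 := 2)) //.
  by rewrite -oC subset_leq_card // setSI ?subsetIl.
rewrite index_cent1 -oZ -(card_lcoset _ v) subset_leq_card //.
apply/subsetP=> _ /imsetP[g /setIP[Gg Pg] ->]; rewrite mem_lcoset -commgEl.
have nZg := subsetP nZG g Gg; have nZv := subsetP nZG v Gv.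
apply: coset_idr; first by rewrite groupR.
rewrite morphR //=; apply/eqP/commgP/cent1P; rewrite cent1C.
by have := mem_quotient Z Pg; rewrite cosetpreK => /setIP[].
Qed.

Hypothesis T4 : 4 < #|T|.

(** This lower bound holds in any 2-group of order at least four: a noncentral element lies outside
    the nontrivial centre, so its centraliser, containing both, has order above two. It meets the
    upper bound of [card_quo_cent_le]. *)
Lemma cent4_card_quoT : 4 <= #|'C_(T / Z)[coset Z v]|.
Proof.
have pT := pHall_pgroup sylT; have sTG := pHall_sub sylT.
case: (cGv) => oZ Gv nZv _.
have [Tb2 pTb] : 4 <= #|T / Z| /\ 2.-group (T / Z).
  split; last exact: quotient_pgroup.
  have [n oT] := p_natP pT; have sZT := subset_trans cent4_sub sCT.
  rewrite card_quotient ?(subset_trans sTG nZG) // -divgS // oZ oT.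
  move: T4; rewrite oT; case: n {oT} => [|[|[|n]]] // _.
  by rewrite -(prednK (expn_gt0 2 n.+3)) // prednK ?expn_gt0 // expnS mulKn // (@leq_exp2l 2 2).
have Tv : coset Z v \in T / Z by apply: mem_quotient; apply: cent4_T.
have [cv | ncv] := boolP (coset Z v \in 'Z(T / Z)).
  apply: leq_trans Tb2 _; rewrite subset_leq_card // subsetI subxx sub_cent1.
  by case/setIP: cv.
have Zgt1 : 2 <= #|'Z(T / Z)|.
  by rewrite cardG_gt1; apply: contraTneq Tb2 => /(trivg_center_pgroup pTb) ->; rewrite cards1.
have s1 : 'Z(T / Z) \proper 'C_(T / Z)[coset Z v].
  rewrite properE subsetI center_sub center_sub_cent1 //=.
  by apply/subsetPn; exists (coset Z v); rewrite // inE Tv cent1id.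
have := cardSg (proper_sub s1); have := proper_card s1; have := Zgt1.
have pC : 2.-group 'C_(T / Z)[coset Z v] := pgroupS (subsetIl _ _) pTb.
have [m ->] := p_natP pC.
case: m => [|[|m]]; rewrite ?expnS ?expn0 ?muln1 //=; last by rewrite mulnA leq_pmulr ?expn_gt0.
  by move=> a /(leq_ltn_trans a).
by move=> a /(leq_ltn_trans a).
Qed.

Lemma quo_sub_cent : 'C_(T / Z)[coset Z v] \subset 'C_(G / Z)[coset Z v].
Proof. by rewrite setSI // quotientS // (pHall_sub sylT). Qed.

Lemma cent4_card_quo : #|'C_(G / Z)[coset Z v]| = 4.
Proof.
apply/eqP; rewrite eqn_leq card_quo_cent_le (leq_trans cent4_card_quoT) //.
exact/subset_leq_card/quo_sub_cent.
Qed.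

Lemma cent4_quo_sub : 'C_(G / Z)[coset Z v] \subset T / Z.
Proof.
have /eqP <- : 'C_(T / Z)[coset Z v] == 'C_(G / Z)[coset Z v].
  by rewrite eqEcard quo_sub_cent cent4_card_quo cent4_card_quoT.
exact: subsetIl.
Qed.

End Cent4.

(** * The three cases *)

Lemma card_cent1_class (gT : finGroupType) (X : {group gT}) (x y : gT) :
  y \in x ^: X -> #|'C_X[y]| = #|'C_X[x]|.
Proof.
move/class_eqP=> e; apply/eqP; rewrite -(eqn_pmul2r (indexg_gt0 X 'C_X[x])).
by rewrite Lagrange ?subsetIl // index_cent1 -e -index_cent1 Lagrange ?subsetIl.
Qed.

Lemma involution_cent4 (gT : finGroupType) (C : {group gT}) (v s : gT) :
  v ^+ 2 = 1 -> v != 1 -> s != v -> s != 1 -> v \in C -> s \in C -> #|C| = 4 ->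
  forall y, y \in C -> [\/ y = 1, y = v, y = s | y = v * s].
Proof.
move=> v2 v1 nsv s1 Cv Cs oC y Cy.
have ov : #[v] = 2 by apply: nt_prime_order.
have sVC : <[v]> \subset C by rewrite cycle_subG.
have vP h : h \in <[v]> -> h = 1 \/ h = v.
  by rewrite cycle2g // !inE => /orP[] /eqP; [left | right].
have sCV : s \in C :\: <[v]>.
  by rewrite in_setD Cs andbT; apply/negP=> /vP[] e; rewrite e eqxx in nsv s1.
have iC : #|C : <[v]>| = 2 by rewrite -divgS // oC -orderE ov.
have [/vP[]|[h /vP[] ->]] := index2_cosets sVC iC sCV Cy.
- exact: Or41.
- exact: Or42.
- by rewrite mulg1; apply: Or43.
move=> ->; apply: Or44; have := index2_lcoset sVC iC sCV.
have cC : commute s v.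
  have aC : abelian C by apply: (card_p2group_abelian (isT : prime 2)).
  exact: (centsP aC).
by move=> _; exact: cC.
Qed.

(* An involution not conjugate to [v] commutes with [s]: the product with [v]
   has even order, hence a power [z] which is an involution of
   C(v) = {1, v, s, v s} commuting with both. *)
Lemma involution_commutes (gT : finGroupType) (X : {group gT}) (v s w : gT) :
  v \in X -> v ^+ 2 = 1 -> v != 1 -> s \in X -> s ^+ 2 = 1 -> s != 1 -> s != v ->
  commute v s -> #|'C_X[v]| = 4 -> v * s \in v ^: X ->
  w \in X -> w ^+ 2 = 1 -> w \notin v ^: X -> commute w s.
Proof.
move=> Xv v2 v1 Xs s2 s1 nsv cvs oC cls Xw w2 ncls.
have vV : v^-1 = v by apply/eqP; rewrite eq_invg_mul -expg2 v2.
have wV : w^-1 = w by apply/eqP; rewrite eq_invg_mul -expg2 w2.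
have w1 : w = 1 \/ w != 1 by have [->|] := eqVneq w 1; [left | right].
case: w1 => [->|w1]; first exact: commute_sym (commute1 s).
have nvs1 : v * s != 1.
  by apply: contra nsv; rewrite -eq_invg_mul vV eq_sym.
have vsv : v * s != v by rewrite -{2}[v]mulg1 (inj_eq (mulgI v)).
have vss : v * s != s by rewrite -{2}[s]mul1g (inj_eq (mulIg s)).
have Cs : s \in 'C_X[v] by rewrite in_setI Xs cent1E cvs eqxx.
have Cv : v \in 'C_X[v] by rewrite in_setI Xv cent1id.
have defC := involution_cent4 v2 v1 nsv s1 Cv Cs oC.
pose r := v * w.
have ev : ~~ odd #[r].
  apply/negP=> /(conj_of_odd_product v2 w2)[g gvw e]; case/negP: ncls.
  by rewrite e memJ_class // (subsetP _ _ gvw) // cycle_subG groupM.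
have Xr : r \in X by rewrite groupM.
have rv : r ^ v = r^-1 by rewrite conjgE /r invMg vV wV !mulgA -[v * v]expg2 v2 mul1g.
have rw : r ^ w = r^-1 by rewrite /r invMg vV wV conjgE wV -(mulgA v) -expg2 w2 mulg1.
pose z := r ^+ (#[r])./2.
have on : (#[r]./2.*2)%N = #[r] by have := odd_double_half #[r]; rewrite (negbTE ev).
have z1 : z != 1.
  rewrite -order_dvdn -{1}on -{2}[_./2]mul1n -muln2 mulnC dvdn_pmul2r //.
  rewrite half_gt0 ltnNge leq_eqVlt order_eq1 ltnS leqn0 negb_or -lt0n order_gt0 andbT.
  by apply: contraNneq ev => ->; rewrite order1.
have z2 : z ^+ 2 = 1 by rewrite -expgM muln2 on expg_order.
have zV : z^-1 = z by apply/eqP; rewrite eq_invg_mul -expg2 z2.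
have zv : commute z v by apply/commgP/conjg_fixP; rewrite conjXg rv expgVn zV.
have zw : commute z w by apply/commgP/conjg_fixP; rewrite conjXg rw expgVn zV.
have Xz : z \in X by rewrite groupX.
have inC y : y \in X -> commute y v -> y \in 'C_X[v].
  by move=> Xy cy; rewrite in_setI Xy cent1E cy eqxx.
have Cws : w \in 'C_X[v] -> commute w s.
  case/defC=> e; rewrite e ?class_refl ?eqxx // in ncls w1 *.
  by rewrite cls in ncls.
(* A conjugate [z] of [v] has a centraliser of the same order, so containment is equality; [w]
   centralises [z], hence lies in ['C_X[v]], whose elements commute with [s]. *)
have Czs : z \in v ^: X -> commute v z -> 'C_X[v] \subset 'C_X[z] -> commute w s.
  move=> clz cvz sub; apply: Cws; have /eqP-> : 'C_X[v] == 'C_X[z].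
    by rewrite eqEcard sub (card_cent1_class clz) leqnn.
  by rewrite in_setI Xw cent1E zw eqxx.
have [e|e|e|e] := defC z (inC z Xz zv).
  by rewrite e eqxx in z1.
  by apply: Czs; rewrite e ?class_refl.
  by apply: commute_sym; rewrite -e.
apply: Czs; rewrite e //; first exact: commuteM.
have Cvs : v * s \in 'C_X[v * s] by rewrite in_setI groupM // cent1id.
have Cv' : v \in 'C_X[v * s] by rewrite in_setI Xv cent1E mulgA -[v * s * v]mulgA -cvs mulgA eqxx.
have Cs' : s \in 'C_X[v * s] by rewrite -{1}(mulKg v s) groupM // groupV.
by apply/subsetP=> y /defC[->|->|->|->]; rewrite ?group1.
Qed.

Lemma exponent2_abelian (gT : finGroupType) (A : {group gT}) :
  {in A, forall x, x ^+ 2 = 1} -> abelian A.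
Proof.
move=> sq; apply: (@inversion_abelian _ _ 1) => x Ax.
by rewrite conjg1; apply/esym/eqP; rewrite eq_invg_mul -expg2 sq.
Qed.

Definition has_2compl (gT : finGroupType) (G : {group gT}) : Prop :=
  exists N : {group gT}, [/\ N <| G, odd #|N| & 2.-nat #|G : N|].

(** For [Z] of order two this says that [Q] is quaternion of order eight with centre [Z]. It is
    phrased through squares because these can be followed through conjugation and quotients. *)
Definition quat8 (gT : finGroupType) (Z Q : {group gT}) : Prop :=
  [/\ Z \subset Q, #|Q| = 8 & {in Q :\: Z, forall x, x ^+ 2 != 1 /\ x ^+ 2 \in Z}].

Lemma Burnside_2compl (gT : finGroupType) (G T : {group gT}) :
  2.-Sylow(G) T -> 'N_G(T) \subset 'C(T) -> has_2compl G.
Proof.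
move=> sylT nT; have [K [nK p'K iK]] := Burnside_normal_complement sylT nT.
by exists K; rewrite odd_2'nat iK; split=> //; apply: pHall_pgroup sylT.
Qed.

Lemma has_2compl_Hall (gT : finGroupType) (G : {group gT}) :
  has_2compl G -> 2^'.-Hall(G) 'O_2^'(G).
Proof.
case=> N [nNG oN iN]; have hN : 2^'.-Hall(G) N.
  by rewrite /pHall normal_sub // -[2^'.-group _]odd_2'nat oN pnatNK.
by rewrite (normal_Hall_pcore hN).
Qed.

(** In the preimage of the complement, [Z] is a central Sylow 2-subgroup, so Burnside's theorem
    splits it off; the resulting complement is characteristic there and hence normal in [G]. *)
Lemma quotient_2compl (gT : finGroupType) (G Z : {group gT}) :
  Z \subset 'Z(G) -> #|Z| = 2 -> has_2compl (G / Z)%G -> has_2compl G.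
Proof.
move=> sZ oZ [Nb [nNb oNb iNb]].
have nZG : G \subset 'N(Z) by rewrite cents_norm // centsC (subset_trans sZ) // subsetIr.
have sZG : Z \subset G := subset_trans sZ (center_sub G).
pose N1 := (coset Z @*^-1 Nb)%G.
have nZ : Z <| G by apply/andP.
have nN1 : N1 <| G by rewrite -(quotientGK nZ) cosetpre_normal.
have sN1G := normal_sub nN1.
have oN1 : #|N1| = (2 * #|Nb|)%N by rewrite card_cosetpre oZ.
have sZN1 : Z \subset N1 by rewrite sub_cosetpre.
have iN1Z : #|N1 : Z| = #|Nb| by rewrite -divgS // oN1 oZ mulKn.
have sylZ : 2.-Sylow(N1) Z.
  by rewrite pHallE sZN1 oZ oN1 partnM // part_pnat_id // part_p'nat -?odd_2'nat.
have cZ : 'N_N1(Z) \subset 'C(Z).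
  by rewrite subIset // (subset_trans sN1G) // centsC (subset_trans sZ) // subsetIr.
have /has_2compl_Hall hO := Burnside_2compl sylZ cZ.
exists ('O_2^'(N1))%G; split; first by rewrite gFnormal_trans.
  by rewrite odd_2'nat; exact: pcore_pgroup.
rewrite -(Lagrange_index sN1G (pcore_sub _ _)) pnatM; apply/andP; split.
  rewrite -divgS // oN1 -[#|G|](Lagrange sZG) oZ -card_quotient // divnMl //.
  by rewrite divgS ?normal_sub.
by case/and3P: hO => _ _; rewrite pnatNK.
Qed.

(** A factor from a centre of order two disappears on squaring. *)
Lemma conj_mod_sqr (gT : finGroupType) (G : {group gT}) x y :
  #|'Z(G)| = 2 -> x \in G -> y \in G ->
  coset 'Z(G) x \in coset 'Z(G) y ^: (G / 'Z(G)) -> exists2 g, g \in G & x ^+ 2 = (y ^+ 2) ^ g.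
Proof.
move=> oZ Gx Gy /imsetP[_ /morphimP[g nZg Gg ->]] e; exists g => //.
have nZ := subsetP (gFnorm _ G : G \subset 'N('Z(G))).
rewrite -morphJ ?nZ // in e.
have /(kercoset_rcoset (nZ _ Gx))[|z Zz ->] := e; first by rewrite nZ ?groupJ.
rewrite expgMn; last first.
  by case/setIP: Zz => _ /centP cz; apply: cz; rewrite groupJ.
rewrite conjXg; have -> : z ^+ 2 = 1; last by rewrite mul1g.
by apply/eqP; rewrite -order_dvdn -oZ order_dvdG.
Qed.

Section Trichotomy.
Variables (gT : finGroupType) (G : {group gT}) (v : gT) (T : {group gT}).
Hypotheses (cGv : cent4 G v) (sylT : 2.-Sylow(G) T) (sCT : 'C_G[v] \subset T).
Let Z := 'Z(G)%G.
Let vb := coset Z v.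

(** Here [T = 'C_G[v]] is abelian, and its normaliser moves [v] only inside a coset of the centre,
    two elements. So [T] has index at most two in its normaliser; the index is also odd, and
    Burnside's theorem applies. *)
Lemma trichotomy4 : #|T| = 4 -> has_2compl G.
Proof.
move=> oT; have [oZ Gv nZv oC] := cGv; have sTG := pHall_sub sylT.
have eT : 'C_G[v] = T by apply/eqP; rewrite eqEcard sCT oC oT.
have aT : abelian T by apply: (card_p2group_abelian (isT : prime 2)).
have sTN : T \subset 'N_G(T) by rewrite subsetI sTG normG.
have i2 : #|'N_G(T) : T| <= 2.
  have eTN : 'C_('N_G(T))[v] = T.
    by apply/eqP; rewrite eqEsubset -{2}eT setSI ?subsetIl // subsetI sTN -eT subsetIr.
  rewrite -{2}eTN index_cent1 -oZ -(card_lcoset _ v) subset_leq_card //.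
  apply/subsetP=> _ /imsetP[g /setIP[Gg Ng] ->]; rewrite mem_lcoset.
  have Cv := cent4_mem cGv.
  apply: (index2_lcoset (cent4_sub cGv) (cent4_index cGv)) => //.
  case/setDP: Cv => Cv _; rewrite in_setD (memJ_norm _ (subsetP (gFnorm _ _) g Gg)) nZv /=.
  by rewrite eT memJ_norm // -eT.
apply: (Burnside_2compl sylT); have -> : 'N_G(T) = T :> {set _}; last exact: aT.
apply/eqP; rewrite eqEsubset sTN andbT -indexg_eq1.
have : odd #|'N_G(T) : T|.
  have := pHall_subl sTN (subsetIl _ _) sylT.
  by rewrite pHallE odd_2'nat; case/and3P: (pHall_subl sTN (subsetIl G 'N(T)) sylT).
by case: #|_ : _| i2 => [|[|[|n]]].
Qed.

(** [T / Z] is a self-centralising four-group, so if its normaliser does not centralise it, the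
    class of [vb] there has odd size above one and consists of all three involutions. By
    [conj_mod_sqr] all squares from [T :\: Z] then equal [v ^+ 2], which is not [1] because [T] is
    not abelian. *)
Lemma trichotomy8 : #|T| = 8 ->
  has_2compl G \/
  [/\ quat8 Z T, 'C_(G / Z)[vb] = T / Z
    & {in T :\: Z, forall x, coset Z x \in vb ^: 'N_(G / Z)(T / Z)}].
Proof.
move=> oT; have [oZ Gv nZv oC] := cGv; have sTG := pHall_sub sylT.
have T4 : 4 < #|T| by rewrite oT.
have nZG : G \subset 'N(Z) := gFnorm _ G.
have sZT : Z \subset T := subset_trans (cent4_sub cGv) sCT.
have oTb : #|T / Z| = 4.
  by rewrite card_quotient ?(subset_trans sTG) // -divgS // oT oZ.
have aTb : abelian (T / Z) by apply: (card_p2group_abelian (isT : prime 2)).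
have Tv := cent4_T cGv sCT.
have Tvb : vb \in T / Z := mem_quotient Z Tv.
have eC : 'C_(G / Z)[vb] = T / Z.
  apply/esym/eqP; rewrite eqEcard (cent4_card_quo cGv sylT sCT T4) oTb andbT.
  rewrite subsetI quotientS //= sub_cent1; exact: (subsetP aTb).
have sylTb : 2.-Sylow(G / Z) (T / Z) by apply: quotient_pHall; rewrite // (subset_trans sTG).
have [nC | nC] := boolP ('N_(G / Z)(T / Z) \subset 'C(T / Z)).
  left; apply: (@quotient_2compl _ G Z); rewrite //=.
  exact: (@Burnside_2compl _ _ (T / Z)%G).
right; set N := 'N_(G / Z)(T / Z) in nC *.
have sTN : T / Z \subset N by rewrite subsetI quotientS // normG.
have eCN : 'C_N[vb] = T / Z.
  by apply/eqP; rewrite eqEsubset -{1}eC setSI ?subsetIl // subsetI sTN -eC subsetIr.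
have iN : #|vb ^: N| = #|N : T / Z| by rewrite -index_cent1 eCN.
have oddN : odd #|N : T / Z|.
  by rewrite odd_2'nat; case/and3P: (pHall_subl sTN (subsetIl _ _) sylTb).
have vb1 : vb != 1 by apply: contra nZv => /eqP/coset_idr; apply; apply: (subsetP nZG).
have sub : vb ^: N \subset (T / Z)^#.
  apply/subsetP=> _ /imsetP[g /setIP[_ Ng] ->].
  by rewrite !inE conjg_eq1 vb1 memJ_norm.
have o3 : #|(T / Z)^#| = 3 by rewrite cardsDS ?sub1G // cards1 oTb.
have cl : vb ^: N = (T / Z)^#.
  apply/eqP; rewrite eqEcard sub o3 iN; move: oddN (subset_leq_card sub); rewrite o3 iN.
  case i: #|N : T / Z| => [|[|[|[|n]]]] // _ _; case/negP: nC.
  suff -> : N = T / Z by [].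
  by apply/eqP; rewrite eqEsubset sTN andbT -indexg_eq1 i.
have conjT : {in T :\: Z, forall x, coset Z x \in vb ^: N}.
  move=> x /setDP[Tx nZx]; rewrite cl !inE mem_quotient // andbT.
  by apply: contra nZx => /eqP/coset_idr; apply; apply: (subsetP nZG); apply: (subsetP sTG).
have sq x : x \in T :\: Z -> x ^+ 2 = v ^+ 2.
  move=> Tx; have Gx : x \in G by case/setDP: Tx => /(subsetP sTG).
  have /(conj_mod_sqr oZ Gx Gv)[g Gg ->] : coset Z x \in vb ^: (G / Z).
    by have := conjT x Tx; apply: subsetP; apply: imsetS; apply: subsetIl.
  have /setIP[_ /centP cv] := cent4_sqr cGv.
  by rewrite conjgE (cv g Gg) mulKg.
split=> //; split=> // x Tx; rewrite sq // cent4_sqr //; split=> //.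
apply/eqP=> v2; have := cent4_nonabelian cGv sylT sCT T4; case/negP.
apply: exponent2_abelian => y Ty.
have [Zy|nZy] := boolP (y \in Z); first exact: center_expn2 cGv y Zy.
by rewrite sq // inE nZy.
Qed.


End Trichotomy.

(** The square of [z] falls into the cyclic subgroup [X] and commutes with [X] and with [z], which
    together generate [T]. *)
Lemma extremal_sqr (gT : finGroupType) (T X : {group gT}) :
  cyclic X -> X \subset T -> #|T : X| = 2 ->
  {in T :\: X, forall z, z ^+ 2 \in 'Z(T)}.
Proof.
move=> cX sXT iX z Tz; have [Tz' nXz] := setDP Tz.
have nX : X <| T by apply: index2_normal.
have Xz2 : z ^+ 2 \in X.
  have nz := subsetP (normal_norm nX) z Tz'.
  by apply: coset_idr; rewrite ?groupX // morphX // -iX -card_quotient ?normal_norm // expg_cardG // mem_quotient.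
rewrite inE (subsetP sXT) //=; apply/centP=> y Ty.
have cXX : {in X, forall h, commute (z ^+ 2) h}.
  by move=> h Xh; apply: (centsP (cyclic_abelian cX)).
have [|[h Xh ->]] := index2_cosets sXT iX Tz Ty; first exact: cXX.
by apply: commuteM; [apply/commute_sym/commuteX | apply: cXX].
Qed.

Lemma conjg_dihedral (gT : finGroupType) (e x : gT) : x ^ e = x^-1 -> e ^ x = e * x ^+ 2.
Proof.
move=> xe; have h : x^-1 * e = e * x by rewrite conjgC conjVg xe invgK.
by rewrite conjgE mulgA h -mulgA.
Qed.

Section Trichotomy16.
Variables (gT : finGroupType) (G : {group gT}) (v : gT) (T : {group gT}).
Hypotheses (cGv : cent4 G v) (sylT : 2.-Sylow(G) T) (sCT : 'C_G[v] \subset T).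
Hypothesis T16 : 16 <= #|T|.
Let Z := 'Z(G)%G.
Let vb := coset Z v.

Lemma trichotomy16 :
  [/\ #|'Z(G / Z)| = 2, vb \notin 'Z(G / Z)
    & forall Q : {group coset_of Z}, Q \subset T / Z -> ~ quat8 'Z(G / Z)%G Q] \/
  exists Q : {group gT},
    [/\ Q <| G, quat8 Z Q, v \notin Q, #|T| = 16
      & {in Q :\: Z &, forall x y, coset Z x \in coset Z y ^: (G / Z)}].
Proof.
have [oZ Gv nZv oC] := cGv; have sTG := pHall_sub sylT.
have T4 : 4 < #|T| by apply: leq_trans T16.
have nZG : G \subset 'N(Z) := gFnorm _ G.
have nZT := subset_trans sTG nZG.
have sZT : Z \subset T := subset_trans (cent4_sub cGv) sCT.
have eZT : 'Z(T) = Z := cent4_centerT cGv sylT sCT T4.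
have naT := cent4_nonabelian cGv sylT sCT T4.
have [X [cX sXT iX [_ sZX'] act]] := extremal2_cyclic (cent4_extremal cGv sylT sCT T4) naT.
have sqT := extremal_sqr cX sXT iX; rewrite eZT in act sqT sZX'.
have sZX : Z \subset X := sZX'.
have nXT : X <| T by apply: index2_normal.
have Tv := cent4_T cGv sCT.
have iXb : #|T / Z : X / Z| = 2 by rewrite index_quotient_eq // subIset // sZX orbT.
have sXTb : X / Z \subset T / Z by apply: quotientS.
have cXb : cyclic (X / Z) by apply: quotient_cyclic.
have nXv : v \notin X.
  apply: contraL T16 => Xv; rewrite -ltnNge.
  have : X \subset 'C_T[v] by rewrite subsetI sXT sub_cent1 (subsetP (cyclic_abelian cX)).
  move/subset_leq_card; rewrite (cent4_SylowC sylT sCT) oC => h.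
  by rewrite -(Lagrange sXT) iX ltnS; apply: leq_trans (leq_mul h (leqnn 2)) _.
have liftX y : y \in X / Z -> exists2 x, x \in X & y = coset Z x.
  by case/morphimP=> x _ Xx ->; exists x.
have liftT y : y \in (T / Z) :\: (X / Z) -> exists2 x, x \in T :\: X & y = coset Z x.
  case/setDP=> /morphimP[x _ Tx ->] nXx; exists x => //; rewrite inE Tx andbT.
  by apply: contra nXx; apply: mem_quotient.
(* [T / Z] is dihedral: elements outside [X / Z] invert it and have square one, since in [T] both
   hold modulo the centre. *)
have D1 : {in X / Z & (T / Z) :\: (X / Z), forall y z, y ^ z = y^-1}.
  move=> _ _ /liftX[y Xy ->] /liftT[z Tz ->].
  have nT := subsetP nZT; have [Tz' _] := setDP Tz.
  have Ty := subsetP sXT y Xy.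
  rewrite -morphJ ?nT // -morphV ?nT //; apply: (mulgI (coset Z y)).
  rewrite -!morphM ?groupV ?nT ?groupJ // mulgV morph1; apply: coset_id.
  exact: act.
have D2 : {in (T / Z) :\: (X / Z), forall z, z ^+ 2 = 1}.
  move=> _ /liftT[z Tz ->]; have [Tz' _] := setDP Tz.
  by rewrite -morphX ?(subsetP nZT) //; apply: coset_id; apply: sqT.
have Tvb : vb \in T / Z by apply: mem_quotient.
have nXvb : vb \in (T / Z) :\: (X / Z).
  rewrite inE Tvb andbT; apply: contra nXv => /morphimP[x nx Xx /(kercoset_rcoset _ nx)[|z Zz ->]].
    exact: (subsetP nZT).
  by rewrite groupM // (subsetP sZX).
have [a defX] := cyclicP cXb.
have [k [k2 oX]] : exists k, 2 <= k /\ #[a] = (2 ^ k)%N.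
  have pXb : 2.-group (X / Z) := quotient_pgroup _ (pgroupS sXT (pHall_pgroup sylT)).
  have [k ok] := p_natP pXb; exists k; rewrite orderE -defX; split=> //.
  have : #|T| = (2 * 2 * 2 ^ k)%N.
    by rewrite -(Lagrange sXT) iX -(Lagrange sZX) -card_quotient ?(subset_trans sXT) // ok oZ mulnAC.
  move=> oT; rewrite -(@leq_exp2l 2) // -(@leq_pmul2l (2 * 2)) //.
  by rewrite -oT.
have Xa : a \in X / Z by rewrite defX cycle_id.
have Ta := subsetP sXTb a Xa.
(* [s] is the involution of [X / Z]; its square root [x] conjugates [vb] to [vb * s], the fusion
   that [involution_commutes] asks for. *)
pose x := a ^+ (2 ^ k.-2); pose s := x ^+ 2.
have es : s = a ^+ (2 ^ k.-1) by rewrite /s /x -expgM -expnSr; case: (k) k2 => [|[|]].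
have Xx : x \in X / Z by rewrite groupX.
have Xs : s \in X / Z by rewrite groupX.
have s1 : s != 1.
  by rewrite es -order_dvdn oX dvdn_Pexp2l // -ltnNge prednK // ltnW.
have s2 : s ^+ 2 = 1 by rewrite es -expgM -expnSr prednK ?(ltnW k2) // -oX expg_order.
have Xinv y : y \in X / Z -> y ^+ 2 = 1 -> y = 1 \/ y = s.
  move=> Xy y2; have : y \in <[s]>.
    have [->|y1] := eqVneq y 1; first exact: group1.
    have /eqP <- : <[y]> == <[s]>.
      rewrite (eq_subG_cyclic cXb) ?cycle_subG //.
      by rewrite -!orderE (nt_prime_order _ y2) // (nt_prime_order _ s2).
    exact: cycle_id.
  by rewrite cycle2g ?(nt_prime_order _ s2) // !inE => /orP[] /eqP; [left | right].
have Ts := subsetP sXTb s Xs.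
have sV : s^-1 = s by apply/eqP; rewrite eq_invg_mul -expg2 s2.
have cTs y : y \in T / Z -> commute y s.
  move=> Ty; have [Xy|nXy] := boolP (y \in X / Z).
    exact: (centsP (cyclic_abelian cXb)).
  by apply/commute_sym/commgP/conjg_fixP; rewrite D1 ?sV // inE nXy.
have vb1 : vb != 1 by apply: contraNneq (setDP nXvb).2 => ->; apply: group1.
have vb2 : vb ^+ 2 = 1 by apply: D2.
have nsv : s != vb by apply: contraNneq (setDP nXvb).2 => <-.
have sTGb : T / Z \subset G / Z by apply: quotientS.
have Gvb := subsetP sTGb _ Tvb; have Gs := subsetP sTGb _ Ts.
have oCb := cent4_card_quo cGv sylT sCT T4; rewrite -/Z -/vb in oCb.
have clvs : vb * s \in vb ^: (G / Z).
  have <- : vb ^ x = vb * s by apply: conjg_dihedral; rewrite D1.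
  by rewrite memJ_class // (subsetP sTGb) // (subsetP sXTb).
have Csb : s \in 'C_(G / Z)[vb].
  by rewrite in_setI Gs cent1E (cTs _ Tvb) eqxx.
have Cvb : vb \in 'C_(G / Z)[vb] by rewrite in_setI Gvb cent1id.
have Cb := involution_cent4 vb2 vb1 nsv s1 Cvb Csb oCb.
have oTb : #|T / Z| = (2 ^ k.+1)%N.
  have oXb : #|X / Z| = (2 ^ k)%N by rewrite defX -orderE.
  by rewrite -(Lagrange sXTb) iXb oXb expnSr.
(* [s] is centralised by all of [T / Z], of order at least eight, while conjugates of [vb] have
   centralisers of order four. *)
have ncls : s \notin vb ^: (G / Z).
  apply/negP=> /card_cent1_class; rewrite oCb => oCs.
  have : T / Z \subset 'C_(G / Z)[s].
    rewrite subsetI sTGb sub_cent1; apply/centP=> y Ty; exact/commute_sym/cTs.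
  move/subset_leq_card; rewrite oCs oTb; apply/negP; rewrite -ltnNge.
  by rewrite (@ltn_exp2l 2 2).
pose S := s ^: (G / Z); pose E := <<S>>%G.
have SP w : w \in S -> [/\ w \in G / Z, w ^+ 2 = 1, w != 1, w \notin vb ^: (G / Z) & commute w s].
  case/imsetP=> g Gg ->; have Gsg : s ^ g \in G / Z by rewrite groupJ.
  have sg2 : (s ^ g) ^+ 2 = 1 by rewrite -conjXg s2 conj1g.
  have nsg : s ^ g \notin vb ^: (G / Z).
    apply: contra ncls => /imsetP[h Gh e].
    by rewrite -(conjgK g s) e -conjgM memJ_class ?groupM ?groupV.
  split; rewrite ?conjg_eq1 //.
  exact: (involution_commutes Gvb vb2 vb1 Gs s2 s1 nsv (cTs _ Tvb) oCb clvs Gsg sg2 nsg).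
have aE : abelian E.
  rewrite abelian_gen; apply/centsP=> w Sw w' /imsetP[g Gg ->].
  have : w ^ g^-1 \in S.
    by case/imsetP: Sw => h Gh ->; rewrite -conjgM memJ_class // groupM ?groupV.
  move: (w ^ g^-1) (conjgKV g w) => w1 <- /SP[_ _ _ _ c].
  by rewrite /commute -!conjMg c.
have eE y : y \in E -> y ^+ 2 = 1.
  have : E \subset Group (group_Ldiv 2 aE).
    rewrite gen_subG; apply/subsetP=> w Sw; have [_ w2 _ _ _] := SP w Sw.
    by rewrite !inE mem_gen // w2 eqxx.
  by move/subsetP=> sub /sub; rewrite !inE => /andP[_ /eqP].
have nEG : E <| G / Z.
  by rewrite /normal gen_subG class_subG //= norms_gen // class_norm.
have pE : 2.-group E.
  by apply: abelem_pgroup; apply/abelemP.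
have ET : E \subset T / Z.
  apply: normal_sub_max_pgroup pE nEG; apply: Hall_max.
  exact: quotient_pHall.
(* If [vb] were in the abelian group [E], every conjugate of [s] would be one of [1], [vb], [s],
   [vb * s]. Only [s] itself is not excluded, and then [E] would lie in [X / Z]. *)
have nvE : vb \notin E.
  apply/negP=> Ev; have subS w : w \in S -> w = s.
    move=> Sw; have [Gw _ w1 ncw _] := SP w Sw.
    have : w \in 'C_(G / Z)[vb].
      by rewrite in_setI Gw cent1E; apply/eqP/(centsP aE) => //; apply: mem_gen.
    by case/Cb=> e; move: w1 ncw; rewrite e ?eqxx ?class_refl ?clvs.
  have : E \subset X / Z by rewrite gen_subG; apply/subsetP=> w /subS ->.
  by move/subsetP/(_ _ Ev) => Xv; case/setDP: nXvb; rewrite Xv.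
have Es : s \in E by rewrite mem_gen ?class_refl.
have [sEX | nsEX] := boolP (E \subset X / Z).
  left.
  have defE : E = <[s]> :> {set _}.
    apply/eqP; rewrite eqEsubset cycle_subG Es andbT; apply/subsetP=> y Ey.
    by have [->|->] := Xinv y (subsetP sEX y Ey) (eE y Ey); rewrite ?group1 ?cycle_id.
  have Zs : s \in 'Z(G / Z).
    rewrite inE Gs; apply/centP=> g Gg; apply/commgP/conjg_fixP.
    have : s ^ g \in E by rewrite mem_gen ?memJ_class.
    rewrite defE cycle2g ?(nt_prime_order _ s2) // !inE conjg_eq1 (negbTE s1) /=.
    by move/eqP.
  have nZvb : vb \notin 'Z(G / Z).
    apply/negP=> /setIP[_ /centP cv]; case/imsetP: clvs => g Gg.
    have -> : vb ^ g = vb by apply/conjg_fixP/commgP; apply: cv.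
    rewrite -[RHS]mulg1 => /mulgI e.
    by rewrite e eqxx in s1.
  have sZC : 'Z(G / Z) \subset 'C_(G / Z)[vb] by rewrite subsetI center_sub center_sub_cent1.
  have oZb : #|'Z(G / Z)| = 2.
    have := cardSg sZC; rewrite oCb => /dvdn4[] // e.
      by move: Zs; rewrite (card1_trivg e) inE (negbTE s1).
    case/negP: nZvb; suff -> : 'Z(G / Z) = 'C_(G / Z)[vb] by [].
    by apply/eqP; rewrite eqEcard sZC oCb e.
  have defZ : 'Z(G / Z) = <[s]>.
    by apply/esym/eqP; rewrite eqEcard cycle_subG Zs oZb -orderE (nt_prime_order _ s2).
  (* A quaternion subgroup inside [X / Z] would be cyclic of order eight, yet its generator would
     have a square in a centre of order two; outside [X / Z] every square is one. *)
  split=> // Q sQT [_ oQ sqQ].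
  have [sQX | /subsetPn[q Qq nXq]] := boolP (Q \subset X / Z).
    have /cyclicP[q defQ] := cyclicS sQX cXb.
    have oq : #[q] = 8 by rewrite orderE -defQ.
    have Qq : q \in Q by rewrite defQ cycle_id.
    have q2 : q ^+ 2 \in 'Z(G / Z).
      have [Zq | nZq] := boolP (q \in 'Z(G / Z)); first exact: groupX.
      by have [] := sqQ q; rewrite // in_setD nZq.
    by have := order_dvdG q2; rewrite oZb order_dvdn -expgM -order_dvdn oq.
  have [] := sqQ q.
    by rewrite in_setD Qq andbT /= defZ; apply: contra nXq => sq; rewrite (subsetP _ _ sq) // cycle_subG.
  by rewrite D2 ?eqxx // inE nXq (subsetP sQT).
(* A conjugate [e] of [s] outside [X / Z] satisfies [e ^ a = e * a ^+ 2], so [a ^+ 2] lies in [E],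
   of exponent two. Hence [a] has order four, and [s], [e], [e * s] are the nonidentity elements of
   [E], all conjugate. *)
right; have /subsetPn[e Se nXe] : ~~ (S \subset X / Z) by rewrite -gen_subG.
have Ee : e \in E by rewrite mem_gen.
have Te := subsetP ET e Ee.
have TXe : e \in (T / Z) :\: (X / Z) by rewrite inE nXe.
have ea : e ^ a = e * a ^+ 2 by apply: conjg_dihedral; rewrite D1.
have Sea : e ^ a \in S.
  by case/imsetP: (Se) => h Gh ->; rewrite -conjgM memJ_class // groupM // (subsetP sTGb).
have Ea2 : a ^+ 2 \in E by rewrite -(mulKg e (a ^+ 2)) -ea groupM ?groupV // mem_gen.
have k2' : k = 2.
  apply/eqP; rewrite eqn_leq k2 andbT.
  have := eE _ Ea2; rewrite -expgM => /eqP; rewrite -order_dvdn oX.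
  by rewrite -[(2 * 2)%N]/(2 ^ 2)%N dvdn_Pexp2l.
have as2 : a ^+ 2 = s by rewrite es k2'.
have Ses : e * s \in S by rewrite -as2 -ea.
have Ss : s \in S := class_refl _ _.
have EP y : y \in E -> [\/ y = 1, y = s, y = e | y = e * s].
  move=> Ey; have Ty := subsetP ET y Ey.
  have [Xy | nXy] := boolP (y \in X / Z).
    by have [->|->] := Xinv y Xy (eE y Ey); [apply: Or41 | apply: Or42].
  have Xey : e^-1 * y \in X / Z by apply: (index2_lcoset sXTb iXb TXe); rewrite inE nXy.
  have Eey : e^-1 * y \in E by rewrite groupM ?groupV.
  have [h|h] := Xinv _ Xey (eE _ Eey); rewrite -(mulKVg e y) h ?mulg1.
    exact: Or43.
  exact: Or44.
have ES y : y \in E -> y != 1 -> y \in S.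
  by case/EP=> -> //; rewrite eqxx.
have e1 : e != 1 by apply: contraNneq nXe => ->; apply: group1.
have nes : e != s by apply: contraNneq nXe => ->.
have oE : #|E| = 4.
  have s1E : <[s]> \subset E by rewrite cycle_subG.
  have e4 : #|E| <= 4.
    apply: (@leq_trans #|e |: [set e * s] :|: <[s]>|).
      apply/subset_leq_card/subsetP=> y /EP[]->; rewrite !inE ?group1 ?cycle_id ?eqxx ?orbT //.
    rewrite (leq_trans (leq_card_setU _ _)) // -orderE (nt_prime_order _ s2) //.
    by rewrite (leq_add2r 2 _ 2) cards2 ltnS leq_b1.
  have := cardSg s1E; rewrite -orderE (nt_prime_order _ s2) //.
  have : 2 < #|E|.
    rewrite -[2](nt_prime_order _ s2) // orderE proper_card // properE s1E /=.
    apply/subsetPn; exists e => //.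
    by rewrite cycle2g ?(nt_prime_order _ s2) // !inE negb_or e1.
  by move: e4; case: #|E| => [|[|[|[|[|n]]]]].
pose Q := (coset Z @*^-1 E)%G.
have nZ : Z <| G by apply/andP; rewrite center_sub.
have nQG : Q <| G by rewrite -(quotientGK nZ) cosetpre_normal.
have sQG := normal_sub nQG.
have QS y : y \in Q :\: Z -> coset Z y \in S.
  case/setDP=> Qy nZy; have ny : y \in 'N(Z) by rewrite (subsetP nZG) // (subsetP sQG).
  apply: ES; first by have := mem_quotient Z Qy; rewrite cosetpreK.
  by apply: contra nZy => /eqP; apply: coset_idr.
have oT : #|T| = 16.
  by rewrite -(Lagrange sZT) -card_quotient // oTb k2' oZ.
have [s' Xs' es'] := liftX s Xs.
(* The cyclic group [X] has [Z] as its only subgroup of order two, and [s'] lies outside [Z]. The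
   squares of all other elements of [Q] outside [Z] are conjugate to this one. *)
have ns' : s' ^+ 2 != 1.
  apply: contra s1 => /eqP s2'; have [s1'|s1'] := eqVneq s' 1.
    by rewrite es' s1' morph1.
  rewrite es'; apply/eqP/coset_id.
  have /eqP <- : <[s']> == Z.
    rewrite (eq_subG_cyclic cX) ?cycle_subG //= oZ.
    by rewrite -orderE (nt_prime_order _ s2').
  exact: cycle_id.
have Gs' : s' \in G by rewrite (subsetP sTG) // (subsetP sXT).
exists Q; split=> //.
  split; first exact: sub_cosetpre.
    by rewrite card_cosetpre oE /= oZ.
  move=> y Qy; have Sy := QS y Qy.
  have Gy : y \in G by case/setDP: Qy => /(subsetP sQG).
  have [g Gg ->] : exists2 g, g \in G & y ^+ 2 = (s' ^+ 2) ^ g.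
    by apply: conj_mod_sqr; rewrite // -es'.
  rewrite conjg_eq1 ns' memJ_norm ?(subsetP nZG) //; split=> //.
  apply: coset_idr; first by rewrite groupX // (subsetP nZG).
  by rewrite morphX ?(subsetP nZG) //= -es'.
  apply: contra nvE => Qv; have := mem_quotient Z Qv; by rewrite cosetpreK.
move=> y z /QS Sy /QS Sz; by rewrite (class_eqP Sz).
Qed.
End Trichotomy16.

(* If [G / Z(G)] has a centre of order two, induction applies to it, and only the
   first case can occur there since [T / Z(G)] has no quaternion subgroup. *)
Theorem trichotomy m : forall (gT : finGroupType) (G T : {group gT}) (v : gT),
  #|G| <= m -> cent4 G v -> 2.-Sylow(G) T -> 'C_G[v] \subset T ->
  [\/ has_2compl G,
      [/\ #|T| = 8, quat8 'Z(G)%G T, 'C_(G / 'Z(G))[coset 'Z(G) v] = T / 'Z(G)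
        & {in T :\: 'Z(G), forall x,
             coset 'Z(G) x \in coset 'Z(G) v ^: 'N_(G / 'Z(G))(T / 'Z(G))}]
    | exists Q : {group gT},
       [/\ Q <| G, quat8 'Z(G)%G Q, v \notin Q, #|T| = 16
        & {in Q :\: 'Z(G) &, forall x y,
             coset 'Z(G) x \in coset 'Z(G) y ^: (G / 'Z(G))}]].
Proof.
elim: m => [|m IHm] gT G T v; first by rewrite leqNgt cardG_gt0.
move=> leGm cGv sylT sCT; have [oZ Gv nZv oC] := cGv.
have pT := pHall_pgroup sylT.
have [n oT] := p_natP pT.
have : 4 <= #|T| by rewrite -oC subset_leq_card.
rewrite {1}oT (@leq_exp2l 2 2) // => n2.
have [n4 | n3] := ltnP 3 n; last first.
  have [e | e] : n = 2 \/ n = 3 by case: n n2 n3 {oT} => [|[|[|[|n]]]] //; [left | right].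
    by rewrite e in oT; apply: Or31; apply: (trichotomy4 cGv sylT sCT).
  rewrite e in oT.
  by have [h|[h1 h2 h3]] := trichotomy8 cGv sylT sCT oT; [apply: Or31 | apply: Or32].
have T16 : 16 <= #|T| by rewrite oT (@leq_exp2l 2 4).
have [[oZb nZvb noQ] | h] := trichotomy16 cGv sylT sCT T16; last exact: Or33.
apply: Or31; apply: (@quotient_2compl _ G 'Z(G)%G) => //=.
have T4 : 4 < #|T| by apply: leq_trans T16.
have nZG : G \subset 'N('Z(G)) := gFnorm _ G.
have cGb : cent4 (G / 'Z(G))%G (coset 'Z(G) v).
  split=> //; first exact: mem_quotient.
  exact: (cent4_card_quo cGv sylT sCT T4).
have sylTb : 2.-Sylow(G / 'Z(G)) (T / 'Z(G)).
  by apply: quotient_pHall => //; apply: subset_trans (pHall_sub sylT) nZG.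
have lem : #|G / 'Z(G)| <= m.
  by rewrite -ltnS (leq_trans _ leGm) // ltn_quotient ?center_sub // -cardG_gt1 oZ.
have sCTb : 'C_(G / 'Z(G))[coset 'Z(G) v] \subset T / 'Z(G).
  exact: (cent4_quo_sub cGv sylT sCT T4).
have [//|[_ qT _ _]|[Q [nQ qQ _ _ _]]] := IHm _ (G / 'Z(G))%G (T / 'Z(G))%G _ lem cGb sylTb sCTb.
  by case: (noQ (T / 'Z(G))%G).
have pQ : 2.-group Q by case: qQ => _ oQ _; rewrite /pgroup oQ.
by case: (noQ Q) => //; apply: normal_sub_max_pgroup (Hall_max sylTb) pQ nQ.
Qed.

Lemma part3_12 : (12`_3 = 3)%N.
Proof. by rewrite -[12%N]/(4 * 3)%N partnM // part_p'nat // part_pnat_id. Qed.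

Lemma part3_36 : (36`_3 = 9)%N.
Proof. by rewrite -[36%N]/(4 * 9)%N partnM // part_p'nat // part_pnat_id. Qed.

Lemma part3_60 : (60`_3 = 3)%N.
Proof. by rewrite -[60%N]/(20 * 3)%N partnM // part_p'nat // part_pnat_id. Qed.

(** * Groups with a self-centralising fused Sylow four-group *)

Section FusedFour.
Variables (gT : finGroupType) (X V : {group gT}) (v : gT).
Hypotheses (sylV : 2.-Sylow(X) V) (oV : #|V| = 4) (cV : 'C_X[v] = V).
Hypothesis fV : {in V^#, forall x, x \in v ^: 'N_X(V)}.
Let H := 'N_X(V)%G.

Let sVX : V \subset X. Proof. exact: pHall_sub sylV. Qed.
Let sVH : V \subset H. Proof. by rewrite subsetI sVX normG. Qed.
Let sHX : H \subset X. Proof. exact: subsetIl. Qed.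
Let nVH : V <| H. Proof. by rewrite /normal sVH subsetIr. Qed.
Let Xv : v \in X.
Proof.
have [u Vu u1] : exists2 u, u \in V & u != 1 by apply/trivgPn; rewrite -cardG_gt1 oV.
have /imsetP[h Hh e] : u \in v ^: H by apply: fV; rewrite !inE u1.
by rewrite -(memJ_norm v (subsetP (normG X) h (subsetP sHX h Hh))) -e (subsetP sVX).
Qed.
Lemma four_memv : v \in V. Proof. by rewrite -cV inE Xv cent1id. Qed.
Let Vv := four_memv.

Lemma four_v1 : v != 1.
Proof.
have [u Vu u1] : exists2 u, u \in V & u != 1 by apply/trivgPn; rewrite -cardG_gt1 oV.
have /imsetP[h Hh e] : u \in v ^: H by apply: fV; rewrite !inE u1.
by apply: contraNneq u1 => v1; rewrite e v1 conj1g.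
Qed.

Lemma four_cent u : u \in V -> u != 1 -> 'C_X[u] = V.
Proof.
move=> Vu u1; have /imsetP[h Hh ->] : u \in v ^: H by apply: fV; rewrite !inE u1.
have [Xh Nh] := setIP Hh.
by rewrite cent1J -{1}(conjGid Xh) -conjIg cV (normP Nh).
Qed.

(** The nonidentity elements of [V] have the same order; were it four, [v ^+ 2] would be one of
    order two. *)
Lemma four_v2 : v ^+ 2 = 1.
Proof.
apply/eqP/idPn=> v2; have V2 : v ^+ 2 \in V by rewrite groupX.
have /imsetP[h Hh e] : v ^+ 2 \in v ^: H by apply: fV; rewrite !inE v2.
have := orderJ v h; rewrite -e => o2.
have o4 : #[v] %| 4 by rewrite -oV order_dvdG.
case/dvdn4: o4 => o.
- by move/eqP: o; rewrite order_eq1 (negbTE four_v1).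
- by move: v2; rewrite -order_dvdn o.
by move: o2; rewrite orderXdiv o.
Qed.

Lemma four_sqr u : u \in V -> u ^+ 2 = 1.
Proof.
move=> Vu; have [->|u1] := eqVneq u 1; first by rewrite expg1n.
have /imsetP[h Hh ->] : u \in v ^: H by apply: fV; rewrite !inE u1.
by rewrite -conjXg four_v2 conj1g.
Qed.

Lemma four_cardH : #|H| = 12.
Proof.
have cl : v ^: H = V^#.
  apply/eqP; rewrite eqEsubset; apply/andP; split; last by apply/subsetP=> x /fV.
  apply/subsetP=> _ /imsetP[h /setIP[_ Nh] ->].
  by rewrite !inE conjg_eq1 four_v1 memJ_norm.
have sVc : V \subset 'C[v] by rewrite -{1}cV subsetIr.
have eC : 'C_H[v] = V.
  apply/eqP; rewrite eqEsubset subsetI sVH sVc !andbT.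
  by apply: subset_trans (setSI _ sHX) _; rewrite cV.
have := index_cent1 H v; rewrite cl eC cardsDS ?sub1G // cards1 oV => iH.
by rewrite -(Lagrange sVH) oV iH.
Qed.

(** [V] is the centraliser of each of its nonidentity elements, so conjugating one of them into [V]
    carries [V] to itself. *)
Lemma four_TI x u : x \in X -> u \in V -> u != 1 -> u ^ x \in V -> x \in H.
Proof.
move=> Xx Vu u1 Vux; rewrite inE Xx; apply/normP.
have e1 := four_cent Vu u1; have e2 := four_cent Vux.
by rewrite -[in LHS]e1 conjIg conjGid // -cent1J e2 ?conjg_eq1.
Qed.

(** By Sylow's theorem and the fusion in [V], this class consists of all involutions of [X]; see
    [involP]. *)
Definition invols := v ^: X.

Lemma involP i : i \in X -> (i \in invols) = (i ^+ 2 == 1) && (i != 1).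
Proof.
move=> Xi; apply/idP/andP=> [/imsetP[x Xx ->] | [/eqP i2 i1]].
  by rewrite -conjXg four_v2 conj1g eqxx conjg_eq1 four_v1.
have p2 : 2.-group <[i]> by rewrite /pgroup -orderE (nt_prime_order _ i2).
have siX : <[i]> \subset X by rewrite cycle_subG.
have [x Xx] := Sylow_Jsub sylV siX p2; rewrite -cycleJ cycle_subG => Vix.
have /fV/imsetP[h /setIP[Xh _] e] : i ^ x \in V^# by rewrite !inE conjg_eq1 i1.
by rewrite -(conjgK x i) e -conjgM memJ_class // groupM ?groupV.
Qed.

Lemma card_invols : #|invols| = (3 * #|X : H|)%N.
Proof.
rewrite /invols -index_cent1 cV -(Lagrange_index sHX sVH) mulnC; congr (_ * _)%N.
by rewrite -divgS // oV four_cardH.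
Qed.

Lemma involH : invols :&: H = V^#.
Proof.
apply/setP=> i; rewrite inE [in RHS]in_setD1; apply/andP/andP=> [[Ii Hi] | [i1 Vi]].
  have Xi := subsetP sHX i Hi; move: Ii; rewrite involP // => /andP[/eqP i2 i1].
  split=> //; rewrite (mem_normal_Hall (pHall_subl sVH sHX sylV)) //.
  by rewrite /p_elt (nt_prime_order _ i2).
by rewrite (subsetP sVH) // involP ?(subsetP sVX) // four_sqr ?eqxx.
Qed.

(** An involution common to [H] and [H :^ x] would lie in [V] and in its conjugate, which [four_TI]
    forbids; of the order 12 only a factor of three is left. *)
Lemma four_oddI x : x \in X :\: H -> #|H :&: H :^ x| %| 3.
Proof.
case/setDP=> Xx nHx.
have o12 : #|H :&: H :^ x| %| 4 * 3.
  by have := cardSg (subsetIl H (H :^ x)); rewrite four_cardH.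
suff cop : coprime #|H :&: H :^ x| 4 by rewrite Gauss_dvdr in o12.
rewrite coprime_sym (@coprime_pexpl 2 2) // prime_coprime //; apply/negP.
case/(Cauchy (isT : prime 2)) => u /setIP[Hu Hxu] ou.
have u1 : u != 1 by rewrite -order_gt1 ou.
have Vof w : w \in H -> #[w] = 2 -> w \in V.
  move=> Hw ow; rewrite (mem_normal_Hall (pHall_subl sVH sHX sylV)) //.
  by rewrite /p_elt ow.
rewrite mem_conjg in Hxu.
have Vu' : u ^ x^-1 \in V by rewrite Vof ?orderJ.
case/negP: nHx; apply: (@four_TI x (u ^ x^-1)) => //; first by rewrite conjg_eq1.
by rewrite conjgKV Vof.
Qed.

(** For two involutions [i], [j] of one coset, [j * i] lies in [H] and [i] inverts it, so it lies in
    [H :&: H :^ i], of order at most three. *)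
Lemma inv_coset_le C : C \in rcosets H X :\ (H : {set gT}) ->
  #|[set i in invols :\: H | H :* i == C]| <= 3.
Proof.
move=> /setD1P[nC /rcosetsP[x Xx eC]].
have [->|[i]] := set_0Vmem [set i in invols :\: H | H :* i == C]; first by rewrite cards0.
rewrite inE => /andP[/setDP[Ii nHi] /eqP ei].
have Xi : i \in X by move: (Ii); apply: subsetP; apply: class_subG.
have i2 : i ^+ 2 = 1 by move: Ii; rewrite involP // => /andP[/eqP].
have iV : i^-1 = i by apply/eqP; rewrite eq_invg_mul -expg2 i2.
have o3 : #|H :&: H :^ i| <= 3 by apply/dvdn_leq/four_oddI; rewrite // inE nHi.
apply: leq_trans o3; rewrite -(card_rcoset (H :&: H :^ i) i) subset_leq_card //.
apply/subsetP=> j; rewrite inE => /andP[/setDP[Ij nHj] /eqP ej].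
have Xj : j \in X by move: (Ij); apply: subsetP; apply: class_subG.
have j2 : j ^+ 2 = 1 by move: Ij; rewrite involP // => /andP[/eqP].
have jV : j^-1 = j by apply/eqP; rewrite eq_invg_mul -expg2 j2.
have Hji : j * i^-1 \in H by rewrite -mem_rcoset ei -ej rcoset_refl.
rewrite mem_rcoset inE Hji mem_conjg conjgE invgK iV.
by rewrite iV in Hji; rewrite -(mulgA j) -expg2 i2 mulg1 -[i * j]invgK invMg iV jV groupV.
Qed.

(** There are three times as many involutions outside [H] as nontrivial cosets, and no such coset
    has more than three; so equality holds throughout. *)
Lemma inv_coset_eq x : x \in X :\: H ->
  #|[set i in invols :\: H | H :* i == H :* x]| = 3.
Proof.
move=> Xx; pose P := rcosets H X :\ (H : {set gT}).
have cnt : #|invols :\: H| = (\sum_(C in P) #|[set i in invols :\: H | H :* i == C]|)%N.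
  rewrite -sum1_card (partition_big (fun i => H :* i) (mem P)) /=; last first.
    move=> i /setDP[Ii nHi]; apply/setD1P; split.
      by apply: contraNneq nHi => <-; apply: rcoset_refl.
    by rewrite mem_rcosets mulSGid // (subsetP _ _ Ii) // class_subG.
  apply: eq_bigr => C _; rewrite -sum1_card; apply: eq_bigl => i.
  by rewrite inE.
have le3 : (\sum_(C in P) #|[set i in invols :\: H | H :* i == C]| <=
   \sum_(C in P) 3 ?= iff [forall (C | C \in P), #|[set i in invols :\: H | H :* i == C]| == 3])%N.
  apply: leqif_sum => C PC; split; rewrite ?inv_coset_le //.
have oP : #|P| = #|X : H|.-1.
  rewrite /P; have := cardsD1 (H : {set gT}) (rcosets H X).
  have -> : (H : {set gT}) \in rcosets H X.
    by apply/rcosetsP; exists 1; rewrite ?group1 ?rcoset_id.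
  by rewrite add1n -[#|rcosets H X|]/#|X : H| => ->.
have oI : #|invols :\: H| = (3 * #|X : H|.-1)%N.
  rewrite cardsD involH cardsDS ?sub1G // cards1 oV card_invols.
  by rewrite -subn1 mulnBr muln1.
have eq3 : [forall (C | C \in P), #|[set i in invols :\: H | H :* i == C]| == 3].
  by rewrite -(le3.2) -cnt oI sum_nat_const oP mulnC.
have [Xx' nHx] := setDP Xx.
apply/eqP; apply: (forall_inP eq3); apply/setD1P; split.
  by apply: contraNneq nHx => <-; apply: rcoset_refl.
by rewrite mem_rcosets mulSGid.
Qed.

(* The three involutions of a coset [H x] are the [h i] with [h] in
   [H :&: H :^ i], a group whose order divides three. *)
Lemma inv_coset x : x \in X :\: H ->
  #|H :&: H :^ x| = 3 /\
  exists i, [/\ i \in H :* x, H :&: H :^ x = H :&: H :^ i & {subset (H :&: H :^ x) :* i <= invols}].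
Proof.
move=> Xx; have [Xx' nHx] := setDP Xx; have := inv_coset_eq Xx.
set S := finset _ => oS.
have SP i : i \in S -> [/\ i \in invols, i^-1 = i & i \in H :* x].
  rewrite inE => /andP[/setDP[Ii nHi] /eqP ei].
  have Xi : i \in X by move: (Ii); apply: subsetP; apply: class_subG.
  split=> //; last by rewrite -ei rcoset_refl.
  by apply/eqP; rewrite eq_invg_mul -expg2; move: Ii; rewrite involP // => /andP[].
have [i0 Si0] : exists i, i \in S by apply/set0Pn; rewrite -card_gt0 oS.
have [_ i0V Hxi0] := SP i0 Si0.
have HI i : i \in H :* x -> H :&: H :^ x = H :&: H :^ i.
  by case/rcosetP=> h Hh ->; rewrite conjsgM (conjGid Hh).
have sub : S \subset (H :&: H :^ x) :* i0.
  apply/subsetP=> j Sj; have [_ jV Hxj] := SP j Sj.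
  have Hji : j * i0^-1 \in H.
    by rewrite -mem_rcoset (rcoset_eqP Hxi0).
  rewrite mem_rcoset (HI i0) // inE Hji mem_conjg conjgE invgK i0V.
  rewrite i0V in Hji; rewrite -(mulgA j) -{3}i0V mulgV mulg1.
  by rewrite -[i0 * j]invgK invMg i0V jV groupV.
have o3 : #|H :&: H :^ x| = 3.
  apply/eqP; rewrite eqn_leq dvdn_leq ?four_oddI //= -oS.
  by rewrite -(card_rcoset (H :&: H :^ x) i0) subset_leq_card.
have eS : S = (H :&: H :^ x) :* i0.
  by apply/eqP; rewrite eqEcard sub card_rcoset o3 oS.
split=> //; exists i0; split=> //; first exact: HI.
by move=> y; rewrite -eS => /SP[].
Qed.

Section OrderThree.
Variable D : {group gT}.
Hypotheses (sDH : D \subset H) (oD : #|D| = 3).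

(** An involution [u] of [V] normalising [D] would centralise it, as commutators fall into
    [V :&: D = 1]; but ['C_X[u] = V]. So the normaliser meets [V] trivially and has order at most
    three. *)
Lemma three_normH : 'N_H(D) = D.
Proof.
have tiN : V :&: 'N_H(D) = 1.
  apply/trivgP/subsetP=> u /setIP[Vu /setIP[Hu Nu]]; rewrite inE; apply/idPn=> u1.
  have tiVD : V :&: D = 1 by rewrite coprime_TIg // oV oD.
  have cuD : D \subset 'C[u].
    apply/subsetP=> d Dd; apply/cent1P/commute_sym/commgP; rewrite -in_set1 -set1gE -tiVD.
    apply/setIP; split.
      have nd : d \in 'N(V) by have /setIP[] := subsetP sDH d Dd.
      by rewrite commgEl groupM ?groupV // memJ_norm.
    by rewrite commgEr groupM // memJ_norm ?groupV.
  have : D \subset V.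
    by rewrite -(four_cent Vu u1) subsetI (subset_trans sDH sHX).
  by move/setIidPr=> e; move: oD; rewrite -e tiVD cards1.
apply/esym/eqP; rewrite eqEcard subsetI sDH normG oD /=.
have : #|V * 'N_H(D)| <= 12 by rewrite -four_cardH subset_leq_card // mul_subG // subsetIl.
by rewrite TI_cardMg // oV -[12]/(4 * 3)%N leq_pmul2l.
Qed.

(** Here [H :&: H :^ y] is [D], so the involutions of [H :* y] form a coset [D :* i] with [i]
    normalising [D]. As [y * i^-1] lies in ['N_H(D) = D], the element [y] is one of them. *)
Lemma three_norm_invol y : y \in 'N_X(D) -> y \notin H ->
  y \in invols /\ D :=: H :&: H :^ y.
Proof.
case/setIP=> Xy Ny nHy; have [] := @inv_coset y; first by rewrite inE nHy.
move=> o3 [i [Hyi eI sI]].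
have eD : D :=: H :&: H :^ y.
  apply/eqP; rewrite eqEcard o3 oD leqnn andbT subsetI sDH /= -{1}(normP Ny).
  by rewrite conjSg.
split=> //; have Ii : i \in invols by apply: sI; rewrite -eD rcoset_refl.
have Xi : i \in X by move: (Ii); apply: subsetP; apply: class_subG.
have i2 : i ^+ 2 = 1 by move: Ii; rewrite involP // => /andP[/eqP].
have Ni : i \in 'N(D).
  have eDi : D :=: H :&: H :^ i by rewrite eD.
  by rewrite inE eDi conjIg -conjsgM -expg2 i2 conjsg1 setIC.
apply: sI; rewrite -eD mem_rcoset -three_normH inE.
by rewrite -mem_rcoset (rcoset_eqP Hyi) rcoset_refl groupM // groupV.
Qed.

(** An element outside [H] centralising [D] would be an involution, whose centraliser of order four
    has no room for [D]. *)
Lemma three_cent : 'C_X(D) = D.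
Proof.
have cDD : D \subset 'C(D) by rewrite -abelianE cyclic_abelian // prime_cyclic ?oD.
apply/eqP; rewrite eqEsubset subsetI cDD (subset_trans sDH sHX) !andbT.
apply/subsetP=> y /setIP[Xy cy].
have Ny : y \in 'N_X(D) by rewrite inE Xy (subsetP (cent_sub D)).
have [Hy | nHy] := boolP (y \in H).
  by rewrite -three_normH inE Hy; case/setIP: Ny.
have [Iy _] := three_norm_invol Ny nHy.
have sDC : D \subset 'C_X[y] by rewrite subsetI (subset_trans sDH) //= sub_cent1.
have : #|'C_X[y]| = 4 by rewrite (card_cent1_class Iy) cV oV.
by move=> o4; have := cardSg sDC; rewrite o4 oD.
Qed.

Lemma three_norm_inv y : y \in 'N_X(D) -> y \notin H -> acts_by_inversion y D.
Proof.
move=> Ny nHy; have [Iy _] := three_norm_invol Ny nHy; case/setIP: Ny => Xy Ny.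
have y2 : y ^+ 2 = 1 by move: Iy; rewrite involP // => /andP[/eqP].
apply: fixfree_inversion; rewrite ?y2 ?group1 //.
have : #|'C_X[y]| = 4 by rewrite (card_cent1_class Iy) cV oV.
move=> o4; apply/trivgP; rewrite -(_ : D :&: 'C_X[y] = 1).
  by rewrite setIA setSI // subsetI subxx (subset_trans sDH).
by rewrite coprime_TIg // oD o4.
Qed.

Lemma three_norm_coset y : y \in 'N_X(D) -> y \notin H -> 'N_X(D) = D :|: y *: D.
Proof.
move=> Ny nHy; have [Xy Ny'] := setIP Ny.
apply/setP=> w; apply/idP/setUP=> [Nw | ].
  have [Hw|nHw] := boolP (w \in H).
    by left; rewrite -three_normH inE Hw; case/setIP: Nw.
  right; have [Iy _] := three_norm_invol Ny nHy.
  have yV : y^-1 = y.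
    by apply/eqP; rewrite eq_invg_mul -expg2; move: Iy; rewrite involP // => /andP[].
  rewrite mem_lcoset yV -three_cent inE; case/setIP: Nw (Nw) => Xw _ Nw.
  by rewrite groupM //= two_inversions_cent //; apply: three_norm_inv.
have sDN : D \subset 'N_X(D) by rewrite subsetI normG (subset_trans sDH).
case=> [/(subsetP sDN) // | /lcosetP[d Dd ->]].
by rewrite groupM // (subsetP sDN).
Qed.

Lemma three_outside_le : #|'N_X(D) :\: H| <= 3.
Proof.
have [->|[y /setDP[Ny nHy]]] := set_0Vmem ('N_X(D) :\: H); first by rewrite cards0.
rewrite -oD -(card_lcoset D y) subset_leq_card //; apply/subsetP=> w.
rewrite (three_norm_coset Ny nHy) => /setDP[/setUP[Dw | //]].
by rewrite (subsetP sDH).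
Qed.

End OrderThree.

Let card_SylH : #|'Syl_3(H)| = 4.
Proof.
have [D sylD] := Sylow_exists 3 H.
have sDH := pHall_sub sylD.
have oD : #|D| = 3 by rewrite (card_Hall sylD) four_cardH part3_12.
by rewrite (card_Syl sylD) (three_normH sDH oD) -divgS // four_cardH oD.
Qed.

Lemma three_exists x : x \in X :\: H ->
  exists (D : {group gT}) i,
    [/\ D \subset H, #|D| = 3, i \in invols, i \in 'N_X(D) & i \notin H].
Proof.
move=> Xx; have [Xx' nHx] := setDP Xx; have [o3 [i [Hxi eI sI]]] := inv_coset Xx.
have nHi : i \notin H.
  by apply: contra nHx => Hi; case/rcosetP: Hxi Hi => h Hh ->; rewrite groupMl.
have Ii : i \in invols by apply: sI; rewrite rcoset_refl.
have Xi : i \in X by move: (Ii); apply: subsetP; apply: class_subG.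
have i2 : i ^+ 2 = 1 by move: Ii; rewrite involP // => /andP[/eqP].
exists (H :&: H :^ i)%G, i; split; rewrite ?subsetIl //= -?eI //.
by rewrite inE Xi inE /= eI conjIg -conjsgM -expg2 i2 conjsg1 setIC.
Qed.

(** An involution [i] outside [H] normalises [H :&: H :^ i], one of the four subgroups of order
    three in [H], and each of these is normalised by at most three elements outside [H]. With [n]
    the index of [H], an odd number, this gives [3 * (n - 1) <= 12]. The value three fails: an
    abelian Sylow subgroup of order nine would centralise a subgroup of order three. *)
Lemma fused_card : X :=: H \/ #|X| = 60.
Proof.
have [sXH | /subsetPn[x Xx nHx]] := boolP (X \subset H).
  by left; apply/eqP; rewrite eqEsubset sXH.
right; pose n := #|X : H|.
have oX : #|X| = (12 * n)%N by rewrite -(Lagrange sHX) four_cardH.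
have n1 : n != 1%N by rewrite indexg_eq1; apply/subsetPn; exists x.
have oddn : odd n.
  have := pHall_sub sylV; case/and3P: sylV => _ _; rewrite -odd_2'nat => o _.
  by apply: dvdn_odd o; rewrite -(Lagrange_index sHX sVH) dvdn_mulr.
have oI : #|invols :\: H| = (3 * n.-1)%N.
  rewrite cardsD involH cardsDS ?sub1G // cards1 oV card_invols.
  by rewrite -subn1 mulnBr muln1.
have n5 : n <= 5.
  have : (3 * n.-1 <= 12)%N.
    rewrite -oI -sum1_card (partition_big (fun i => (H :&: H :^ i)%G) (mem 'Syl_3(H))) /=.
      apply: (@leq_trans (\sum_(D in 'Syl_3(H)) 3)%N); last by rewrite sum_nat_const card_SylH.
      apply: leq_sum => D; rewrite inE => sylD; have sDH := pHall_sub sylD.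
      have oD : #|D| = 3 by rewrite (card_Hall sylD) four_cardH part3_12.
      apply: leq_trans (three_outside_le sDH oD); rewrite sum1_card subset_leq_card //.
      apply/subsetP=> i; rewrite unfold_in => /andP[/setDP[Ii nHi] /eqP eD].
      have Xi : i \in X by move: (Ii); apply: subsetP; apply: class_subG.
      have i2 : i ^+ 2 = 1 by move: Ii; rewrite involP // => /andP[/eqP].
      rewrite inE nHi inE Xi inE -eD /= conjIg -conjsgM -expg2 i2 conjsg1 setIC //.
    move=> i /setDP[Ii nHi]; have Xi : i \in X by move: (Ii); apply: subsetP; apply: class_subG.
    have [|o3 _] := @inv_coset i; first by rewrite inE nHi.
    by rewrite inE pHallE subsetIl o3 four_cardH part3_12.
  by rewrite -[12]/(3 * 4)%N leq_pmul2l //; case: (n).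
have : n = 3 \/ n = 5 by case: (n) n1 oddn n5 => [|[|[|[|[|[|k]]]]]] //; [left | right].
case=> en; last by rewrite oX en.
have [D [i [sDH oD _ _ _]]] := @three_exists x ltac:(by rewrite inE nHx).
have [|P sylP sDP] := @Sylow_superset 3 _ _ D (subset_trans sDH sHX); first by rewrite /pgroup oD.
have oP : #|P| = 9 by rewrite (card_Hall sylP) oX en part3_36.
have aP : abelian P by apply: (card_p2group_abelian (isT : prime 3)).
have : P \subset 'C_X(D) by rewrite subsetI (pHall_sub sylP) (subset_trans aP) // centS.
by rewrite (three_cent sDH oD) => /subset_leq_card; rewrite oP oD.
Qed.

Lemma fused_part3 : (#|X|`_3 = 3)%N.
Proof.
case: fused_card => [eX | ->]; last exact: part3_60.
by rewrite eX four_cardH part3_12.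
Qed.

Lemma exists_D : exists D : {group gT}, D \subset H /\ #|D| = 3.
Proof.
have [D sylD] := Sylow_exists 3 H; exists D; rewrite (pHall_sub sylD).
by rewrite (card_Hall sylD) four_cardH part3_12.
Qed.

Lemma order_three_cent x : x \in X -> #[x] = 3 -> 'C_X[x] = <[x]>.
Proof.
move=> Xx ox; have [D [sDH oD]] := exists_D.
have sDX := subset_trans sDH sHX.
have sylD : 3.-Sylow(X) D by rewrite pHallE sDX oD fused_part3.
have px : 3.-group <[x]> by rewrite /pgroup -orderE ox.
have sxX : <[x]> \subset X by rewrite cycle_subG.
have [g Xg sxD] := Sylow_Jsub sylD sxX px.
have {}sxD : <[x ^ g]> = D.
  by apply/eqP; rewrite cycleJ eqEcard sxD oD cardJg -orderE ox.
apply: (@conjsg_inj _ g); rewrite conjIg -cent1J conjGid // -cycleJ sxD.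
by rewrite -cent_cycle sxD (three_cent sDH).
Qed.

Lemma involX i : i \in invols -> i \in X.
Proof. by apply: subsetP; apply: class_subG. Qed.

Lemma cent_noninvol x : x \in X -> x != 1 -> x \notin invols ->
  #[x] = 3 /\ #|'C_X[x]| = 3 \/ [/\ #|X| = 60, #|'C_X[x]| = 5 & #[x] <> 3].
Proof.
move=> Xx x1 nIx.
have oddC : odd #|'C_X[x]|.
  apply/negPn/negP; rewrite -dvdn2 => /(Cauchy (isT : prime 2))[u /setIP[Xu cu] ou].
  have Iu : u \in invols.
    by rewrite involP // -order_dvdn ou /= -order_gt1 ou.
  case/negP: nIx; have /imsetP[g Xg eu] := Iu.
  have : x ^ g^-1 \in 'C_X[v].
    rewrite inE groupJ ?groupV //= -[v](conjgK g) -eu; apply/cent1P.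
    by rewrite /commute -!conjMg; congr (_ ^ _); apply/esym/cent1P.
  rewrite cV => Vx; rewrite involP //; rewrite x1 andbT.
  by rewrite -[x](conjgKV g) -conjXg four_sqr ?conj1g.
have [d3 | nd3] := boolP (3 %| #|'C_X[x]|).
  left; have [y /setIP[Xy cy] oy] := Cauchy (isT : prime 3) d3.
  have : x \in 'C_X[y] by rewrite inE Xx cent1C.
  rewrite (order_three_cent Xy oy) => xy.
  have ox : #[x] = 3.
    have := order_dvdG xy; rewrite -orderE oy => /(prime_nt_dvdP (isT : prime 3)) -> //.
    by rewrite order_eq1.
  by rewrite (order_three_cent Xx ox) -orderE.
have C1 : #|'C_X[x]| != 1%N.
  by rewrite -trivg_card1; apply/trivgPn; exists x; rewrite // inE Xx cent1id.
have cop4 : coprime #|'C_X[x]| 4 by rewrite coprime_sym (@coprime_pexpl 2 2) // coprime2n.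
have cop3 : coprime #|'C_X[x]| 3 by rewrite coprime_sym prime_coprime.
have dX : #|'C_X[x]| %| #|X| by rewrite cardSg ?subsetIl.
case: fused_card => [eX | oX].
  move: dX; rewrite {2}eX four_cardH -[12%N]/(4 * 3)%N Gauss_dvdr //.
  by move/(prime_nt_dvdP (isT : prime 3)) => e; rewrite e // in nd3.
right; move: dX; rewrite oX -[60%N]/(4 * (3 * 5))%N !Gauss_dvdr //.
move/(prime_nt_dvdP (isT : prime 5)) => /(_ C1) oC; split=> // ox.
by move: oC; rewrite (order_three_cent Xx ox) -orderE ox.
Qed.

Lemma card_invols12 : X :=: H -> #|invols| = 3.
Proof. by move=> eX; rewrite card_invols {1}eX indexgg. Qed.

(** * Order sixty: elements of order three and the braid relation *)

Section Sixty.
Hypothesis oX : #|X| = 60.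

Let iH : #|X : H| = 5.
Proof. by rewrite -divgS // oX four_cardH. Qed.

Lemma card_invols60 : #|invols| = 15.
Proof. by rewrite card_invols iH. Qed.

Lemma exists_outside : exists x, x \in X :\: H.
Proof.
have /subsetPn[x Xx nHx] : ~~ (X \subset H) by rewrite -indexg_eq1 iH.
by exists x; rewrite inE nHx.
Qed.

Lemma sixty_di : exists d i,
  [/\ d \in H, #[d] = 3, i \in invols, i \notin H & d ^ i = d^-1].
Proof.
have [x Xx] := exists_outside; have [D [i [sDH oD Ii Ni nHi]]] := three_exists Xx.
have /cyclicP[d eD] : cyclic D by rewrite prime_cyclic ?oD.
exists d, i; split=> //; first by rewrite (subsetP sDH) // eD cycle_id.
  by rewrite orderE -eD.
by apply: (three_norm_inv sDH oD Ni nHi); rewrite eD cycle_id.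
Qed.

Lemma order_three_class d i x :
  d \in X -> #[d] = 3 -> i \in X -> d ^ i = d^-1 -> x \in X -> #[x] = 3 -> x \in d ^: X.
Proof.
move=> Xd od Xi di Xx ox.
have pS y : y \in X -> #[y] = 3 -> 3.-Sylow(X) <[y]>.
  by move=> Xy oy; rewrite pHallE cycle_subG Xy -orderE oy fused_part3.
have [g Xg eg] := Sylow_trans (pS d Xd od) (pS x Xx ox).
have xdg : x \in <[d ^ g]> by rewrite cycleJ -eg cycle_id.
have [k k3 ex] : exists2 k, k < 3 & x = (d ^ g) ^+ k.
  have := cyclePmin xdg; rewrite orderJ od => -[k k3 ->]; by exists k.
case: k k3 ex => [|[|[|k]]] // _ ex.
- by rewrite ex expg0 order1 in ox.
- by rewrite ex expg1 memJ_class.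
have -> : x = (d ^ i) ^ g.
  rewrite ex di conjVg; apply/eqP; rewrite eq_sym eq_invg_mul -expgS.
  by rewrite -order_dvdn orderJ od.
by rewrite -conjgM memJ_class // groupM.
Qed.

Lemma card_class3 d : d \in X -> #[d] = 3 -> #|d ^: X| = 20.
Proof.
move=> Xd od; rewrite -index_cent1 (order_three_cent Xd od) -divgS ?cycle_subG //.
by rewrite oX -orderE od.
Qed.

Section Braid.
Variables (d i : gT).
Hypotheses (Hd : d \in H) (od : #[d] = 3) (Ii : i \in invols) (nHi : i \notin H)
  (di : d ^ i = d^-1).

Let Xi : i \in X. Proof. exact: involX. Qed.
Let i2 : i * i = 1. Proof. by rewrite -expg2; move: Ii; rewrite involP // => /andP[/eqP]. Qed.
Let iV : i^-1 = i. Proof. by apply/eqP; rewrite eq_invg_mul i2. Qed.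

Lemma outside_conj u : u \in V -> u != 1 -> u ^ i \notin H.
Proof.
move=> Vu u1; apply: contra nHi => Hui.
have Vui : u ^ i \in V^#.
  have Xui : u ^ i \in X by rewrite groupJ // (subsetP sVX).
  have u2 : (u ^ i) ^+ 2 = 1 by rewrite -conjXg four_sqr // conj1g.
  by rewrite -involH inE Hui andbT involP // u2 eqxx conjg_eq1.
by apply: (@four_TI i u); case/setD1P: Vui.
Qed.

(** The four cosets [H :* (i * w)] are distinct, as equality of two would bring some
    [(w * w'^-1) ^ i] into [H]; with [H] they exhaust the index five. *)
Lemma braid_cover x : x \in X -> x \notin H -> exists2 w, w \in V & x \in H :* (i * w).
Proof.
move=> Xx nHx.
pose F w := H :* (i * w).
have injF : {in V &, injective F}.
  move=> w w' Vw Vw' eF; apply/eqP; rewrite eq_mulgV1; apply/negPn/negP=> ne.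
  have : i * w \in H :* (i * w') by rewrite -[H :* (i * w')]eF rcoset_refl.
  rewrite mem_rcoset invMg -mulgA (mulgA w) iV => Hi.
  have := @outside_conj (w * w'^-1); rewrite groupM ?groupV // => /(_ isT ne).
  by rewrite conjgE iV Hi.
have sF : F @: V \subset rcosets H X :\ (H : {set gT}).
  apply/subsetP=> _ /imsetP[w Vw ->]; apply/setD1P; split.
    apply: contraNneq nHi => e; have := rcoset_refl H (i * w); rewrite -/(F w) e.
    by rewrite groupMr // (subsetP sVH).
  by rewrite mem_rcosets mulSGid // groupM // (subsetP sVX).
have eF : F @: V = rcosets H X :\ (H : {set gT}).
  apply/eqP; rewrite eqEcard sF card_in_imset // oV.
  have := cardsD1 (H : {set gT}) (rcosets H X).
  have -> : (H : {set gT}) \in rcosets H X.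
    by apply/rcosetsP; exists 1; rewrite ?group1 ?rcoset_id.
  by rewrite add1n -[#|rcosets H X|]/#|X : H| iH => -[<-].
have : H :* x \in F @: V.
  rewrite eF; apply/setD1P; split; last by rewrite mem_rcosets mulSGid.
  by apply: contraNneq nHx => <-; apply: rcoset_refl.
by case/imsetP=> w Vw e; exists w; rewrite // -/(F w) -e rcoset_refl.
Qed.

Let Nd : d \in 'N(V). Proof. by case/setIP: Hd. Qed.
Let d3 : d * d * d = 1.
Proof. by rewrite -mulgA -expg2 -expgS -od expg_order. Qed.
Let dV : d^-1 = d * d. Proof. by apply/eqP; rewrite eq_invg_mul mulgA d3. Qed.

Lemma four_orbit u w : u \in V -> u != 1 -> w \in V -> w != 1 ->
  [\/ w = u, w = u ^ d | w = (u ^ d) ^ d].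
Proof.
move=> Vu u1 Vw w1.
have nd : u ^ d != u.
  apply/eqP=> /conjg_fixP/commgP cud.
  have : d \in 'C_X[u] by rewrite inE (subsetP sHX) //; apply/cent1P/commute_sym.
  by rewrite (four_cent Vu u1) => /order_dvdG; rewrite oV od.
have ndd : (u ^ d) ^ d != u.
  have hd3 y : ((y ^ d) ^ d) ^ d = y by rewrite -!conjgM mulgA d3 conjg1.
  by apply: contra nd => /eqP e; rewrite -{2}(hd3 u) e.
have e3 : [set (u ^ d) ^ d; u; u ^ d] = V^#.
  apply/eqP; rewrite eqEcard; apply/andP; split.
    apply/subsetP=> y; rewrite !inE -!orbA => /or3P[]/eqP->; rewrite ?conjg_eq1 ?u1 //.
      by rewrite !(memJ_norm _ Nd).
    by rewrite (memJ_norm _ Nd).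
  have nd2 : (u ^ d) ^ d != u ^ d by apply: contra nd => /eqP/conjg_inj->.
  rewrite -setUA cardsU1 cards2 !inE negb_or ndd nd2 [u == _]eq_sym nd.
  by rewrite cardsDS ?sub1G // cards1 oV.
have : w \in V^# by rewrite !inE w1.
rewrite -e3 !inE -!orbA => /or3P[]/eqP; [exact: Or33 | exact: Or31 | exact: Or32].
Qed.

(** Because [i] inverts [d], carrying [d] across [i] turns conjugation of [u] by [d] into
    conjugation of [w] by its inverse. *)
Lemma braid_equiv u w : i * u * i \in H :* (i * w) -> i * u ^ d * i \in H :* (i * w ^ d^-1).
Proof.
have e1 x : i * (d^-1 * x) = d * (i * x).
  by rewrite -{1}di conjgE iV !mulgA i2 mul1g.
have e2 x : d * (i * (d * x)) = i * x by rewrite -e1 mulKg.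
have e3 : d^-1 * i = i * d by rewrite -di conjgE iV -!mulgA i2 mulg1.
rewrite !mem_rcoset => Hu.
have -> : i * u ^ d * i * (i * w ^ d^-1)^-1 = d * (i * u * i * (i * w)^-1) * d.
  by rewrite !conjgE !invMg !invgK iV -!mulgA e1 e2 e3.
by rewrite groupM // groupM.
Qed.

(** By [braid_equiv] the rule sending [u] to [w] reverses the cyclic action of [d] on the three
    involutions of [V]. It is a reflection of a triangle and fixes a vertex, which is found by
    locating the value at [v] in the orbit of [v]. *)
Lemma braid_fix : exists q, [/\ q \in V, q != 1 & i * q * i \in H :* (i * q)].
Proof.
have v1 := four_v1.
have [w Vw Hw] : exists2 w, w \in V & i * v * i \in H :* (i * w).
  apply: braid_cover; first by rewrite !groupM.
  by have := outside_conj Vv v1; rewrite conjgE iV mulgA.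
have w1 : w != 1.
  apply: contraNneq nHi => ew; move: Hw; rewrite ew mulg1 mem_rcoset mulgK => Hiv.
  by move: Hiv; rewrite groupMr // (subsetP sVH).
have Hw1 := braid_equiv Hw.
have Vvd : v ^ d \in V by rewrite memJ_norm.
case: (four_orbit Vv v1 Vw w1) => ew.
- by exists v; rewrite -{4}ew.
- exists ((v ^ d) ^ d); rewrite !conjg_eq1 memJ_norm //; split=> //.
  rewrite ew conjgK in Hw1; have := braid_equiv Hw1.
  by rewrite dV [v ^ (d * d)]conjgM.
exists (v ^ d); rewrite conjg_eq1; split=> //.
by rewrite ew conjgK in Hw1.
Qed.

(** The element [h] is a conjugate of [i] lying in [H], hence in [V]. Inverting
    [h * i * q = i * q * i] gives [q * i * h = i * q * i], whence [q * h] commutes with [i] and must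
    be [1]. So [q * i * q = i * q * i], which for involutions is the stated relation. *)
Lemma braid : exists q, [/\ q \in V, q != 1 & (i * q) ^+ 3 = 1].
Proof.
have [q [Vq q1]] := braid_fix; rewrite mem_rcoset; set h := _ * _ => Hh.
have qq : q * q = 1 by rewrite -expg2 four_sqr.
have qV : q^-1 = q by apply/eqP; rewrite eq_invg_mul qq.
have eh : h = i ^ (i * q)^-1.
  by rewrite /h conjgE invgK invMg iV qV !mulgA.
have Vh : h \in V.
  have : h \in V^#; last by case/setD1P.
  rewrite -involH inE Hh andbT eh; case/imsetP: Ii => g Xg ->.
  by rewrite -conjgM memJ_class // groupM ?groupV // groupM ?groupJ // (subsetP sVX).
have A : h * i * q = i * q * i by rewrite -mulgA /h mulgKV.
clear eh; clearbody h.
have hh : h * h = 1 by rewrite -expg2 four_sqr.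
have hV : h^-1 = h by apply/eqP; rewrite eq_invg_mul hh.
have B : q * i * h = i * q * i.
  by have := congr1 (fun x => x^-1) A; rewrite /= !invMg iV qV hV !mulgA.
have aV : abelian V by apply: (card_p2group_abelian (isT : prime 2)); rewrite oV.
have hq : h * q = q * h by apply: (centsP aV).
have AB : h * i * q = q * i * h by rewrite A B.
have C : q * h * i = i * (q * h).
  have : q * (h * i * q) * q = q * (q * i * h) * q by rewrite AB.
  by rewrite !mulgA qq mul1g -(mulgA _ q q) qq mulg1 => ->; rewrite -!mulgA hq.
have qh1 : q * h = 1.
  apply/eqP/negPn/negP=> n1; have Vqh : q * h \in V by rewrite groupM.
  have : i \in 'C_X[q * h] by rewrite inE Xi; apply/cent1P.
  by rewrite (four_cent Vqh n1) => /(subsetP sVH); rewrite (negbTE nHi).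
have ehq : h = q by apply/eqP; rewrite -qV eq_sym eq_invg_mul qh1.
exists q; split=> //; rewrite ehq in A.
by rewrite expgSr expg2 !mulgA -A -(mulgA _ q q) qq mulg1 -(mulgA q i i) i2 mulg1 qq.
Qed.
End Braid.
End Sixty.
End FusedFour.

(** * Presentations *)

(** [D] is the graph of the isomorphism: it projects onto both groups, and the order bounds make
    both projections injective. For [D] generated by pairs of generators, an order bound from a
    presentation yields an isomorphism with known values. *)
Lemma pair_isom (gT rT : finGroupType) (G : {group gT}) (K : {group rT})
    (D : {group gT * rT}) :
  [set x.1 | x in D] = G -> [set x.2 | x in D] = K ->
  #|D| <= #|G| -> #|D| <= #|K| ->
  exists2 f : {morphism G >-> rT}, isom G K f & forall x, x \in D -> f x.1 = x.2.
Proof.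
move=> e1 e2 le1 le2.
have inj1 : {in D &, injective (fun x : gT * rT => x.1)}.
  by apply/imset_injP; rewrite eqn_leq leq_imset_card /= e1.
have inj2 : {in D &, injective (fun x : gT * rT => x.2)}.
  by apply/imset_injP; rewrite eqn_leq leq_imset_card /= e2.
pose s (g : gT) := odflt 1 [pick x in D | x.1 == g].
have sP g : g \in G -> s g \in D /\ (s g).1 = g.
  rewrite -{1}e1 => /imsetP[x Dx eg]; rewrite /s; case: pickP => [y /andP[Dy /eqP] // | /(_ x)].
  by rewrite Dx eg eqxx.
have sE x : x \in D -> s x.1 = x.
  move=> Dx; have Gx : x.1 \in G by rewrite -e1; apply: imset_f.
  by have [Ds es] := sP _ Gx; apply: inj1.
pose f g := (s g).2.
have fM : {in G &, {morph f : x y / x * y}}.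
  move=> x y Gx Gy; have [Dx ex] := sP x Gx; have [Dy ey] := sP y Gy.
  by rewrite /f -{1}ex -{1}ey -[(s x).1 * (s y).1]/((s x * s y).1) sE ?groupM.
exists (Morphism fM); last by move=> x Dx /=; rewrite /f sE.
apply/isomP; split.
  apply/injmP=> x y Gx Gy /=; have [Dx ex] := sP x Gx; have [Dy ey] := sP y Gy.
  by move=> exy; rewrite -ex -ey; congr (_.1); apply: inj2.
rewrite morphimE /= setIid -e2 -e1; apply/setP=> k; apply/imsetP/imsetP.
  case=> _ /imsetP[x Dx ->] ->; exists x => //; by rewrite /f sE.
by case=> x Dx ->; exists x.1; rewrite ?imset_f // /f sE.
Qed.

Lemma fst_gen (gT rT : finGroupType) (A : {set gT * rT}) :
  [set x.1 | x in <<A>>] = <<[set x.1 | x in A]>>.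
Proof.
have := morphim_gen [morphism of fst : gT * rT -> gT] (subsetT A).
by rewrite !morphimE !setTI.
Qed.

Lemma snd_gen (gT rT : finGroupType) (A : {set gT * rT}) :
  [set x.2 | x in <<A>>] = <<[set x.2 | x in A]>>.
Proof.
have := morphim_gen [morphism of snd : gT * rT -> rT] (subsetT A).
by rewrite !morphimE !setTI.
Qed.

Lemma join_cycle_bound (gT : finGroupType) (A : {group gT}) (y : gT) k m :
  0 < k -> y \in 'N(A) -> y ^+ k \in A -> #|A| <= m -> #|A <*> <[y]>| <= k * m.
Proof.
move=> k0 Ny Ayk Am; have nA : <[y]> \subset 'N(A) by rewrite cycle_subG.
have sAJ : A \subset A <*> <[y]> := joing_subl _ _.
rewrite -(Lagrange sAJ) mulnC leq_mul //.
rewrite -card_quotient ?join_subG ?normG // quotientYidl // quotient_cycle //.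
rewrite -orderE dvdn_leq // order_dvdn -morphX //; apply/eqP; exact: coset_id.
Qed.

(** In a finite group inverses are positive words, so stability under right multiplication by
    generators is enough; [S] will be a union of cosets. *)
Lemma gen_closed (gT : finGroupType) (A S : {set gT}) :
  1 \in S -> (forall x a, x \in S -> a \in A -> x * a \in S) -> <<A>> \subset S.
Proof.
move=> S1 SA; apply/subsetP=> _ /gen_prodgP[n [c Ac ->]].
elim: n c Ac => [|n IHn] c Ac; first by rewrite big_ord0.
by rewrite big_ord_recr /= SA // IHn.
Qed.

Lemma cycle_le (gT : finGroupType) (x : gT) k : 0 < k -> x ^+ k = 1 -> #|<[x]>| <= k.
Proof. by move=> k0 xk; rewrite -orderE dvdn_leq // order_dvdn xk. Qed.

(** Relations of [SL(2,3)] as a quaternion group extended by a group of order three: [q] and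
    [r = q ^ d] generate the quaternion group, and [d] sends [q] to [r] and [r] to [q * r]. *)
Definition rel24 (gT : finGroupType) (q d : gT) : Prop :=
  [/\ (q ^+ 2) ^+ 2 = 1, commute (q ^+ 2) d, d ^+ 3 = 1,
      q ^ (q ^ d) = q^-1 & (q ^ d) ^ d = q * q ^ d].

(** To [SL(2,3)] is added a lift [y] of the involution [i] from the group of order 60; the last
    relation lifts the one found in [braid], and the outcome is [SL(2,5)]. *)
Definition rel120 (gT : finGroupType) (q d y : gT) : Prop :=
  [/\ rel24 q d, y ^+ 2 = q ^+ 2, d ^ y = d^-1 & (y * q) ^+ 3 = 1].

(** Common to [GL(2,3)] and [J]: [a] and [b] generate [SL(2,3)], [v] swaps them, and [v ^+ 2] is [1]
    in the first group and [a ^+ 3] in the second. *)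
Definition rel48 (gT : finGroupType) (a b v : gT) : Prop :=
  [/\ a ^+ 3 = b ^+ 3, (a * b) ^+ 2 = a ^+ 3, a ^ v = b, b ^ v = a
    & v ^+ 2 \in <[a ^+ 3]>].

(** Adjoining [r] and then [d] to [<[q]>], of order at most four, multiplies the bound by two and by
    three. *)
Lemma rel24_bound (gT : finGroupType) (q d : gT) :
  rel24 q d -> #|<<[set q; d]>>| <= 24.
Proof.
case=> z2 czd d3 qr rd; set r := q ^ d in qr rd.
have oq : #|<[q]>| <= 4 by apply: cycle_le; rewrite // -[4]/(2 * 2)%N expgM.
have r2 : r ^+ 2 = q ^+ 2 by rewrite -conjXg; apply/conjg_fixP/commgP.
pose Q := (<[q]> <*> <[r]>)%G.
have oQ : #|Q| <= 8.
  apply: (@join_cycle_bound _ <[q]>%G r 2 4); rewrite // ?r2 ?mem_cycle //.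
  by rewrite inE -cycleJ cycle_subG qr groupV cycle_id.
have Qq : q \in Q by rewrite mem_gen // inE cycle_id.
have Qr : r \in Q by rewrite mem_gen // inE cycle_id orbT.
have oQd : #|Q <*> <[d]>| <= 24.
  apply: (@join_cycle_bound _ Q d 3 8); rewrite // ?d3 ?group1 //.
  by rewrite inE -genJ conjUg -!cycleJ join_subG !cycle_subG rd Qr groupM.
apply: leq_trans oQd; apply/subset_leq_card; rewrite gen_subG subUset !sub1set.
by rewrite !mem_gen // inE ?Qq ?cycle_id ?orbT.
Qed.

Lemma rel24_facts (gT : finGroupType) (q d : gT) (r := q ^ d) : rel24 q d ->
  [/\ q * d = d * r, r * d = d * (q * r), q * r * d = d * q,
      r * q = q ^+ 2 * (q * r) & q * r * q = r].
Proof.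
case=> z2 czd d3 qr rd; rewrite -/r in qr rd.
have r2 : r ^+ 2 = q ^+ 2 by rewrite -conjXg; apply/conjg_fixP/commgP.
have er : q ^ d = r by [].
have f5 : q * r * q = r by rewrite [q * r]conjgC qr mulgKV.
clearbody r; have f4 : r * q = q ^+ 2 * (q * r).
  apply: (mulgI (q ^+ 2)); rewrite [RHS]mulgA -[q ^+ 2 * q ^+ 2]expg2 z2 mul1g.
  by rewrite expg2 -mulgA [q * (r * q)]mulgA f5.
split=> //; first by rewrite conjgC er.
  by rewrite conjgC rd.
have f6 : r * (q * r) = q.
  have rr : r * r = q ^+ 2 by rewrite -r2 expg2.
  have czq : commute (q ^+ 2) q by apply/commute_sym/commuteX.
  rewrite mulgA f4; move: (q ^+ 2) czq z2 rr {czd f4 r2} => z czq z2 rr.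
  by rewrite -mulgA -(mulgA q) rr -czq mulgA -expg2 z2 mul1g.
by rewrite conjgC conjMg er rd f6.
Qed.

(** The one coset computation where [y] occurs on both sides of [r]: writing [r] as [d * (q * e)]
    moves [d] and [e] outwards past [y] and leaves [y * q * y], to which the braid relation
    applies. *)
Lemma mul_sandwich (gT : finGroupType) (q r s d e y : gT) :
  y * d = e * y -> y * q * y = q^-1 * (y * q) -> q * d = d * s ->
  r = d * (q * e) -> y * (r * y) = e * q^-1 * e * (y * s).
Proof.
move=> yd yqy qd ->.
have -> : y * (d * (q * e) * y) = y * d * q * (e * y) by rewrite !mulgA.
rewrite -yd [y * d in X in X * _]yd.
have -> : e * y * q * (y * d) = e * (y * q * y) * d by rewrite !mulgA.
rewrite yqy.
have -> : e * (q^-1 * (y * q)) * d = e * q^-1 * (y * (q * d)) by rewrite !mulgA.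
rewrite qd (mulgA y) yd; by rewrite !mulgA.
Qed.

(** The five cosets mirror [braid_cover]: [L] is generated by [q] and [d], [y] stands for [i], and
    [1], [q], [r], [q * r] represent the four-group. Right multiplication by each generator maps
    their union into itself. *)
Lemma rel120_bound (gT : finGroupType) (q d y : gT) :
  rel120 q d y -> #|<<[set q; d; y]>>| <= 120.
Proof.
case=> R yq dy yq3; have [z2 czd d3 qr rd] := R.
have oL := rel24_bound R; set L := <<_>> in oL.
have [f1 f2 f3 f4 f5] := rel24_facts R.
have Lq : q \in L by rewrite mem_gen // !inE eqxx.
have Ld : d \in L by rewrite mem_gen // !inE eqxx orbT.
have Lz : q ^+ 2 \in L by rewrite groupX.
have qq : q * q = q ^+ 2 by rewrite expg2.
have czy : commute (q ^+ 2) y by rewrite -yq; apply/commute_sym/commuteX.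
have yV : y^-1 = q ^+ 2 * y.
  apply/eqP; rewrite eq_invg_mul -yq -expgSr -expgS -[4%N]/(2 * 2)%N expgM yq.
  by rewrite z2.
(* The cube relation makes [y * q * y] the inverse of [q * y * q], and the central factors of [y^-1]
   and [q^-1] cancel. *)
have yqy : y * q * y = q^-1 * (y * q).
  have : y * q * y * (q * y * q) = 1 by rewrite -yq3 expgS expg2 !mulgA.
  have zq : q ^+ 2 * q^-1 = q by rewrite expg2 mulgK.
  by move/(canRL (mulgK _)) => ->; rewrite mul1g !invMg yV czy -(mulgA y) zq.
have yd : y * d = d^-1 * y by rewrite [RHS]conjgC conjVg dy invgK.
have ydV : y * d^-1 = d * y by rewrite [RHS]conjgC dy.
have qdV : q * d^-1 = d^-1 * (q * q ^ d).
  by apply: (mulIg d); rewrite mulgKV -[RHS]mulgA f3 mulKg.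
move: (q ^ d) (q ^+ 2) f1 f2 f3 f4 f5 qdV z2 czd czy Lz qq yq {qr rd yV}.
move=> r z f1 f2 f3 f4 f5 qdV z2 czd czy Lz qq yq.
pose S := L :|: L :* y :|: L :* (y * q) :|: L :* (y * r) :|: L :* (y * (q * r)).
have S0 l : l \in L -> l \in S by move=> Ll; rewrite !in_setU Ll.
have S1 l : l \in L -> l * y \in S.
  by move=> Ll; rewrite !in_setU (mem_rcoset _ y) mulgK Ll !orbT.
have S2 l : l \in L -> l * (y * q) \in S.
  by move=> Ll; rewrite !in_setU (mem_rcoset _ (y * q)) mulgK Ll !orbT.
have S3 l : l \in L -> l * (y * r) \in S.
  by move=> Ll; rewrite !in_setU (mem_rcoset _ (y * r)) mulgK Ll !orbT.
have S4 l : l \in L -> l * (y * (q * r)) \in S.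
  by move=> Ll; rewrite !in_setU (mem_rcoset _ (y * (q * r))) mulgK Ll !orbT.
have oS : #|S| <= 120.
  have U (A B : {set gT}) m n : #|A| <= m -> #|B| <= n -> #|A :|: B| <= m + n.
    by move=> Am Bn; apply: leq_trans (leq_card_setU _ _) (leq_add Am Bn).
  by rewrite -[120%N]/(24 + 24 + 24 + 24 + 24)%N !U ?card_rcoset.
have SP x : x \in S -> [\/ [\/ x \in L, x \in L :* y | x \in L :* (y * q)],
                          x \in L :* (y * r) | x \in L :* (y * (q * r))].
  rewrite !in_setU => /orP[/orP[/orP[/orP[|]|]|]|] h; last 2 first.
  - by constructor 2.
  - by constructor 3.
  - by constructor 1; constructor 1.
  - by constructor 1; constructor 2.
  by constructor 1; constructor 3.
clearbody S; apply: leq_trans oS; apply/subset_leq_card/gen_closed; first exact/S0/group1.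
move=> x a Sx; rewrite !inE -!orbA.
move: (SP x Sx) => [[Lx|/rcosetP[l Ll ->]|/rcosetP[l Ll ->]]|/rcosetP[l Ll ->]|/rcosetP[l Ll ->]];
  case/or3P=> /eqP->; rewrite -?mulgA.
- by apply: S0; rewrite groupM.
- by apply: S0; rewrite groupM.
- exact: S1.
- exact: S2.
- by rewrite yd (mulgA l); apply: S1; rewrite groupM ?groupV.
- by rewrite -expg2 yq; apply: S0; rewrite groupM.
- by rewrite qq -czy (mulgA l); apply: S1; rewrite groupM.
- by rewrite f1 (mulgA y) yd -(mulgA _ y) (mulgA l); apply: S3; rewrite groupM ?groupV.
- by rewrite (mulgA y) yqy (mulgA l); apply: S2; rewrite groupM ?groupV.
- by rewrite f4 (mulgA y) -czy -(mulgA z) (mulgA l); apply: S4; rewrite groupM.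
- by rewrite f2 (mulgA y) yd -(mulgA _ y) (mulgA l); apply: S4; rewrite groupM ?groupV.
- have -> : y * (r * y) = d * q^-1 * d * (y * (q * r)).
    have := mul_sandwich ydV yqy qdV.
    by apply; rewrite f1 mulKg.
  by rewrite (mulgA l); apply: S4; rewrite !groupM ?groupV.
- by rewrite (mulgA q) f5; apply: S3.
- by rewrite (mulgA q) f3 (mulgA y) yd -(mulgA _ y) (mulgA l); apply: S2; rewrite groupM ?groupV.
have -> : y * (q * (r * y)) = d^-1 * q^-1 * d^-1 * (y * r).
  by rewrite (mulgA q r); apply: (mul_sandwich yd yqy f1); rewrite qdV mulKVg.
by rewrite (mulgA l); apply: S3; rewrite !groupM ?groupV.
Qed.

(** [z ^+ 2 = 1] follows from the relations: with [X = b * a] and [C = a * b], the identity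
    [X * C = z * (C * X)] makes [X * C * C] equal both to [z * X] and to [z ^+ 3 * X]. *)
Lemma rel48_facts (gT : finGroupType) (a b : gT) (z := a ^+ 3) :
  a ^+ 3 = b ^+ 3 -> (a * b) ^+ 2 = a ^+ 3 ->
  [/\ b * a * (a * b) = z * (a * b * (b * a)), z ^+ 2 = 1, a * a = b * a * b
    & b * b = a * b * a].
Proof.
rewrite {}/z => ab abz.
have aa : a * a = b * a * b.
  by apply: (mulgI a); rewrite -expg2 -expgS -abz expg2 !mulgA.
have bb : b * b = a * b * a.
  by apply: (mulIg b); rewrite -expg2 -expgSr -ab -abz expg2 !mulgA.
have cza : commute (a ^+ 3) a by apply/commute_sym/commuteX.
have czb : commute (a ^+ 3) b by rewrite ab; apply/commute_sym/commuteX.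
have aaa : a * (a * a) = a ^+ 3 by rewrite -expg2 -expgS.
move: (a ^+ 3) aaa cza czb {ab} abz => z aaa cza czb; rewrite expg2 => abz.
have e : b * a * (a * b) = z * (a * b * (b * a)).
  rewrite !mulgA -(mulgA b a a) aa !mulgA -(mulgA _ b b) bb !mulgA.
  rewrite -(mulgA (a * b * a) a a) -(mulgA (a * b) a (a * a)) aaa.
  by rewrite -(mulgA a b z) -czb mulgA -cza.
split=> //.
have czX : commute z (b * a) by apply: commuteM.
have czC : commute z (a * b) by apply: commuteM.
move: (b * a) (a * b) e abz czX czC => X C e abz czX czC.
have e1 : X * C * C = z * X by rewrite -mulgA abz -czX.
have e2 : X * C * C = z * z * (z * X).
  by rewrite e -!mulgA e (mulgA C z) -czC -!mulgA (mulgA C C) abz.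
by apply: (mulIg (z * X)); rewrite mul1g expg2 -e2.
Qed.

(** Adjoining [b * a], [a] and [v] in turn to [<[a * b]>], of order at most four, gives the bound 4
    * 2 * 3 * 2. *)
Lemma rel48_bound (gT : finGroupType) (a b v : gT) :
  rel48 a b v -> #|<<[set a; b; v]>>| <= 48.
Proof.
case=> ab abz av bv vz; have [e z2 aa bb] := rel48_facts ab abz.
have oc : #|<[a * b]>| <= 4 by apply: cycle_le; rewrite // -[4%N]/(2 * 2)%N expgM abz.
have ca : (a * b) ^ a = b * a by rewrite conjgE -mulgA mulKg.
have ba2 : (b * a) ^+ 2 = a ^+ 3.
  by rewrite -ca -conjXg abz; apply/conjg_fixP/commgP/commute_sym/commuteX.
have zc : a ^+ 3 \in <[a * b]> by rewrite -abz mem_cycle.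
pose Q := (<[a * b]> <*> <[b * a]>)%G.
have oQ : #|Q| <= 8.
  apply: (@join_cycle_bound _ <[a * b]>%G (b * a) 2 4); rewrite // ?ba2 //.
  rewrite inE -cycleJ cycle_subG.
  have -> : (a * b) ^ (b * a) = a ^+ 3 * (a * b).
    have czX : commute (a ^+ 3) (b * a).
      by rewrite -ba2; apply/commute_sym/commuteX.
    apply: (mulgI (b * a)); rewrite -conjgC (mulgA _ _ (a * b)) -czX -(mulgA _ (b * a)) e (mulgA (a ^+ 3)).
    by rewrite -expg2 z2 mul1g.
  by rewrite groupM ?cycle_id.
have Qc : a * b \in Q by rewrite mem_gen // inE cycle_id.
have Qc' : b * a \in Q by rewrite mem_gen // inE cycle_id orbT.
have Qz : a ^+ 3 \in Q by rewrite mem_gen // inE zc.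
have c'a : (b * a) ^ a = b * a * (a * b).
  by rewrite conjgE -(mulgA b) aa !mulgA -(mulgA a^-1 b b) bb !mulgA mulVg mul1g.
pose R := (Q <*> <[a]>)%G.
have oR : #|R| <= 24.
  apply: (@join_cycle_bound _ Q a 3 8); rewrite // .
  by rewrite inE -genJ conjUg -!cycleJ join_subG !cycle_subG ca c'a Qc' groupM.
have sQR : Q \subset R := joing_subl _ _.
have Ra : a \in R by rewrite mem_gen // inE cycle_id orbT.
have Rb : b \in R by rewrite -(mulKg a b) groupM ?groupV // (subsetP sQR).
have oW : #|R <*> <[v]>| <= 48.
  apply: (@join_cycle_bound _ R v 2 24) => //.
    rewrite inE -genJ !conjUg -genJ conjUg -!cycleJ join_subG !cycle_subG av Rb andbT.
    rewrite join_subG !cycle_subG !conjMg av bv.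
    by rewrite groupM ?groupM.
  by apply: (subsetP _ _ vz); rewrite cycle_subG groupX.
apply: leq_trans oW; apply/subset_leq_card; rewrite gen_subG !subUset !sub1set.
by rewrite !mem_gen // inE ?Ra ?Rb ?cycle_id ?orbT.
Qed.

(** * Cosets and lifting from quotients *)

Lemma part2_12 : (12`_2 = 4)%N.
Proof. by rewrite p_part. Qed.

Lemma quotient_lift (gT : finGroupType) (G N : {group gT}) y :
  y \in G / N -> exists x, [/\ x \in 'N(N), x \in G & y = coset N x].
Proof. by case/morphimP=> x Nx Gx ->; exists x. Qed.

Lemma cosetM (gT : finGroupType) (N : {group gT}) x y :
  x \in 'N(N) -> y \in 'N(N) -> coset N (x * y) = coset N x * coset N y.
Proof. exact: morphM. Qed.

Lemma cosetJ (gT : finGroupType) (N : {group gT}) x y :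
  x \in 'N(N) -> y \in 'N(N) -> coset N (x ^ y) = coset N x ^ coset N y.
Proof. exact: morphJ. Qed.

Lemma cosetX (gT : finGroupType) (N : {group gT}) x k :
  x \in 'N(N) -> coset N (x ^+ k) = coset N x ^+ k.
Proof. exact: morphX. Qed.

Lemma coset_classP (gT : finGroupType) (G Z : {group gT}) x y :
  Z <| G -> x \in G -> y \in G ->
  reflect (exists g z, [/\ g \in G, z \in Z & x = z * y ^ g])
          (coset Z x \in coset Z y ^: (G / Z)).
Proof.
case/andP=> sZG /subsetP nZ Gx Gy; apply: (iffP imsetP) => [[_ /quotient_lift[g [Ng Gg ->]]]|].
  rewrite -cosetJ ?nZ // => /rcoset_kercosetP; rewrite !nZ ?groupJ // => /(_ isT isT).
  by case/rcosetP=> z Zz ->; exists g, z.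
case=> g [z [Gg Zz ->]]; exists (coset Z g); first exact: mem_quotient.
have Nz : z \in 'N(Z) by apply: (subsetP (normG _)).
by rewrite (cosetM Nz) ?nZ ?groupJ // (coset_id Zz) mul1g cosetJ ?nZ.
Qed.

(** [<[x]>] has order four and covers only the cosets of [1] and [x], so [Q :&: L] has order above
    four and dividing eight. *)
Lemma quat8_gen (gT : finGroupType) (Z Q L : {group gT}) x y :
  quat8 Z Q -> #|Z| = 2 -> Q \subset 'N(Z) -> x \in Q :\: Z -> y \in Q :\: Z ->
  coset Z x != coset Z y -> x \in L -> y \in L -> Q \subset L.
Proof.
move=> [sZQ oQ sqQ] oZ nZQ Qx Qy neq Lx Ly.
have [x2 Zx2] := sqQ x Qx; have [Qx' Zx] := setDP Qx; have [Qy' Zy] := setDP Qy.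
have Nx := subsetP nZQ _ Qx'; have Ny := subsetP nZQ _ Qy'.
have x4 : (x ^+ 2) ^+ 2 = 1 by apply/eqP; rewrite -order_dvdn; have := order_dvdG Zx2; rewrite oZ.
have ox : #[x] = 4.
  have : #[x] %| 4 by rewrite order_dvdn -[4%N]/(2 * 2)%N expgM x4.
  move/dvdn4=> [] // e.
    by move/eqP: e; rewrite order_eq1 => /eqP e; rewrite e group1 in Zx.
  by rewrite -e expg_order eqxx in x2.
have xL : <[x]> \proper Q :&: L.
  rewrite properE cycle_subG inE Qx' Lx /=; apply: contra neq => /subsetP/(_ y).
  rewrite inE Qy' Ly => /(_ isT) xy.
  have : coset Z y \in <[coset Z x]>.
    by rewrite -[<[_]>](morphim_cycle (coset_morphism Z)) // mem_morphim.
  rewrite cycle2g.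
    rewrite !inE => /orP[/eqP e|/eqP-> //].
    by rewrite (coset_idr Ny e) in Zy.
  apply: nt_prime_order => //.
    by rewrite -cosetX //; apply: coset_id.
  by apply: contra Zx => /eqP/(coset_idr Nx).
have := proper_card xL; rewrite -orderE ox.
have : #|Q :&: L| %| 8 by rewrite -oQ cardSg ?subsetIl.
move=> d4 l4; apply/setIidPl/eqP; rewrite eqEcard subsetIl oQ.
by move: d4 l4; case: #|_| => [|[|[|[|[|[|[|[|]]]]]]]].
Qed.

Lemma order3_dvd_four (gT : finGroupType) (x : gT) k :
  x ^+ 3 = 1 -> x != 1 -> coprime 3 k -> ~~ (#[x] %| k).
Proof.
move=> x3 x1 co; apply: contra x1; rewrite -order_eq1 -dvdn1 => xk.
rewrite -(eqP co) dvdn_gcd xk andbT order_dvdn x3 //.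
Qed.

(** * A normal quaternion subgroup of order eight with fused cosets *)

Section NormalQuaternion.
Variables (gT : finGroupType) (G Q : {group gT}) (v : gT).
Hypotheses (cGv : cent4 G v) (nQG : Q <| G) (qQ : quat8 'Z(G)%G Q) (vQ : v \notin Q).
Hypothesis fus : {in Q :\: 'Z(G) &, forall x y,
  coset 'Z(G) x \in coset 'Z(G) y ^: (G / 'Z(G))}.
Let Z := 'Z(G)%G.
Let X := (G / Z)%G.
Let E := (Q / Z)%G.
Let nZG : G \subset 'N(Z). Proof. exact: gFnorm. Qed.
Let sQG : Q \subset G. Proof. exact: normal_sub. Qed.
Let sZQ : Z \subset Q. Proof. by case: qQ. Qed.
Let nZQ : Q \subset 'N(Z). Proof. exact: subset_trans nZG. Qed.
Let oZ : #|Z| = 2. Proof. by case: cGv. Qed.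
Let Gv : v \in G. Proof. by case: cGv. Qed.
Let Nv : v \in 'N(Z). Proof. exact: (subsetP nZG). Qed.

Lemma quatE_card : #|E| = 4.
Proof. by rewrite card_quotient // -divgS //= oZ; case: qQ => _ ->. Qed.

Lemma quatE_card1 : #|E^#| = 3.
Proof. by have := cardsD1 1 E; rewrite group1 quatE_card => -[]. Qed.

Lemma quatE_lift y : y \in E^# -> exists2 x, x \in Q :\: Z & y = coset Z x.
Proof.
case/setD1P=> y1 /morphimP[x Nx Qx ey]; exists x => //; rewrite inE Qx andbT.
by apply: contra y1 => Zx; apply/eqP; rewrite ey; apply: coset_id.
Qed.

Lemma quatE_coset x : x \in Q :\: Z -> coset Z x \in E^#.
Proof.
case/setDP=> Qx Zx; rewrite !inE mem_quotient // andbT.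
by apply: contra Zx => /eqP/coset_idr-> //; apply: (subsetP nZQ).
Qed.

Lemma quatE_sqr y : y \in E -> y ^+ 2 = 1.
Proof.
have [-> _|y1 Ey] := eqVneq y 1; first by rewrite expg1n.
have [|x Qx ->] := @quatE_lift y; first by rewrite !inE y1.
have [_ _ /(_ x Qx)[_ Zx2]] := qQ.
rewrite -morphX; last by apply: (subsetP nZQ); case/setDP: Qx.
exact: coset_id.
Qed.

Lemma quatE_abelian : abelian E.
Proof. exact/exponent2_abelian/quatE_sqr. Qed.

Lemma quatE_class y : y \in E^# -> y ^: X = E^#.
Proof.
move=> Ey; apply/eqP; rewrite eqEsubset; apply/andP; split.
  apply/subsetP=> _ /imsetP[g Xg ->]; case/setD1P: Ey => y1 Ey.
  rewrite !inE conjg_eq1 y1 memJ_norm //; apply: (subsetP _ _ Xg).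
  exact: quotient_norms (normal_norm nQG).
apply/subsetP=> x /quatE_lift[x' Qx' ->]; have [y' Qy' ->] := quatE_lift Ey.
exact: fus.
Qed.

(** Otherwise [E], of order four, would fill the centraliser of the image of [v] and contain that
    image, so [v] would be in [Q]. *)
Lemma quatE_nocent : coset Z v \notin 'C(E).
Proof.
apply/negP=> cv; have le4 := card_quo_cent_le cGv.
have sE : E \subset 'C_X[coset Z v].
  rewrite subsetI quotientS //=; apply/subsetP=> x Ex.
  by rewrite cent1E; apply/eqP/esym/(centP cv).
have : coset Z v \in E.
  have /eqP-> : E == 'C_X[coset Z v] :> {set _}.
    by rewrite eqEcard sE quatE_card.
  by rewrite inE cent1id andbT mem_quotient.
case/morphimP=> x Nx Qx /(rcoset_kercosetP Nv Nx).
case/rcosetP=> z Zz ev; case/negP: vQ; rewrite ev groupM //; exact: (subsetP sZQ).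
Qed.

(** [X] permutes the three elements of [E^#] transitively with kernel ['C_X(E)], so the index is
    three or six. Three is impossible, as the image of [v] has square one and acts nontrivially. *)
Lemma quatE_index : #|X : 'C_X(E)| = 6.
Proof.
have oE1 := quatE_card1.
have [e1 Ee1] : exists e1, e1 \in E^#.
  by apply/set0Pn; rewrite -card_gt0 oE1.
have [e11 Ee1'] := setD1P Ee1.
have [e2 Ee2] : exists e2, e2 \in E^# :\ e1.
  by apply/set0Pn; rewrite -card_gt0; have := cardsD1 e1 E^#; rewrite Ee1 oE1 => -[e]; rewrite (_ : #|_| = 2).
have [e21 /setD1P[e20 Ee2']] := setD1P Ee2.
have i1 : #|X : 'C_X[e1]| = 3.
  by rewrite index_cent1 quatE_class.
have gE : 'C_X(E) = 'C_('C_X[e1])[e2].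
  apply/setP=> g; rewrite in_setI [in RHS]in_setI [in RHS]in_setI -andbA; congr (_ && _).
  apply/idP/andP=> [cg|[c1 c2]].
    by rewrite !cent1E !(centP cg) ?eqxx //.
  apply/centP=> y Ey.
  have : y \in <[e1]> <*> <[e2]>.
    suff <- : E :=: <[e1]> <*> <[e2]> by [].
    apply/esym/eqP; rewrite eqEcard join_subG !cycle_subG Ee1' Ee2' quatE_card /=.
    have oe1 : #|<[e1]>| = 2.
      by apply: nt_prime_order; rewrite ?quatE_sqr.
    have : #|<[e1]>| < #|<[e1]> <*> <[e2]>|.
      apply: proper_card; rewrite properE joing_subl /=; apply: contra e21 => /subsetP/(_ e2).
      rewrite mem_gen ?inE ?cycle_id ?orbT // => /(_ isT).
      by rewrite cycle2g // in_set2 (negPf e20).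
    have := cardSg (joing_subl <[e1]> <[e2]>); rewrite oe1.
    by case: #|_| => [|[|[|[|]]]].
  have : <[e1]> <*> <[e2]> \subset 'C[g].
    by rewrite join_subG !cycle_subG !cent1E; rewrite !cent1E in c1 c2; rewrite eq_sym c1 eq_sym c2.
  by move/subsetP=> s /s /cent1P.
have i2 : #|'C_X[e1] : 'C_('C_X[e1])[e2]| <= 2.
  rewrite index_cent1.
  have <- : #|E^# :\ e1| = 2.
    by have := cardsD1 e1 E^#; rewrite Ee1 oE1 => -[].
  apply/subset_leq_card/subsetP=> _ /imsetP[g /setIP[Xg c1] ->].
  have : e2 ^ g \in E^# by rewrite -(quatE_class (y := e2)) ?imset_f // !inE e20.
  rewrite !inE => ->; rewrite andbT; apply: contra e21 => /eqP e.
  by apply/eqP/(conjg_inj g); rewrite e conjgE -(cent1P c1) mulKg.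
have : #|X : 'C_X(E)| = (3 * #|'C_X[e1] : 'C_('C_X[e1])[e2]|)%N.
  by rewrite -i1 gE Lagrange_index ?subsetIl.
move: i2 (indexg_gt0 'C_X[e1] 'C_('C_X[e1])[e2]).
case: #|_ : _| => [|[|[|//]]] // _ _ i3.
case/negP: quatE_nocent.
have nEX : X \subset 'N(E) by apply: quotient_norms (normal_norm nQG).
have nC : 'C_X(E) <| X by rewrite /normal subsetIl normsI ?normG ?norms_cent.
have Xv : coset Z v \in X by rewrite mem_quotient.
have v2 : coset Z v ^+ 2 = 1 by rewrite -morphX //; apply/coset_id/cent4_sqr.
have : coset 'C_X(E) (coset Z v) = 1.
  apply/eqP; rewrite -order_eq1 -dvdn1 -[1%N]/(gcdn 2 3) dvdn_gcd.
  rewrite order_dvdn -morphX ?v2 ?morph1 ?eqxx ?(subsetP (normal_norm nC)) //=.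
  have <- : #|X / 'C_X(E)| = 3 by rewrite card_quotient ?normal_norm // i3.
  by rewrite order_dvdG // mem_quotient.
by move/coset_idr=> /(_ (subsetP (normal_norm nC) _ Xv)); case/setIP.
Qed.

(** [E] is a central Sylow 2-subgroup of ['C_X(E)], so this group has a normal 2-complement, which
    lifts through [Z]. The index is six from [quatE_index] times eight, the 2-part of the preimage
    of ['C_X(E)]. *)
Lemma quat_odd_core : (#|G|`_2 = 16)%N ->
  exists N : {group gT}, [/\ N <| G, odd #|N| & #|G : N| = 48].
Proof.
move=> G16; pose C := 'C_X(E)%G.
have nEX : X \subset 'N(E) by apply: quotient_norms (normal_norm nQG).
have nC : C <| X by rewrite /normal subsetIl normsI ?normG ?norms_cent.
have sEC : E \subset C by rewrite subsetI quotientS //; exact: quatE_abelian.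
have nZ : Z <| G := center_normal G.
have oX : (#|G| = 2 * #|X|)%N by rewrite -oZ card_quotient // Lagrange ?center_sub.
have oXC : (#|X| = 6 * #|C|)%N by rewrite -quatE_index mulnC Lagrange ?subsetIl.
have oC2 : (#|C|`_2 = 4)%N.
  have := G16; rewrite oX oXC mulnA partnM ?cardG_gt0 // part2_12.
  by move/eqP; rewrite -[16]/(4 * 4)%N eqn_pmul2l // => /eqP.
have sylE : 2.-Sylow(C) E by rewrite pHallE sEC quatE_card oC2.
have hC : has_2compl C.
  by apply: (Burnside_2compl sylE); rewrite subIset // subsetIr.
pose K := (coset Z @*^-1 C)%G.
have nK : K <| G by rewrite -(quotientGK nZ) cosetpre_normal.
have eK : (K / Z)%G = C by apply/val_inj; rewrite /= cosetpreK.
have oK : (#|K| = 2 * #|C|)%N by rewrite card_cosetpre oZ.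
have sZK : Z \subset 'Z(K).
  rewrite subsetI sub_cosetpre (subset_trans (subsetIr G _)) // centS //.
  exact: normal_sub.
have hallN : 2^'.-Hall(K) 'O_2^'(K).
  by apply: has_2compl_Hall; apply: (quotient_2compl sZK oZ); rewrite eK.
exists ('O_2^'(K))%G; rewrite gFnormal_trans // odd_2'nat; split=> //; first exact: pcore_pgroup.
rewrite -(Lagrange_index (normal_sub nK) (pcore_sub _ _)).
have -> : #|G : K| = 6.
  by rewrite -divgS ?normal_sub // oK oX oXC mulnCA mulnK // muln_gt0 cardG_gt0.
rewrite -divgS ?pcore_sub // (card_Hall hallN) -[X in X %/ _](@partnC 2) ?cardG_gt0 //.
by rewrite mulnK ?part_gt0 // oK partnM ?cardG_gt0 // oC2 part_pnat_id.
Qed.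

Section FortyEight.
Hypothesis oG : #|G| = 48.

Let oX : #|X| = 24.
Proof. by rewrite card_quotient // -divgS ?center_sub //= oZ oG. Qed.

Lemma quatE_self_cent : 'C_X(E) = E.
Proof.
have sE : E \subset 'C_X(E) by rewrite subsetI quotientS //; exact: quatE_abelian.
apply/esym/eqP; rewrite eqEcard sE quatE_card /=.
have := Lagrange (subsetIl X 'C(E)); rewrite quatE_index oX.
by move/eqP; rewrite -[24]/(4 * 6)%N eqn_pmul2r // => /eqP->.
Qed.

(** The three cosets are fused in [X], of order 24, so the stabiliser of one of them has order eight
    and no element of order three. *)
Lemma quat_three_fixfree d x : d \in G -> #[d] = 3 -> x \in Q :\: Z ->
  coset Z (x ^ d) != coset Z x.
Proof.
move=> Gd od Qx; have Ex := quatE_coset Qx.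
have Nx : x \in 'N(Z) by apply: (subsetP nZQ); case/setDP: Qx.
have Nd := subsetP nZG _ Gd.
rewrite cosetJ //; apply/negP=> /eqP/conjg_fixP/commgP cxd.
have : #[coset Z d] %| 8.
  have <- : #|'C_X[coset Z x]| = 8.
    have := Lagrange (subsetIl X 'C[coset Z x]); rewrite index_cent1 quatE_class // oX.
    rewrite quatE_card1 => /eqP.
    by rewrite -[24]/(8 * 3)%N eqn_pmul2r // => /eqP.
  by rewrite order_dvdG // inE mem_quotient //; apply/cent1P/commute_sym.
apply/negP/order3_dvd_four => //.
  by rewrite -cosetX // -od expg_order; apply: coset_id; apply: group1.
apply/eqP=> /(coset_idr Nd) Zd; have := order_dvdG Zd.
by rewrite od oZ.
Qed.

(** On [E^#], [d] induces a three-cycle and [v] a transposition, so [d ^ v] acts as the inverse of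
    [d]. The product acts trivially, and [E] is its own centraliser. *)
Lemma quat_three_prod d : d \in G -> #[d] = 3 -> d * d ^ v \in Q.
Proof.
move=> Gd od; have Nd := subsetP nZG _ Gd.
have Ndv : d * d ^ v \in 'N(Z) by rewrite groupM ?groupJ.
have nEX : X \subset 'N(E) by apply: quotient_norms (normal_norm nQG).
have Xd : coset Z d \in X by apply: mem_quotient.
have Xv : coset Z v \in X by apply: mem_quotient.
have dfix y : y \in E^# -> y ^ coset Z d != y.
  by case/quatE_lift=> x Qx ->; rewrite -cosetJ ?quat_three_fixfree // (subsetP nZQ) //; case/setDP: Qx.
have EJ g y : g \in X -> y \in E^# -> y ^ g \in E^#.
  by move=> Xg Ey; rewrite -(quatE_class Ey) imset_f.
have d3 : coset Z d ^+ 3 = 1.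
  by rewrite -cosetX // -od expg_order; apply: coset_id; apply: group1.
have v2 : coset Z v ^+ 2 = 1 by rewrite -cosetX //; apply/coset_id/cent4_sqr.
suff: coset Z (d * d ^ v) \in 'C_X(E).
  rewrite quatE_self_cent => /quotient_lift[x [Nx Qx /rcoset_kercosetP]].
  by move/(_ Ndv Nx)/rcosetP=> [z Zz ->]; rewrite groupM // (subsetP sZQ).
have -> : coset Z (d * d ^ v) = coset Z d * coset Z d ^ coset Z v.
  by rewrite -cosetJ // -cosetM // groupJ.
rewrite in_setI groupM ?groupJ //=.
have := quatE_nocent; move: (coset Z d) (coset Z v) Xd Xv dfix d3 v2 {Gd od Nd Ndv}.
move=> d' v' Xd Xv dfix d3 v2 nC.
have [e0 Ee0 fe0] : exists2 e, e \in E^# & e ^ v' = e.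
  have [e Ee nfe] : exists2 e, e \in E & e ^ v' != e.
    apply/exists_inP; apply: contraR nC => /exists_inPn h; apply/centP=> e Ee.
    by apply/commute_sym/commgP/conjg_fixP/eqP; move: (h e Ee); rewrite negbK.
  have Eev : e ^ v' \in E by rewrite memJ_norm // (subsetP nEX).
  exists (e * e ^ v'); last first.
    rewrite conjMg -conjgM -expg2 v2 conjg1.
    exact: (centsP quatE_abelian).
  rewrite !inE groupM // andbT; apply: contra nfe; rewrite -eq_invg_mul => /eqP<-.
  by rewrite eq_invg_mul -expg2 quatE_sqr.
have vV : v'^-1 = v' by apply/eqP; rewrite eq_invg_mul -expg2 v2.
pose e1 := e0 ^ d'; pose e2 := e1 ^ d'.
have e2d : e2 ^ d' = e0.
  have <- : e0 ^ (d' ^+ 3) = e2 ^ d' by rewrite 2!expgS expg1 !conjgM.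
  by rewrite d3 conjg1.
have Ee1 : e1 \in E^# by apply: EJ.
have Ee2 : e2 \in E^# by apply: EJ.
have n10 : e1 != e0 by apply: dfix.
have n21 : e2 != e1 by apply: dfix.
have n20 : e2 != e0 by rewrite -e2d eq_sym dfix.
have e3 y : y \in E^# -> [\/ y = e0, y = e1 | y = e2].
  have /eqP <- : [set e0; e1; e2] == E^#.
    rewrite eqEcard !subUset !sub1set Ee0 Ee1 Ee2 /=.
    by rewrite quatE_card1 setUC cardsU1 cards2 !inE negb_or n20 n21 eq_sym n10.
  by rewrite !inE => /orP[/orP[]|] /eqP->; [constructor 1|constructor 2|constructor 3].
have v1 : e1 ^ v' = e2.
  have ne0 : e1 ^ v' != e0 by apply: contra n10 => /eqP e; rewrite -(inj_eq (conjg_inj v')) e fe0.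
  have [e|e|//] := e3 _ (EJ _ _ Xv Ee1); first by rewrite e eqxx in ne0.
  case/negP: nC; apply/centP=> y Ey; apply/commute_sym/commgP/conjg_fixP.
  have [->|y1] := eqVneq y 1; first exact: conj1g.
  have [|->|->|->] := e3 y; rewrite ?inE ?y1 //.
  have [e'|e'|//] := e3 _ (EJ _ _ Xv Ee2).
    by case/eqP: n20; apply: (conjg_inj v'); rewrite e' fe0.
  by case/eqP: n21; apply: (conjg_inj v'); rewrite e' e.
have v2' : e2 ^ v' = e1 by rewrite -v1 -conjgM -expg2 v2 conjg1.
have eW e : e ^ (d' * d' ^ v') = (((e ^ d') ^ v') ^ d') ^ v'.
  by rewrite -!conjgM (conjgE d' v') vV !mulgA.
have w0 : e0 ^ (d' * d' ^ v') = e0 by rewrite eW -/e1 v1 e2d fe0.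
have w1 : e1 ^ (d' * d' ^ v') = e1 by rewrite eW -/e2 v2' -/e2 v2'.
have w2 : e2 ^ (d' * d' ^ v') = e2 by rewrite eW e2d fe0 -/e1 v1.
apply/centP=> y Ey; apply/commute_sym/commgP/conjg_fixP.
have [->|y1] := eqVneq y 1; first exact: conj1g.
by have [|->|->|->] := e3 y; rewrite ?inE ?y1.
Qed.

(** If [v] inverted both [d] and [d ^ e], then [e ^ v * e^-1] would commute with [d]; for an [e] in
    [Q] that [v] moves modulo [Z] this contradicts [quat_three_fixfree]. *)
Lemma quat_three_not_inverted :
  exists d, [/\ d \in G, #[d] = 3 & d ^ v != d^-1].
Proof.
have [||d Gd od] := @Cauchy _ 3 G; rewrite ?oG //.
have [edv|] := eqVneq (d ^ v) d^-1; last by exists d.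
have [e Qe nev] : exists2 e, e \in Q & e ^ v * e^-1 \notin Z.
  apply/exists_inP; have := quatE_nocent; apply: contraR => /exists_inPn h.
  apply/centP=> _ /quotient_lift[e [Ne Qe ->]]; apply/commute_sym/commgP/conjg_fixP.
  rewrite -cosetJ //; apply/rcoset_kercosetP; rewrite ?groupJ //.
  by rewrite mem_rcoset; move: (h e Qe); rewrite negbK.
have nQ := subsetP (normal_norm nQG).
have Ge := subsetP sQG _ Qe.
exists (d ^ e); rewrite groupJ ?orderJ //; split=> //.
apply/negP=> /eqP ed.
have Qf : e ^ v * e^-1 \in Q by rewrite groupM ?groupV // memJ_norm ?nQ.
have := quat_three_fixfree Gd od (x := e ^ v * e^-1); rewrite inE nev Qf => /(_ isT)/eqP[].
congr (coset Z _); apply/conjg_fixP/commgP/commute_sym/commgP/conjg_fixP.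
have : (d ^ v) ^ (e ^ v) = d^-1 ^ e by rewrite -conjJg ed conjVg.
rewrite edv !conjVg => /invg_inj; move: (e ^ v) => f h.
by rewrite conjgM h -conjgM mulgV conjg1.
Qed.

(** With [t] the central involution, [a = t * d] and [b = t * d ^ v] have cube [t], and
    [a * b = d * d ^ v] lies in [Q]. It is not central, since [1] would mean that [v] inverts [d],
    and [t] is refuted by cubing; so its square is [t] too. *)
Lemma quat_rel48 : exists a b,
  [/\ a \in G, b \in G, rel48 a b v & <<[set a; b; v]>> = G].
Proof.
have [d [Gd od ndv]] := quat_three_not_inverted.
have [t [t1 t2 Zt]] := center2_gen cGv.
have [z Zz nz1] : exists2 z, z \in Z & z != 1.
  have : #|Z^#| = 1%N by have := cardsD1 1 Z; rewrite group1 oZ => -[].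
  by move/eqP/cards1P=> [z ez]; have := set11 z; rewrite -ez => /setD1P[]; exists z.
have {z Zz nz1} tZ : t \in Z by have [e|<-] := Zt z Zz; rewrite // e eqxx in nz1.
have ct x : x \in G -> commute t x by move=> Gx; case/centerP: tZ => _; apply.
have Gt : t \in G by case/centerP: tZ.
have d3 : d ^+ 3 = 1 by rewrite -od expg_order.
have Gdv : d ^ v \in G by rewrite groupJ.
have Qc := quat_three_prod Gd od; set c := d * d ^ v in Qc.
have ec : c = d * d ^ v by [].
have Zc : c \notin Z.
  apply/negP=> /Zt[e|e]; first by case/eqP: ndv; apply/eqP; rewrite eq_sym eq_invg_mul -ec e.
  have edv : d ^ v = d^-1 * t by rewrite -e ec mulKg.
  have : (d ^ v) ^+ 3 = 1 by rewrite -conjXg d3 conj1g.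
  rewrite edv expgMn; last by apply/commute_sym/ct; rewrite groupV.
  by rewrite expgVn d3 invg1 mul1g expgS t2 mulg1 => e1; rewrite e1 eqxx in t1.
have Qc' : c \in Q :\: Z by rewrite inE Zc.
have [c2 Zc2] : c ^+ 2 != 1 /\ c ^+ 2 \in Z by case: qQ => _ _; apply.
have {c2 Zc2} c2 : c ^+ 2 = t by have [e|//] := Zt _ Zc2; rewrite e eqxx in c2.
clearbody c.
have t3 : t ^+ 3 = t by rewrite expgS t2 mulg1.
have tv : t ^ v = t by apply/conjg_fixP/commgP/ct.
pose a := t * d; pose b := t * d ^ v.
have a3 : a ^+ 3 = t by rewrite (expgMn _ (ct d Gd)) d3 mulg1 t3.
have b3 : b ^+ 3 = t by rewrite (expgMn _ (ct _ Gdv)) -conjXg d3 conj1g mulg1 t3.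
have ab : a * b = c.
  rewrite /a /b; move: (d ^ v) Gdv ec => e Ge ec.
  by rewrite mulgA -(mulgA t) -(ct d) // mulgA -expg2 t2 mul1g ec.
have av : a ^ v = b by rewrite conjMg tv.
have Zv2 : v ^+ 2 \in Z := cent4_sqr cGv.
have Ga : a \in G by apply: groupM.
have bv : b ^ v = a.
  rewrite -av -conjgM -expg2; apply/conjg_fixP/commgP/commute_sym.
  by case/centerP: Zv2 => _; apply.
exists a, b; split=> //; first by rewrite -av groupJ.
  split; rewrite ?a3 ?b3 ?ab //.
  by have [->|->] := Zt _ Zv2; rewrite ?group1 ?cycle_id.
pose L := <<[set a; b; v]>>%G.
have La : a \in L by rewrite mem_gen // !inE eqxx.
have Lb : b \in L by rewrite mem_gen // !inE eqxx orbT.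
have Lv : v \in L by rewrite mem_gen // !inE eqxx !orbT.
have Lt : t \in L by rewrite -a3 groupX.
have Ld : d \in L by rewrite -(mulKg t d) groupM ?groupV.
have Lc : c \in L by rewrite -ab groupM.
have sLG : L \subset G by rewrite gen_subG !subUset !sub1set Gv Ga -av groupJ.
have sQL : Q \subset L.
  apply: (quat8_gen qQ oZ nZQ (x := c) (y := c ^ d)); rewrite ?groupJ //.
    rewrite in_setD memJ_norm ?(subsetP nZG) // Zc /=.
    by rewrite memJ_norm ?(subsetP (normal_norm nQG)).
  by rewrite eq_sym quat_three_fixfree.
have oQ : #|Q| = 8 by case: qQ.
have d24 : 24 %| #|L|.
  by rewrite (@Gauss_dvd 8 3) // -oQ cardSg //= -od order_dvdG.
have := cardSg sLG; rewrite oG; case/dvdnP: d24 => k ek; rewrite ek.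
rewrite -[48]/(2 * 24)%N dvdn_pmul2r // => k2.
have : k = 1%N \/ k = 2.
  have := dvdn_leq (isT : 0 < 2) k2.
  by case: (k) k2 => [|[|[|]]] // _ _; [left|right].
case=> e; last by apply/eqP; rewrite eqEcard sLG -/L ek e oG.
(* If [L] had order 24, [Q] would be its normal Sylow 2-subgroup and would contain the 2-element
   [v]. *)
have hQ : 2.-Hall(L) Q by rewrite pHallE sQL oQ ek e mul1n p_part.
case/negP: vQ; rewrite (mem_normal_Hall hQ) ?Lv //; last first.
  by rewrite /normal sQL (subset_trans sLG) ?normal_norm.
rewrite /p_elt; apply: (@pnat_dvd _ 4) => //.
rewrite order_dvdn -[4%N]/(2 * 2)%N expgM; have := order_dvdG Zv2.
by rewrite oZ order_dvdn.
Qed.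

End FortyEight.
End NormalQuaternion.

(** * Quotients by odd normal subgroups *)

Section OddQuotient.
Variables (gT : finGroupType) (G N : {group gT}) (v : gT).
Hypotheses (cGv : cent4 G v) (nNG : N <| G) (oN : odd #|N|).
Let Z := 'Z(G)%G.
Let sNG : N \subset G. Proof. exact: normal_sub. Qed.
Let Gv : v \in G. Proof. by case: cGv. Qed.

Lemma cent4_odd_cent1 : 'C_N[v] = 1.
Proof.
apply/eqP; rewrite trivg_card1; have [_ _ _ oC] := cGv.
have : #|'C_N[v]| %| 4 by rewrite -oC cardSg ?setSI.
have : odd #|'C_N[v]| by apply: dvdn_odd oN; rewrite cardSg ?subsetIl.
by move=> o /dvdn4[] e; rewrite e // in o *.
Qed.

Lemma cent4_odd_inversion : acts_by_inversion v N.
Proof.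
apply: fixfree_inversion cent4_odd_cent1; first exact: subsetP (normal_norm nNG) _ Gv.
apply: (subsetP _ _ (cent4_sqr cGv)).
exact: subset_trans (subsetIr _ _) (centS sNG).
Qed.

Lemma cent4_odd_TI z : z \in Z -> z \in N -> z = 1.
Proof.
move=> Zz Nz; apply/set1P; rewrite -[[set 1]]cent4_odd_cent1 inE Nz.
by rewrite (subsetP (center_sub_cent1 Gv)).
Qed.

(** If [x] commutes with [v] modulo [N], then [v ^ x] lies in the coset of [v], whose elements are
    the [v ^ m] with [m] in [N]; so [x * m^-1] centralises [v] and has the same image as [x]. *)
Lemma cent4_cent1_quotient : 'C_(G / N)[coset N v] = 'C_G[v] / N.
Proof.
have Nv := subsetP (normal_norm nNG) _ Gv.
apply/eqP; rewrite eqEsubset; apply/andP; split; last first.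
  apply/subsetP=> _ /quotient_lift[x [Nx /setIP[Gx /cent1P cx] ->]].
  by rewrite in_setI mem_quotient // cent1E -!cosetM // cx eqxx.
apply/subsetP=> _ /setIP[/quotient_lift[x [Nx Gx ->]] /cent1P cx].
have /rcoset_kercosetP : coset N (v ^ x) = coset N v.
  by rewrite cosetJ // conjgE -cx mulKg.
rewrite groupJ // Nv => /(_ isT isT)/rcosetP[n Nn evx].
have [m Nm em] : exists2 m, m \in N & v * (n ^ v) = v ^ m.
  apply: inversion_coset_conj => //; first exact: cent4_odd_inversion.
  by rewrite memJ_norm.
rewrite -conjgC -evx in em.
have -> : coset N x = coset N (x * m^-1).
  have Nm' : m^-1 \in N by rewrite groupV.
  by rewrite cosetM // ?(subsetP (normG N) _ Nm') // (coset_id Nm') mulg1.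
apply: mem_quotient; rewrite inE groupM ?groupV ?(subsetP sNG _ Nm) //=.
apply/cent1P/commute_sym/commgP/conjg_fixP.
by rewrite conjgM em -conjgM mulgV conjg1.
Qed.

Lemma card_cent4_quotient : #|'C_(G / N)[coset N v]| = 4.
Proof.
have [_ _ _ oC] := cGv; have nNC := subset_trans (subsetIl G 'C[v]) (normal_norm nNG).
rewrite cent4_cent1_quotient card_quotient // -indexgI.
by rewrite [_ :&: N]setIAC (setIidPr sNG) cent4_odd_cent1 indexg1.
Qed.

(** The centraliser of the image of [v] has order four, so the index bound makes that image
    noncentral. The centre of the quotient is then proper in this centraliser and contains the image
    of [Z], of order two. *)
Lemma cent4_quotient : 4 < #|G : N| ->
  'Z(G / N) = Z / N /\ cent4 (G / N)%G (coset N v).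
Proof.
move=> iN; have oC := card_cent4_quotient; have nNG' := normal_norm nNG.
have Yv : coset N v \in G / N by apply: mem_quotient.
have nZv : coset N v \notin 'Z(G / N).
  apply: contraL iN => /centerP[_ cv]; rewrite -leqNgt -card_quotient // -oC.
  rewrite subset_leq_card // subsetI subxx /=; apply/subsetP=> y Yy.
  by rewrite cent1E; apply/eqP/esym/cv.
have sZC : 'Z(G / N) \subset 'C_(G / N)[coset N v].
  by rewrite subsetI center_sub center_sub_cent1.
have sZZ : Z / N \subset 'Z(G / N) by rewrite subsetI quotientS ?center_sub // quotient_cents // subsetIr.
have oZN : #|Z / N| = 2.
  rewrite card_quotient; last exact: subset_trans (center_sub G) nNG'.
  rewrite -indexgI (_ : Z :&: N = 1) ?indexg1; first by case: cGv.
  by apply/trivgP/subsetP=> z /setIP[Zz Nz]; rewrite inE (cent4_odd_TI Zz Nz).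
have oZ : #|'Z(G / N)| = 2.
  have := cardSg sZC; rewrite oC => /dvdn4[] // e.
    by have := subset_leq_card sZZ; rewrite oZN e.
  case/negP: nZv; have /eqP-> : 'Z(G / N) == 'C_(G / N)[coset N v] by rewrite eqEcard sZC e oC.
  by rewrite inE Yv cent1id.
split=> //; by apply/esym/eqP; rewrite eqEcard sZZ oZ oZN.
Qed.

End OddQuotient.

Section QuaternionQuotient.
Variables (gT : finGroupType) (G Q : {group gT}) (v : gT).
Hypotheses (cGv : cent4 G v) (nQG : Q <| G) (qQ : quat8 'Z(G)%G Q) (vQ : v \notin Q).
Hypothesis fus : {in Q :\: 'Z(G) &, forall x y,
  coset 'Z(G) x \in coset 'Z(G) y ^: (G / 'Z(G))}.

Lemma quat_odd_quotient (N : {group gT}) : N <| G -> odd #|N| -> 4 < #|G : N| ->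
  [/\ cent4 (G / N)%G (coset N v), Q / N <| G / N, quat8 'Z(G / N)%G (Q / N)%G,
      coset N v \notin Q / N
    & {in (Q / N) :\: 'Z(G / N) &, forall x y,
        coset 'Z(G / N) x \in coset 'Z(G / N) y ^: ((G / N) / 'Z(G / N))}].
Proof.
move=> nNG oN iN; have nN := subsetP (normal_norm nNG).
have [eZ cYv] := cent4_quotient cGv nNG oN iN.
have [sZQ oQ sqQ] := qQ; have sQG := normal_sub nQG.
have Gv : v \in G by case: cGv.
have TI : Q :&: N = 1.
  by apply: coprime_TIg; rewrite oQ -[8]/(2 ^ 3)%N coprimeXl // coprime2n.
have oQN : #|Q / N| = 8.
  rewrite card_quotient; last exact: subset_trans sQG (normal_norm nNG).
  by rewrite -indexgI TI indexg1.
have liftQ y : y \in (Q / N) :\: ('Z(G) / N) -> exists2 x, x \in Q :\: 'Z(G) & y = coset N x.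
  case/setDP=> /quotient_lift[x [Nx Qx ->]] nZ; exists x => //; rewrite inE Qx andbT.
  by apply: contra nZ => Zx; apply: mem_quotient.
split=> //=.
- exact: quotient_normal.
- split=> //=; rewrite ?eZ ?quotientS // => y /liftQ[x Qx ->].
  have [x2 Zx2] := sqQ x Qx; have Gx : x \in G by case/setDP: Qx => /(subsetP sQG).
  rewrite -cosetX ?nN // mem_quotient //; split=> //.
  apply: contra x2 => /eqP/(coset_idr (nN _ (groupX 2 Gx))) Nx2.
  by apply/eqP; apply: (cent4_odd_TI cGv nNG oN Zx2 Nx2).
- apply/negP=> /quotient_lift[q [Nq Qq /rcoset_kercosetP]].
  move/(_ (nN _ Gv) Nq)/rcosetP=> [n Nn ev].
  (* In [N <*> Q] the group [Q] is a normal Sylow 2-subgroup, so it would contain the 2-element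
     [v]. *)
  pose W := (N <*> Q)%G.
  have Wv : v \in W by rewrite ev groupM // mem_gen // inE ?Nn ?Qq ?orbT.
  have hQ : 2.-Hall(W) Q.
    rewrite /pHall joing_subr /= /pgroup oQ -divgS ?joing_subr //=.
    rewrite norm_joinEr; last exact: subset_trans sQG (normal_norm nNG).
    by rewrite TI_cardMg ?mulnK ?cardG_gt0 // 1?setIC // -odd_2'nat.
  case/negP: vQ; rewrite (mem_normal_Hall hQ) //.
    rewrite /p_elt; apply: (@pnat_dvd _ 4) => //; rewrite order_dvdn.
    have := order_dvdG (cent4_sqr cGv).
    by rewrite order_dvdn -[4%N]/(2 * 2)%N expgM; case: cGv => ->.
  by rewrite /normal joing_subr join_subG normG (subset_trans (normal_sub nNG) (normal_norm nQG)).
- rewrite eZ => _ _ /liftQ[x Qx ->] /liftQ[y Qy ->].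
  have Gx : x \in G by case/setDP: Qx => /(subsetP sQG).
  have Gy : y \in G by case/setDP: Qy => /(subsetP sQG).
  have /(coset_classP (center_normal G) Gx Gy)[g [z [Gg Zz ->]]] := fus Qx Qy.
  rewrite -eZ; apply/coset_classP; rewrite ?center_normal ?mem_quotient //.
    by rewrite groupM ?groupJ //; case/setIP: Zz.
  exists (coset N g), (coset N z); rewrite mem_quotient //.
  rewrite -[_ \in _ _]/(_ \in 'Z(G / N)) eZ mem_quotient //.
  have Gz : z \in G by case/setIP: Zz.
  by rewrite (cosetM (nN _ Gz)) ?nN ?groupJ // cosetJ ?nN.
Qed.

Lemma quat_odd_generators : (#|G|`_2 = 16)%N ->
  exists N : {group gT}, [/\ N <| G, odd #|N|, #|G : N| = 48 &
    exists a b, [/\ a \in G / N, b \in G / N, rel48 a b (coset N v)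
      & <<[set a; b; coset N v]>> = G / N]].
Proof.
move=> G16; have [N [nNG oN iN]] := quat_odd_core cGv nQG qQ vQ fus G16.
exists N; split=> //; have [|cYv nQY qQY vQY fusY] := quat_odd_quotient nNG oN.
  by rewrite iN.
apply: (quat_rel48 cYv nQY qQY vQY fusY).
by rewrite card_quotient ?normal_norm.
Qed.
End QuaternionQuotient.

Lemma expg2_conj_inv (gT : finGroupType) (q r : gT) :
  (q * r) ^+ 2 = r ^+ 2 -> q ^ r = q^-1.
Proof.
rewrite !expg2 mulgA => /mulIg e; apply: (mulgI r); rewrite -conjgC.
by apply: (mulIg q); rewrite mulgKV.
Qed.

(** * A quaternion Sylow subgroup: generators of SL(2,3) and SL(2,5) *)

Section SylowQuaternion.
Variables (gT : finGroupType) (G T : {group gT}) (v : gT).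
Hypotheses (cGv : cent4 G v) (sylT : 2.-Sylow(G) T) (qT : quat8 'Z(G)%G T).
Hypothesis cT : 'C_(G / 'Z(G))[coset 'Z(G) v] = T / 'Z(G).
Hypothesis fT : {in T :\: 'Z(G), forall x,
  coset 'Z(G) x \in coset 'Z(G) v ^: 'N_(G / 'Z(G))(T / 'Z(G))}.
Let Z := 'Z(G)%G.
Let X := (G / Z)%G.
Let V := (T / Z)%G.
Let H := 'N_X(V)%G.
Let nZG : G \subset 'N(Z). Proof. exact: gFnorm. Qed.
Let sTG : T \subset G. Proof. exact: pHall_sub sylT. Qed.
Let sZT : Z \subset T. Proof. by case: qT. Qed.
Let nZT : T \subset 'N(Z). Proof. exact: subset_trans nZG. Qed.
Let oZ : #|Z| = 2. Proof. by case: cGv. Qed.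
Let Gv : v \in G. Proof. by case: cGv. Qed.
Let oV : #|V| = 4.
Proof. by rewrite card_quotient // -divgS //= oZ; case: qT => _ ->. Qed.
Let sylV : 2.-Sylow(X) V. Proof. exact: quotient_pHall. Qed.
Let oX : (#|G| = 2 * #|X|)%N.
Proof. by rewrite -oZ card_quotient // Lagrange ?center_sub. Qed.

Let liftT y : y \in V -> y != 1 -> exists2 x, x \in T :\: Z & y = coset Z x.
Proof.
case/quotient_lift=> x [Nx Tx ->] x1; exists x => //; rewrite inE Tx andbT.
by apply: contra x1 => Zx; apply/eqP/coset_id.
Qed.

Let cosetT x : x \in T :\: Z -> coset Z x \in V /\ coset Z x != 1.
Proof.
case/setDP=> Tx Zx; rewrite mem_quotient //; split=> //.
by apply: contra Zx => /eqP/coset_idr; apply; apply: (subsetP nZT).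
Qed.

Lemma memT x : x \in 'N(Z) -> coset Z x \in V -> x \in T.
Proof.
move=> Nx /quotient_lift[y [Ny Ty /rcoset_kercosetP]] /(_ Nx Ny)/rcosetP[z Zz ->].
by rewrite groupM // (subsetP sZT).
Qed.

Lemma memTv : v \in T :\: Z.
Proof.
have [_ _ nZv _] := cGv; rewrite in_setD nZv; apply: memT; first exact: (subsetP nZG).
by rewrite /= -cT inE cent1id andbT mem_quotient.
Qed.

Lemma fusedV : {in V^#, forall x, x \in coset Z v ^: 'N_X(V)}.
Proof. by move=> x /setD1P[x1 /liftT/(_ x1)[y Ty ->]]; apply: fT. Qed.

Lemma sylow_quat_card : #|G| = 24 /\ X :=: H \/ #|G| = 120 /\ #|X| = 60.
Proof.
have [e|e] := fused_card sylV oV cT fusedV; [left|right]; rewrite oX.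
  have oH := four_cardH sylV oV cT fusedV; rewrite -e in oH.
  by rewrite /X oH; split.
by rewrite e.
Qed.

Lemma center_cent z x : z \in Z -> x \in G -> commute z x.
Proof. by move=> /centerP[_ c] Gx; apply: c. Qed.

Lemma sylow_quat_sqr x y : x \in T :\: Z -> y \in T :\: Z -> x ^+ 2 = y ^+ 2.
Proof.
have [t [t1 t2 Zt]] := center2_gen cGv; have [_ _ sq] := qT.
by move=> /sq[x2 /Zt[e|->]] /sq[y2 /Zt[e'|->]] //; rewrite ?e ?e' eqxx in x2 y2.
Qed.

(** A lift [x] has its cube in [Z], so [x ^+ 6 = 1]; the power [x ^+ 4] has the same image and cube
    one. *)
Lemma lift_order_three d : d \in X -> #[d] = 3 ->
  exists d', [/\ d' \in G, d = coset Z d', d' ^+ 3 = 1 & #[d'] = 3].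
Proof.
case/quotient_lift=> x [Nx Gx ->] od.
have Zx3 : x ^+ 3 \in Z.
  by apply: coset_idr; rewrite ?groupX // cosetX // -od expg_order.
have x6 : x ^+ 6 = 1.
  by apply/eqP; rewrite -[6]/(3 * 2)%N expgM -order_dvdn; have := order_dvdG Zx3; rewrite oZ.
have e : coset Z (x ^+ 4) = coset Z x.
  have e3 : coset Z x ^+ 3 = 1 by rewrite -{1}od expg_order.
  by rewrite cosetX // expgSr e3 mul1g.
have x12 : (x ^+ 4) ^+ 3 = 1 by rewrite -expgM -[(4 * 3)%N]/(6 * 2)%N expgM x6 expg1n.
exists (x ^+ 4); rewrite groupX // e; split=> //.
apply: nt_prime_order => //; apply/eqP=> x4.
by move: e od; rewrite x4 (coset_id (group1 _)) => <-; rewrite order1.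
Qed.

Section Order3.
Variable d : gT.
Hypotheses (Gd : d \in G) (od : #[d] = 3) (d3 : d ^+ 3 = 1) (Hd : coset Z d \in 'N(V)).

Let Nd : d \in 'N(Z). Proof. exact: (subsetP nZG). Qed.

(** In the quotient an element of order three generates its own centraliser, which therefore meets
    the four-group trivially. *)
Lemma three_fixfree k x : 0 < k < 3 -> x \in T :\: Z -> coset Z (x ^ (d ^+ k)) != coset Z x.
Proof.
move=> k3 Tx; have [Vx x1] := cosetT Tx; have Nx : x \in 'N(Z) by apply: (subsetP nZT); case/setDP: Tx.
have Ndk : d ^+ k \in 'N(Z) by rewrite groupX.
rewrite cosetJ //; apply/negP=> /eqP/conjg_fixP/commgP/commute_sym cdx.
have odk : #[coset Z (d ^+ k)] = 3.
  apply: nt_prime_order => //.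
    by rewrite -cosetX // -expgM mulnC expgM d3 expg1n; apply/coset_id/group1.
  apply/eqP=> /(coset_idr Ndk)/order_dvdG; rewrite oZ => h.
  have : #[d ^+ k] %| gcdn 2 3 by rewrite dvdn_gcd h order_dvdn -expgM mulnC expgM d3 expg1n eqxx.
  rewrite -[gcdn 2 3]/1%N dvdn1 order_eq1 -order_dvdn od.
  by case: (k) k3 => [|[|[|]]].
have Xdk : coset Z (d ^+ k) \in X by rewrite mem_quotient ?groupX.
have := order_three_cent sylV oV cT fusedV Xdk odk.
move/setP/(_ (coset Z x)); rewrite in_setI (subsetP (pHall_sub sylV) _ Vx).
rewrite [_ && _](_ : _ = true); last by apply/cent1P/commute_sym.
move/esym => /order_dvdG; rewrite -orderE odk.
have := order_dvdG Vx; rewrite oV => h1 h2.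
have : #[coset Z x] %| gcdn 4 3 by rewrite dvdn_gcd h1.
by rewrite -[gcdn 4 3]/1%N dvdn1 order_eq1 (negPf x1).
Qed.

Lemma conjT k x : x \in T :\: Z -> x ^ (d ^+ k) \in T :\: Z.
Proof.
case/setDP=> Tx Zx; have Gdk : d ^+ k \in G by rewrite groupX.
rewrite in_setD memJ_norm ?(subsetP nZG) // Zx /=.
have Nx := subsetP nZT _ Tx; have Ndk := subsetP nZG _ Gdk.
have : coset Z (x ^ d ^+ k) \in V.
  by rewrite cosetJ // cosetX // memJ_norm ?groupX // mem_quotient.
by apply: memT; rewrite groupJ.
Qed.

(** Modulo [Z] the four-group consists of [1], [x], [x ^ d], [x * x ^ d], so the last relation holds
    up to a central factor. If that factor is the involution [t], replacing [x] by [t * x] adds one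
    factor [t] on the left and two on the right. *)
Lemma sylow_quat_rel24 x : x \in T :\: Z -> exists q,
  [/\ q \in T :\: Z, coset Z q = coset Z x, rel24 q d
    & forall L : {group gT}, q \in L -> d \in L -> T \subset L].
Proof.
have [t [t1 t2 Zt]] := center2_gen cGv.
have gen q : q \in T :\: Z -> forall L : {group gT}, q \in L -> d \in L -> T \subset L.
  move=> Tq L Lq Ld; apply: (quat8_gen qT oZ nZT Tq (conjT 1 Tq)); rewrite ?groupJ //.
  by rewrite eq_sym three_fixfree.
have rel q : q \in T :\: Z -> (q ^ d) ^ d = q * q ^ d -> rel24 q d.
  move=> Tq e; have Tr := conjT 1 Tq; have Trd := conjT 2 Tq.
  have [_ _ /(_ q Tq)[_ Zq2]] := qT.
  split=> //.
  - by have := order_dvdG Zq2; rewrite oZ order_dvdn => /eqP.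
  - by apply: center_cent.
  by apply: expg2_conj_inv; rewrite -e -conjgM -expg2; apply: sylow_quat_sqr.
move=> Tx; have [Vx x1] := cosetT Tx.
have [Vy y1] := cosetT (conjT 1 Tx); have [Vw w1] := cosetT (conjT 2 Tx).
have Nxd : x ^ d \in 'N(Z) by apply: (subsetP nZT); case/setDP: (conjT 1 Tx).
have Nx : x \in 'N(Z) by apply: (subsetP nZT); case/setDP: Tx.
have [z Zz exdd] : exists2 z, z \in Z & (x ^ d) ^ d = z * (x * x ^ d).
  have sq := four_sqr sylV oV cT fusedV.
  have neq : coset Z (x ^ d) != coset Z x := three_fixfree (k := 1) isT Tx.
  have [] := involution_cent4 (sq _ Vx) x1 neq y1 Vx Vy oV Vw.
  - by move/eqP: w1.
  - by move/eqP: (three_fixfree (k := 2) isT Tx).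
  - move/eqP: (three_fixfree (k := 1) isT (conjT 1 Tx)).
    by rewrite -!conjgM -expg2.
  rewrite -cosetM //; rewrite expg2 conjgM => /rcoset_kercosetP.
  by rewrite groupJ // groupM // => /(_ isT isT)/rcosetP.
have [ez|ez] := Zt z Zz.
  exists x; split=> //; last exact: gen.
  by apply: rel; rewrite // exdd ez mul1g.
have Gt : t \in G by rewrite -ez; case/centerP: Zz.
have ct u : u \in G -> commute t u by rewrite -ez; apply: center_cent.
have Gx : x \in G by case/setDP: Tx => /(subsetP sTG).
have Tq : t * x \in T :\: Z.
  by case/setDP: Tx => Tx Zx; rewrite in_setD -ez groupMl // Zx groupMl // (subsetP sZT).
have etd : t ^ d = t by apply/conjg_fixP/commgP/ct.
exists (t * x); split=> //; last exact: gen.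
  by rewrite (cosetM (subsetP nZG _ Gt) Nx) coset_id ?mul1g // -ez.
have e1 : (t * x) ^ d = t * x ^ d by rewrite conjMg etd.
apply: rel; rewrite // e1 conjMg etd exdd ez; move: (x ^ d) => y.
by rewrite -(mulgA t x) (mulgA x t) -(ct x Gx) -(mulgA t x).
Qed.

End Order3.

Lemma dvd24 (L : {group gT}) d : T \subset L -> d \in L -> #[d] = 3 -> 24 %| #|L|.
Proof.
move=> sTL Ld od; rewrite (@Gauss_dvd 8 3) // -{2}od order_dvdG // andbT.
by have [_ <- _] := qT; rewrite cardSg.
Qed.

Lemma sylow_quat_SL23 : #|G| = 24 -> exists q d,
  [/\ q \in G, d \in G, rel24 q d & <<[set q; d]>> = G].
Proof.
move=> oG; have [[_ eX]|[]] := sylow_quat_card; last by rewrite oG.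
have [||d Gd od] := @Cauchy _ 3 G; rewrite ?oG //.
have d3 : d ^+ 3 = 1 by rewrite -od expg_order.
have Hd : coset Z d \in 'N(V).
  by have : coset Z d \in X; [apply: mem_quotient | rewrite eX => /setIP[]].
have [q [Tq _ R gen]] := sylow_quat_rel24 Gd od d3 Hd memTv.
have Gq : q \in G by case/setDP: Tq => /(subsetP sTG).
exists q, d; split=> //; pose L := <<[set q; d]>>%G.
have Lq : q \in L by rewrite mem_gen // !inE eqxx.
have Ld : d \in L by rewrite mem_gen // !inE eqxx orbT.
apply/eqP; rewrite eqEcard gen_subG subUset !sub1set Gq Gd oG /=.
by rewrite dvdn_leq // (dvd24 (gen L Lq Ld) Ld).
Qed.

(** The generators lift those of [braid]. The square of [y0] is [t] because its image is conjugate
    to that of [v], and cubing shows that it inverts [d] exactly. Only [(y0 * q) ^+ 3] may be [t],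
    which replacing [y0] by [t * y0] repairs. *)
Lemma sylow_quat_SL25 : #|G| = 120 -> exists q d y,
  [/\ [/\ q \in G, d \in G & y \in G], rel120 q d y & <<[set q; d; y]>> = G].
Proof.
move=> oG; have [[]|[_ o60]] := sylow_quat_card; first by rewrite oG.
have [db [i [Hdb odb Ii nHi dbi]]] := sixty_di sylV oV cT fusedV o60.
have [Xdb Ndb] := setIP Hdb.
have [d [Gd ed d3 od]] := lift_order_three Xdb odb.
have Hd : coset Z d \in 'N(V) by rewrite -ed.
have [qb [Vqb qb1 br]] := braid sylV oV cT fusedV o60 Hdb odb Ii nHi dbi.
have [x Tx ex] := liftT Vqb qb1.
have [q [Tq eq R gen]] := sylow_quat_rel24 Gd od d3 Hd Tx.
have Gq : q \in G by case/setDP: Tq => /(subsetP sTG).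
have Xi : i \in X by case/imsetP: Ii => g Xg ->; rewrite groupJ // mem_quotient.
have [y0 [Ny0 Gy0 ei]] := quotient_lift Xi.
have [t [t1 t2 Zt]] := center2_gen cGv; have [_ _ sq] := qT.
have [q2 Zq2] := sq q Tq.
have eqt : q ^+ 2 = t by have [e|//] := Zt _ Zq2; rewrite e eqxx in q2.
have Zt' : t \in Z by rewrite -eqt.
have ct u : u \in G -> commute t u by apply: center_cent.
have Gt : t \in G by case/centerP: Zt'.
have y02 : y0 ^+ 2 = t.
  have [g Gg ->] : exists2 g, g \in G & y0 ^+ 2 = (v ^+ 2) ^ g.
    by apply: conj_mod_sqr => //; rewrite -/Z -ei.
  by rewrite (sylow_quat_sqr memTv Tq) eqt; apply/conjg_fixP/commgP/ct.
have [Nd Nq] := (subsetP nZG _ Gd, subsetP nZG _ Gq).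
have dy0 : d ^ y0 = d^-1.
  have : coset Z (d ^ y0) = coset Z d^-1 by rewrite cosetJ // -ei -ed dbi ed -morphV.
  move/rcoset_kercosetP; rewrite groupJ // groupV => /(_ isT Nd)/rcosetP[z Zz e].
  have [ez|ez] := Zt z Zz; first by rewrite e ez mul1g.
  have : (d ^ y0) ^+ 3 = 1 by rewrite -conjXg d3 conj1g.
  rewrite e ez expgMn; last by apply: ct; rewrite groupV.
  rewrite expgVn d3 invg1 mulg1 expgS t2 mulg1 => e1.
  by rewrite e1 eqxx in t1.
have [y [Gy ey y2 dy yq]] : exists y,
    [/\ y \in G, coset Z y = i, y ^+ 2 = t, d ^ y = d^-1 & (y * q) ^+ 3 = 1].
  have Zb : (y0 * q) ^+ 3 \in Z.
    apply: coset_idr; first by rewrite groupX ?groupM.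
    by rewrite cosetX ?groupM // cosetM // -ei eq -ex.
  have [e|e] := Zt _ Zb; first by exists y0.
  exists (t * y0); split; rewrite ?groupM //.
  - by rewrite cosetM ?(subsetP nZG _ Gt) // (coset_id Zt') mul1g.
  - by rewrite (expgMn _ (ct _ Gy0)) t2 mul1g.
  - by rewrite conjgM (_ : d ^ t = d) //; apply/conjg_fixP/commgP/commute_sym/ct.
  - rewrite -mulgA expgMn; last by apply: ct; rewrite groupM.
    by rewrite e -expgSr -[4%N]/(2 * 2)%N expgM t2 expg1n.
exists q, d, y; split=> //; first by split; rewrite // y2.
pose L := <<[set q; d; y]>>%G; pose L0 := <<[set q; d]>>%G.
have Lq : q \in L by rewrite mem_gen // !inE eqxx.
have Ld : d \in L by rewrite mem_gen // !inE eqxx orbT.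
have Ly : y \in L by rewrite mem_gen // !inE eqxx orbT.
have L0q : q \in L0 by rewrite mem_gen // !inE eqxx.
have L0d : d \in L0 by rewrite mem_gen // !inE eqxx orbT.
have sLG : L \subset G by rewrite gen_subG !subUset !sub1set Gq Gd Gy.
have /dvdnP[k ek] := dvd24 (gen L Lq Ld) Ld od.
have := cardSg sLG; rewrite oG ek -[120]/(5 * 24)%N dvdn_pmul2r //.
have [ek1|k1] := eqVneq k 1%N; last first.
  move/(prime_nt_dvdP (isT : prime 5)) => /(_ k1) k5.
  by apply/eqP; rewrite eqEcard sLG -/L ek k5 oG.
(* In the remaining case [L] has order 24, so it is generated by [q] and [d] and its image
   normalises [V]; but the image [i] of [y] does not. *)
have oL0 : #|L0| = 24.
  apply/eqP; rewrite eqn_leq rel24_bound //= dvdn_leq // (dvd24 (gen L0 L0q L0d) L0d) //.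
move=> _; have eL : L0 :=: L.
  have sL0 : L0 \subset L by rewrite gen_subG subUset !sub1set Lq Ld.
  by apply/eqP; rewrite eqEcard sL0 oL0 ek ek1.
case/negP: nHi; rewrite in_setI Xi /= -ey.
have : L0 \subset coset Z @*^-1 'N(V).
  rewrite gen_subG subUset !sub1set !mem_morphpre //= ?Hd ?andbT //.
  apply: (subsetP (normG V)); apply: mem_quotient; by case/setDP: Tq.
by rewrite eL => /subsetP/(_ y Ly)/morphpreP[].
Qed.

End SylowQuaternion.

(** * Generators of SL(2,3), SL(2,5) and GL(2,3) *)

Lemma det_GLM n (R : finComUnitRingType) (u v : {'GL_n[R]}) :
  (\det (GLval (u * v)%g) = \det (GLval u) * \det (GLval v))%R.
Proof. by rewrite GL_ME det_mulmx. Qed.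

Definition mx2 (p : nat) (a b c d : 'F_p) : 'M['F_p]_2 :=
  (\matrix_(i < 2, j < 2) if i == 0 then (if j == 0 then a else b)
                         else if j == 0 then c else d)%R.

(** Singular entries give the default [1], so the lemmas assume a nonzero determinant. The lock
    makes [gl2] opaque to conversion; products are computed entry by entry through [gl2M]. *)
HB.lock Definition gl2 (p : nat) (a b c d : 'F_p) : {'GL_2(p)} :=
  insubd (1 : {'GL_2(p)})%g (mx2 a b c d).

Section Matrices.
Variable p : nat.
Local Notation F := 'F_p.
Implicit Types a b c d : F.
Import GRing.Theory.
Local Open Scope ring_scope.

Lemma mx2_ext (A B : 'M[F]_2) : A 0 0 = B 0 0 -> A 0 1 = B 0 1 ->
  A 1 0 = B 1 0 -> A 1 1 = B 1 1 -> A = B.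
Proof.
move=> e1 e2 e3 e4; apply/matrixP=> i j.
have E (k : 'I_2) : k = 0 \/ k = 1.
  by case: k => [[|[|//]] h]; [left|right]; apply/val_inj.
by case: (E i) => ->; case: (E j) => ->.
Qed.

Lemma det_mx2 a b c d : \det (mx2 a b c d) = a * d - b * c.
Proof.
rewrite (expand_det_row _ 0) big_ord_recl big_ord1 /cofactor !det_mx11 !mxE /=.
by rewrite expr0 mul1r expr1 mulN1r mulrN.
Qed.

Lemma mulmx2 a b c d a' b' c' d' :
  mx2 a b c d *m mx2 a' b' c' d' =
  mx2 (a * a' + b * c') (a * b' + b * d') (c * a' + d * c') (c * b' + d * d').
Proof. by apply: mx2_ext; rewrite !mxE big_ord_recl big_ord1 !mxE. Qed.

Lemma gl2E a b c d : a * d - b * c != 0 -> GLval (gl2 a b c d) = mx2 a b c d.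
Proof.
move=> D; have U : mx2 a b c d \is a GRing.unit.
  by rewrite -[_ \is a _]/(_ \in unitmx) unitmxE det_mx2 unitfE.
by rewrite gl2.unlock; exact: (insubdK (1 : {'GL_2(p)})%g U).
Qed.

Lemma gl2M a b c d a' b' c' d' : a * d - b * c != 0 -> a' * d' - b' * c' != 0 ->
  (gl2 a b c d * gl2 a' b' c' d')%g =
  gl2 (a * a' + b * c') (a * b' + b * d') (c * a' + d * c') (c * b' + d * d').
Proof.
move=> D D'; apply/val_inj; rewrite -[LHS]/(GLval _ *m GLval _) (gl2E D) (gl2E D') mulmx2.
by rewrite -[RHS]/(GLval _) gl2E // -det_mx2 -mulmx2 det_mulmx mulf_neq0 ?det_mx2.
Qed.

Lemma gl2_1 : gl2 (1 : F) 0 0 1 = 1%g.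
Proof.
apply/val_inj; rewrite -[LHS]/(GLval _) gl2E ?mulr1 ?mul0r ?subr0 ?oner_eq0 //.
by apply: mx2_ext; rewrite !mxE.
Qed.

Lemma gl2_inj a b c d a' b' c' d' : a * d - b * c != 0 -> a' * d' - b' * c' != 0 ->
  gl2 a b c d = gl2 a' b' c' d' -> [/\ a = a', b = b', c = c' & d = d'].
Proof.
move=> D D' /(congr1 GLval); rewrite (gl2E D) (gl2E D') => /matrixP e.
by have := (e 0 0, e 0 1, e 1 0, e 1 1); rewrite !mxE /= => -[[[-> ->] ->] ->].
Qed.

Lemma det_gl2 a b c d : a * d - b * c != 0 -> \det (gl2 a b c d) = a * d - b * c.
Proof. by move=> D; rewrite gl2E // det_mx2. Qed.

(** The determinant recovers [u] from [diag(u, 1) * g], so the pairs [(u, g)] embed in ['GL_2(p)].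
    Matching lower bounds come from explicit generators. *)
Lemma card_SL2 : prime p -> (p.-1 * #|'SL_2(p)| <= #|'GL_2(p)|)%N.
Proof.
move=> pr; have Dg (u : F) : u != 0 -> u * 1 - 0 * 0 != 0.
  by rewrite mulr1 mul0r subr0.
pose A := setX [set~ (0 : F)] 'SL_2(p).
pose f (x : F * {'GL_2(p)}) := (gl2 (x.1 : F) 0 0 1%R * x.2)%g.
have <- : #|A| = (p.-1 * #|'SL_2(p)|)%N by rewrite cardsX cardsC1 card_Fp.
have detf x : x \in A -> \det (GLval (f x)) = x.1.
  case: x => u g; rewrite in_setX in_setC1 => /andP[x1]; rewrite inE => /eqP d1.
  apply: etrans (det_GLM _ _) _; rewrite det_gl2; last first.
    exact: Dg.
  by apply: etrans (congr1 _ d1) _; rewrite !mulr1 mul0r subr0.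
have <- : #|f @: A| = #|A|.
  apply: card_in_imset => x y Ax Ay e; have e1 : x.1 = y.1 by rewrite -!detf ?e.
  case: x y e1 Ax Ay e => [x1 x2] [y1 y2] /= <- _ _ e; congr (_, _).
  by apply: (mulgI (gl2 (x1 : F) 0 0 1%R)); exact: e.
by rewrite subset_leq_card // subsetT.
Qed.

End Matrices.

Lemma expg3 (gT : finGroupType) (x : gT) : x ^+ 3 = x * (x * x).
Proof. by []. Qed.

Lemma expg5 (gT : finGroupType) (x : gT) : x ^+ 5 = x * (x * (x * (x * x))).
Proof. by []. Qed.

Lemma gl2_conj p (x y z : {'GL_2(p)}) : x * y = y * z -> x ^ y = z.
Proof. by move=> e; rewrite conjgE e mulKg. Qed.

Lemma gl2_conjV p (x y z : {'GL_2(p)}) : x * y * z = y -> x ^ y = z^-1.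
Proof. by move=> e; apply: (mulIg z); rewrite mulVg conjgE -(mulgA y^-1) e mulVg. Qed.

Local Ltac gl2_eval := by rewrite ?gl2M //; congr (gl2 _ _ _ _); apply/eqP.

(** If [r = q ^ d] were a power of [q] it would commute with [q], and [q] would equal its inverse;
    so [q] and [r] generate a group of order eight, and [d] contributes the factor three. *)
Lemma rel24_dvd (gT : finGroupType) (q d : gT) (L : {group gT}) :
  rel24 q d -> q ^+ 2 != 1 -> d != 1 -> q \in L -> d \in L -> 24 %| #|L|.
Proof.
move=> R q2 d1 Lq Ld; have [z2 czd d3 qr rd] := R; pose r := q ^ d.
have oq : #[q] = 4.
  have : #[q] %| 4 by rewrite order_dvdn -[4]/(2 * 2)%N expgM z2.
  by case/dvdn4=> // e; case/negP: q2; rewrite -order_dvdn e.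
have od : #[d] = 3 by apply: nt_prime_order.
have Lr : r \in L by rewrite groupJ.
have rq : r \notin <[q]>.
  apply/negP=> /cycleP[k er]; case/negP: q2.
  rewrite expg2 -eq_invg_mul -qr; apply/eqP/conjg_fixP/commgP.
  by rewrite -/r er; apply: commuteX.
pose Q := (<[q]> <*> <[r]>)%G.
have oQ : #|Q| <= 8.
  apply: (@join_cycle_bound _ <[q]>%G r 2 4); rewrite // -?orderE ?oq //.
    by rewrite inE -cycleJ cycle_subG qr groupV cycle_id.
  by rewrite -conjXg; have /commgP/conjg_fixP-> := czd; rewrite mem_cycle.
have Q8 : #|Q| = 8.
  have sqQ : <[q]> \proper Q.
    rewrite properE joing_subl; apply: contra rq => /subsetP; apply.
    by rewrite mem_gen // inE cycle_id orbT.
  have := proper_card sqQ; have := cardSg (proper_sub sqQ); rewrite -orderE oq.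
  by move: oQ; case: #|_| => [|[|[|[|[|[|[|[|[|]]]]]]]]].
rewrite (@Gauss_dvd 8 3) // -{1}Q8 -od order_dvdG // andbT cardSg //.
by rewrite join_subG !cycle_subG Lq.
Qed.

(** For determinant one, trace 0 gives square [-1], trace [-1] gives cube [1] and trace 1 gives cube
    [-1]; the entries are chosen by this rule. Conjugation by [gl23_v = diag(1, -1)] changes the
    off-diagonal signs and so swaps [gl23_a] and [gl23_b]. *)
Notation sl23_q := (gl2 (0 : 'F_3) 1 2%:R 0)%R.
Notation sl23_d := (gl2 (1 : 'F_3) 1 0 1)%R.
Notation sl25_q := (gl2 (0 : 'F_5) 1 4%:R 0)%R.
Notation sl25_d := (gl2 (1 : 'F_5) 2%:R 1 3%:R)%R.
Notation sl25_y := (gl2 (3%:R : 'F_5) 1 0 2%:R)%R.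
Notation gl23_a := (gl2 (0 : 'F_3) 1 2%:R 1)%R.
Notation gl23_b := (gl2 (0 : 'F_3) 2%:R 1 1)%R.
Notation gl23_v := (gl2 (1 : 'F_3) 0 0 2%:R)%R.

Section SL23.
Local Open Scope ring_scope.
Lemma sl23_rel : rel24 sl23_q sl23_d.
Proof.
have qd : (sl23_q ^ sl23_d = gl2 (1%R : 'F_3) 2%:R 2%:R 2%:R)%g by apply: gl2_conj; gl2_eval.
have q2 : (sl23_q ^+ 2 = gl2 (2%:R : 'F_3) 0 0 2%:R)%g by rewrite expg2; gl2_eval.
split.
- by rewrite q2 expg2 -gl2_1; gl2_eval.
- by rewrite q2 /commute; gl2_eval.
- by rewrite expg3 -gl2_1; gl2_eval.
- by rewrite qd; apply: gl2_conjV; gl2_eval.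
by rewrite qd; apply: gl2_conj; gl2_eval.
Qed.

Lemma sl23_gen : <<[set sl23_q; sl23_d]>>%g = 'SL_2(3) /\ #|'SL_2(3)| = 24%N.
Proof.
have sL : <<[set sl23_q; sl23_d]>>%g \subset 'SL_2(3).
  by rewrite gen_subG subUset !sub1set !inE !det_gl2.
have le : (#|'SL_2(3)| <= 24)%N.
  have := card_SL2 (isT : prime 3); rewrite card_GL_2 card_Fp //.
  by rewrite -[(3 * _ * _)%N]/(2 * 24)%N leq_pmul2l.
have ge : (24 %| #|<<[set sl23_q; sl23_d]>>%g|)%N.
  apply: (rel24_dvd sl23_rel); rewrite ?mem_gen ?inE ?eqxx ?orbT //.
    rewrite expg2 gl2M // -gl2_1; apply/eqP=> /gl2_inj[] // /eqP.
  rewrite -gl2_1; apply/eqP=> /gl2_inj[] // _ /eqP.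
have e : #|<<[set sl23_q; sl23_d]>>%g| = 24%N.
  apply/eqP; rewrite eqn_leq (leq_trans (subset_leq_card sL) le) /=.
  by rewrite dvdn_leq.
by split; apply/eqP; rewrite ?eqEcard ?sL ?eqn_leq ?le ?e //= -e subset_leq_card.
Qed.
End SL23.

Section SL25.
Local Open Scope ring_scope.
Lemma sl25_rel : rel120 sl25_q sl25_d sl25_y.
Proof.
have qd : (sl25_q ^ sl25_d = gl2 (0 : 'F_5) 3%:R 3%:R 0)%g by apply: gl2_conj; gl2_eval.
have q2 : (sl25_q ^+ 2 = gl2 (4%:R : 'F_5) 0 0 4%:R)%g by rewrite expg2; gl2_eval.
split.
- split.
  + by rewrite q2 expg2 -gl2_1; gl2_eval.
  + by rewrite q2 /commute; gl2_eval.
  + by rewrite expg3 -gl2_1; gl2_eval.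
  + by rewrite qd; apply: gl2_conjV; gl2_eval.
  by rewrite qd; apply: gl2_conj; gl2_eval.
- by rewrite q2 expg2; gl2_eval.
- by apply: gl2_conjV; gl2_eval.
by rewrite expg3 -gl2_1; gl2_eval.
Qed.

Lemma sl25_gen :
  <<[set sl25_q; sl25_d; sl25_y]>>%g = 'SL_2(5) /\ #|'SL_2(5)| = 120%N.
Proof.
pose L := <<[set sl25_q; sl25_d; sl25_y]>>%G.
have [Lq Ld Ly] : [/\ sl25_q \in L, sl25_d \in L & sl25_y \in L].
  by rewrite !mem_gen ?inE ?eqxx ?orbT.
have sL : L \subset 'SL_2(5).
  by rewrite gen_subG !subUset !sub1set !inE !det_gl2.
have le : (#|'SL_2(5)| <= 120)%N.
  have := card_SL2 (isT : prime 5); rewrite card_GL_2 card_Fp //.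
  by rewrite -[(5 * _ * _)%N]/(4 * 120)%N leq_pmul2l.
have ge : (24 %| #|L|)%N.
  have [R _ _ _] := sl25_rel; apply: (rel24_dvd R) => //.
    rewrite expg2 gl2M // -gl2_1; apply/eqP=> /gl2_inj[] // /eqP.
  by rewrite -gl2_1; apply/eqP=> /gl2_inj[] // _ /eqP.
have ge5 : (5 %| #|L|)%N.
  (* The square of this product has determinant one and trace two and is not the identity, so it is
     unipotent of order five. *)
  pose x := (sl25_q * sl25_d * sl25_y)%g.
  have ex : (x ^+ 2 = gl2 (3%:R : 'F_5) 1%R 1%R 4%:R)%g by rewrite expg2 /x; gl2_eval.
  have ox : #[(x ^+ 2)%g] = 5%N.
    apply: nt_prime_order => //; rewrite ex -gl2_1.
      by rewrite expg5; gl2_eval.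
    by apply/eqP=> /gl2_inj[] // _ /eqP.
  have Lx : (x ^+ 2)%g \in L by rewrite groupX // !groupM.
  by move: (order_dvdG Lx); rewrite ox.
have e : #|L| = 120%N.
  apply/eqP; rewrite eqn_leq (leq_trans (subset_leq_card sL) le) /=.
  by rewrite dvdn_leq // (@Gauss_dvd 24%N 5%N) // ge.
by split; apply/eqP; rewrite ?eqEcard ?sL ?eqn_leq ?le -/L ?e //= -e subset_leq_card.
Qed.
End SL25.

Section GL23.
Local Open Scope ring_scope.
Lemma gl23_rel : rel48 gl23_a gl23_b gl23_v /\ (gl23_v ^+ 2 = 1)%g.
Proof.
have v2 : (gl23_v ^+ 2 = 1)%g by rewrite expg2 -gl2_1; gl2_eval.
have a3 : (gl23_a ^+ 3 = gl2 (2%:R : 'F_3) 0 0 2%:R)%g by rewrite expg3; gl2_eval.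
split=> //; split; rewrite ?a3 ?v2 ?group1 //.
- by rewrite expg3; gl2_eval.
- by rewrite expg2; gl2_eval.
- by apply: gl2_conj; gl2_eval.
by apply: gl2_conj; gl2_eval.
Qed.

Lemma sl23_sub : 'SL_2(3) \subset <<[set gl23_a; gl23_b]>>%g.
Proof.
have [<- _] := sl23_gen; pose L := <<[set gl23_a; gl23_b]>>%G.
have [La Lb] : gl23_a \in L /\ gl23_b \in L by rewrite !mem_gen ?inE ?eqxx ?orbT.
rewrite gen_subG subUset !sub1set.
have -> : sl23_q = (gl23_a * gl23_b * gl23_b * gl23_a)%g by gl2_eval.
have -> : sl23_d = (gl23_b * gl23_b * gl23_a)%g by gl2_eval.
apply/andP; split; last exact: (groupM (groupM Lb Lb) La).
exact: (groupM (groupM (groupM La Lb) Lb) La).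
Qed.

Lemma gl23_gen : <<[set gl23_a; gl23_b; gl23_v]>>%g = 'GL_2(3) /\ #|'GL_2(3)| = 48%N.
Proof.
have oG : #|'GL_2(3)| = 48%N by rewrite card_GL_2 card_Fp.
split=> //; pose L := <<[set gl23_a; gl23_b; gl23_v]>>%G.
have Lv : gl23_v \in L by rewrite mem_gen ?inE ?eqxx ?orbT.
have [_ oS] := sl23_gen.
have sL : 'SL_2(3) \proper L.
  rewrite properE (subset_trans sl23_sub) ?genS ?subsetUl //=.
  by apply/negP=> /subsetP/(_ _ Lv); rewrite inE det_gl2.
apply/eqP; rewrite eqEcard subsetT oG -/L.
have := proper_card sL; have /dvdnP[k ->] := cardSg (proper_sub sL); rewrite oS.
by case: k => [|[|k]] // _; rewrite -[48%N]/(2 * 24)%N leq_pmul2r.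
Qed.
End GL23.

(** * Isomorphisms from the presentations *)

Lemma rel24_pair (gT rT : finGroupType) (q d : gT) (q' d' : rT) :
  rel24 q d -> rel24 q' d' -> @rel24 (gT * rT)%type (q, q') (d, d').
Proof.
case=> a1 a2 a3 a4 a5 [b1 b2 b3 b4 b5]; split.
- exact: (congr2 pair a1 b1).
- exact: (congr2 pair a2 b2).
- exact: (congr2 pair a3 b3).
- exact: (congr2 pair a4 b4).
exact: (congr2 pair a5 b5).
Qed.

Lemma rel120_pair (gT rT : finGroupType) (q d y : gT) (q' d' y' : rT) :
  rel120 q d y -> rel120 q' d' y' -> @rel120 (gT * rT)%type (q, q') (d, d') (y, y').
Proof.
case=> R a1 a2 a3 [R' b1 b2 b3]; split; first exact: rel24_pair.
- exact: (congr2 pair a1 b1).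
- exact: (congr2 pair a2 b2).
exact: (congr2 pair a3 b3).
Qed.

(** Membership of [v ^+ 2] in a cyclic group is not componentwise: one exponent [k] has to serve
    both sides, 0 for [GL(2,3)] and 1 for [J]. *)
Lemma rel48_pair (gT rT : finGroupType) (a b v : gT) (a' b' v' : rT) k :
  rel48 a b v -> rel48 a' b' v' ->
  v ^+ 2 = a ^+ 3 ^+ k -> v' ^+ 2 = a' ^+ 3 ^+ k ->
  @rel48 (gT * rT)%type (a, a') (b, b') (v, v').
Proof.
case=> a1 a2 a3 a4 _ [b1 b2 b3 b4 _] e e'; split.
- exact: (congr2 pair a1 b1).
- exact: (congr2 pair a2 b2).
- exact: (congr2 pair a3 b3).
- exact: (congr2 pair a4 b4).
apply/cycleP; exists k; have := congr2 pair e e'.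
have X n (x : gT) (x' : rT) : ((x, x') : (gT * rT)%type) ^+ n = (x ^+ n, x' ^+ n).
  by elim: n => // n IHn; rewrite !expgS IHn.
by rewrite !X.
Qed.

Lemma SL23_isog (gT : finGroupType) (G : {group gT}) q d :
  rel24 q d -> <<[set q; d]>> = G -> #|G| = 24 -> G \isog 'SL_2(3).
Proof.
move=> R gen oG; have [gen' oS] := sl23_gen.
have R2 := rel24_pair R sl23_rel.
pose D := <<[set (q, sl23_q); (d, sl23_d)]>>%G.
have [||||f /isom_isog h _] := @pair_isom _ _ G 'SL_2(3)%G D; last exact: h.
- by rewrite fst_gen imsetU !imset_set1.
- by rewrite snd_gen imsetU !imset_set1.
- by rewrite oG rel24_bound.
by rewrite oS rel24_bound.
Qed.

Lemma SL25_isog (gT : finGroupType) (G : {group gT}) q d y :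
  rel120 q d y -> <<[set q; d; y]>> = G -> #|G| = 120 -> G \isog 'SL_2(5).
Proof.
move=> R gen oG; have [gen' oS] := sl25_gen.
have R2 := rel120_pair R sl25_rel.
pose D := <<[set (q, sl25_q); (d, sl25_d); (y, sl25_y)]>>%G.
have [||||f /isom_isog h _] := @pair_isom _ _ G 'SL_2(5)%G D; last exact: h.
- by rewrite fst_gen !imsetU !imset_set1.
- by rewrite snd_gen !imsetU !imset_set1.
- by rewrite oG rel120_bound.
by rewrite oS rel120_bound.
Qed.

(** The values at [a] and [b] are kept in order to locate the preimage of ['SL_2(3)]. *)
Lemma GL23_isom (gT : finGroupType) (G : {group gT}) a b v :
  rel48 a b v -> <<[set a; b; v]>> = G -> #|G| = 48 -> v ^+ 2 = 1 ->
  exists2 f : {morphism G >-> {'GL_2(3)}}, isom G 'GL_2(3) f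
    & f a = gl23_a /\ f b = gl23_b.
Proof.
move=> R gen oG v2; have [gen' oS] := gl23_gen; have [R' v2'] := gl23_rel.
have R2 : @rel48 (gT * {'GL_2(3)})%type (a, gl23_a) (b, gl23_b) (v, gl23_v).
  by apply: (rel48_pair (k := 0)).
pose D := <<[set (a, gl23_a); (b, gl23_b); (v, gl23_v)]>>%G.
have [||||f h fE] := @pair_isom _ _ G 'GL_2(3)%G D.
- by rewrite fst_gen !imsetU !imset_set1.
- by rewrite snd_gen !imsetU !imset_set1.
- by rewrite oG rel48_bound.
- by rewrite oS rel48_bound.
exists f => //; split.
  by apply: (fE (a, gl23_a)); rewrite mem_gen // !inE eqxx.
by apply: (fE (b, gl23_b)); rewrite mem_gen // !inE eqxx orbT.
Qed.

Lemma rel48_J (gT : finGroupType) (a b v : gT) :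
  rel48 a b v -> v ^+ 2 = a ^+ 3 -> J_relations a b (a * b) v.
Proof.
by case=> ab abz av bv vz v2; split; rewrite ?v2 ?abz // -expg2.
Qed.

Lemma J_rel48 (gT : finGroupType) (a b c v : gT) :
  J_relations a b c v -> [/\ rel48 a b v, v ^+ 2 = a ^+ 3 & c = a * b].
Proof.
case=> ab bc cc abc av.
have ec : c = a * b by move: cc; rewrite expg2 => /mulIg.
have va : v ^+ 2 = a ^+ 3 by rewrite -abc -cc -bc.
split=> //; split; rewrite ?va ?cycle_id -?ec //.
  by rewrite ab bc.
by rewrite -{1}av -conjgM -expg2 va; apply/conjg_fixP/commgP/commuteX.
Qed.

Lemma join_gen3 (gT : finGroupType) (x y w : gT) :
  <[x]> <*> <[y]> <*> <[x * y]> <*> <[w]> = <<[set x; y; w]>>.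
Proof.
apply/eqP; rewrite eqEsubset; apply/andP; split.
  have [hx hy hw] : [/\ x \in <<[set x; y; w]>>, y \in <<[set x; y; w]>> & w \in <<[set x; y; w]>>].
    by rewrite !mem_gen // !inE eqxx ?orbT.
  by rewrite !join_subG !cycle_subG hx hy hw groupM.
rewrite gen_subG !subUset !sub1set.
rewrite (subsetP (joing_subr _ _) w (cycle_id w)) andbT.
have jl (A B : {set gT}) u : u \in A -> u \in A <*> B := subsetP (joing_subl A B) u.
apply/andP; split; apply: (jl); apply: (jl); first exact: (jl _ _ _ (cycle_id x)).
exact: subsetP (joing_subr _ _) _ (cycle_id y).
Qed.

(** Maximality among groups with this presentation: in the product of [G] with any such [H], the
    pairs of generators span a group of order at most 48, hence a copy of [G], and this projects
    onto [H]. *)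
Lemma isog_J_rel48 (gT : finGroupType) (G : {group gT}) a b v :
  rel48 a b v -> <<[set a; b; v]>> = G -> #|G| = 48 -> v ^+ 2 = a ^+ 3 -> isog_J G.
Proof.
move=> R gen oG v2; have [ab bc cc abc av] := rel48_J R v2.
apply: intro_isoGrp => [|rT H /existsP[[[[x y] z] w]] /=].
  apply/existsP; exists (((a, b), a * b), v) => /=.
  by rewrite !xpair_eqE /= join_gen3 gen ab bc cc abc av !eqxx.
rewrite !xpair_eqE /= => /and5P[/eqP genH /eqP x3 /eqP y3 /eqP z2 /andP[/eqP xyz /eqP xw]].
have [|R' w2 ez] := @J_rel48 _ x y z w; first by split; rewrite ?x3 ?y3 ?z2 ?xyz.
rewrite ez join_gen3 in genH.
have R2 : @rel48 (gT * rT)%type (a, x) (b, y) (v, w).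
  by apply: (rel48_pair (k := 1)); rewrite ?expg1.
pose D := <<[set (a, x); (b, y); (v, w)]>>%G.
have e1 : [morphism of fst : gT * rT -> gT] @* D = G.
  by rewrite morphimE setTI fst_gen !imsetU !imset_set1.
have e2 : [morphism of snd : gT * rT -> rT] @* D = H.
  by rewrite morphimE setTI snd_gen !imsetU !imset_set1.
have hGD : G \homg D by rewrite -e1 morphim_homg // subsetT.
apply: homg_trans (_ : D \homg G); first by rewrite -e2 morphim_homg // subsetT.
apply: isog_hom; rewrite isog_sym isogEcard hGD oG; exact: rel48_bound.
Qed.

Lemma rel48_sqr (gT : finGroupType) (a b v : gT) :
  rel48 a b v -> v ^+ 2 = 1 \/ v ^+ 2 = a ^+ 3.
Proof.
case=> h1 h2 _ _ /cycleP[k ->]; have [_ z2 _ _] := rel48_facts h1 h2.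
rewrite -(odd_double_half k) expgD -mul2n expgM z2 expg1n mulg1.
by case: (odd k); [right; rewrite expg1 | left].
Qed.

(** * The centraliser of an odd normal subgroup of index 48 *)

Lemma acts_by_inversionJ (gT : finGroupType) (N : {group gT}) v x :
  acts_by_inversion v N -> x \in 'N(N) -> acts_by_inversion (v ^ x) N.
Proof.
move=> iv Nx n Nn; have Nn' : n ^ x^-1 \in N by rewrite memJ_norm ?groupV.
by rewrite -{1}(conjgKV x n) -conjJg iv // conjVg conjgKV.
Qed.

Lemma acts_by_inversionV (gT : finGroupType) (N : {group gT}) v :
  acts_by_inversion v N -> v \in 'N(N) -> acts_by_inversion v^-1 N.
Proof.
move=> iv Nv n Nn; apply: (conjg_inj v); rewrite conjgKV conjVg iv // invgK //.
Qed.

Section FortyEightQuotient.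
Variables (gT : finGroupType) (G N : {group gT}) (v : gT) (a b : coset_of N).
Hypotheses (cGv : cent4 G v) (nNG : N <| G) (oN : odd #|N|) (iN : #|G : N| = 48).
Hypotheses (Ya : a \in G / N) (Yb : b \in G / N) (R : rel48 a b (coset N v)).
Hypothesis gen : <<[set a; b; coset N v]>> = G / N.
Let Gv : v \in G. Proof. by case: cGv. Qed.
Let nN : {subset G <= 'N(N)}. Proof. exact/subsetP/normal_norm. Qed.
Let invN : acts_by_inversion v N. Proof. exact: (cent4_odd_inversion cGv nNG oN). Qed.
Let C := 'C_G(N)%G.
Let sNC : N \subset C.
Proof. by rewrite subsetI normal_sub // -[_ \subset _]/(abelian N) (inversion_abelian invN). Qed.
Let nCG : C <| G.
Proof. by rewrite /normal subsetIl normsI ?normG // norms_cent ?normal_norm. Qed.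

(** [[~ x, v]] is the product of a conjugate of [v^-1] and [v], both inverting [N]. *)
Lemma cent_inverted_comm x : x \in G -> [~ x, v] \in C.
Proof.
move=> Gx; rewrite inE groupR //= commgEr; apply: two_inversions_cent => //.
by apply: acts_by_inversionJ (nN Gx); apply: acts_by_inversionV (nN Gv).
Qed.

(** Modulo [C] the element [v] is central, so lifts of [a] and [b = a ^ v] have a common image [X]
    there; [(a * b) ^+ 2 = a ^+ 3] becomes [X ^+ 4 = X ^+ 3], so [X = 1]. *)
Lemma rel48_sub_cent : <<[set a; b]>> \subset C / N.
Proof.
have [ab abz av bv _] := R; have [x [Nx Gx ea]] := quotient_lift Ya.
have nC : {subset G <= 'N(C)} by apply/subsetP/normal_norm.
have eb : b = coset N (x ^ v) by rewrite -av ea cosetJ ?nN.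
have ev : coset C (x ^ v) = coset C x.
  have -> : x ^ v = x * [~ x, v] by rewrite conjg_mulR.
  by rewrite (cosetM (nC _ Gx)) ?nC ?groupR // (coset_id (cent_inverted_comm Gx)) mulg1.
have Cx : x \in C.
  have Gxx : x * x ^ v \in G by rewrite groupM ?groupJ.
  have : coset N ((x * x ^ v) ^+ 2) = coset N (x ^+ 3).
    by rewrite !cosetX ?nN // (cosetM Nx) ?nN ?groupJ // -eb -ea.
  move/rcoset_kercosetP; rewrite !nN ?groupX // => /(_ isT isT)/rcosetP[n Nn e].
  have := congr1 (coset C) e; rewrite cosetX ?nC // (cosetM (nC _ Gx)) ?nC ?groupJ // ev.
  rewrite cosetM ?nC ?groupX //; last by rewrite (subsetP (normal_sub nNG)).
  rewrite (coset_id (subsetP sNC _ Nn)) mul1g cosetX ?nC //.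
  move: (coset C x) (@coset_idr _ C x (nC _ Gx)) => X h; rewrite -expg2 -expgM expgSr.
  by move/(canRL (mulKg _)); rewrite mulVg => /h.
rewrite gen_subG subUset !sub1set ea eb !mem_quotient // memJ_norm //.
exact: nC.
Qed.

Lemma cosetpre_sub_cent (W : {set coset_of N}) :
  W \subset <<[set a; b]>> -> coset N @*^-1 W \subset 'C(N).
Proof.
move=> sW; apply: subset_trans (morphpreS _ (subset_trans sW rel48_sub_cent)) _.
by rewrite quotientGK ?subsetIr // (normalS _ _ nNG) // subsetIl.
Qed.

Lemma quotient_GL23_or_J :
  GL23_quotient_SL_centralises G N \/ J_quotient_SL_centralises G N.
Proof.
have oY : #|G / N| = 48 by rewrite card_quotient ?normal_norm.
case: (rel48_sqr R) => v2; [left | right].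
  have [f isof [fa fb]] := GL23_isom R gen oY v2; exists f => //.
  apply: cosetpre_sub_cent; have [injf imf] := isomP isof.
  have sab : <<[set a; b]>> \subset G / N by rewrite -gen genS // subsetUl.
  rewrite -(injmK injf sab) morphpreS //.
  have -> : f @* <<[set a; b]>> = <<[set gl23_a; gl23_b]>>.
    by rewrite morphim_gen ?subUset ?sub1set ?Ya ?Yb // morphimU !morphim_set1 // fa fb.
  exact: sl23_sub.
split; first exact: isog_J_rel48 R gen oY v2.
exists a, b, (a * b), (coset N v); split; first exact: rel48_J.
  apply/eqP; rewrite eqEsubset -gen; apply/andP; split; last first.
    by apply: genS; rewrite !subUset !sub1set !inE !eqxx ?orbT.
  rewrite gen_subG !subUset !sub1set groupM ?mem_gen ?inE ?eqxx ?orbT //.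
apply: cosetpre_sub_cent.
by rewrite gen_subG !subUset !sub1set groupM ?mem_gen ?inE ?eqxx ?orbT.
Qed.
End FortyEightQuotient.

(** * Graph isomorphisms *)

Lemma giso_trans (A B C : sgraph) : A ~= B -> B ~= C -> A ~= C.
Proof.
case=> f bf fE [g bg gE]; exists (g \o f); first exact: bij_comp.
by move=> x y /=; rewrite gE fE.
Qed.

Lemma giso_union (A A' B B' : sgraph) : A ~= A' -> B ~= B' -> A + B ~= A' + B'.
Proof.
case=> f [f' fK f'K] fE [g [g' gK g'K] gE].
exists (fun x : (A + B)%graph => match x with inl a => inl (f a) | inr b => inr (g b) end : (A' + B')%graph).
  exists (fun x : (A' + B')%graph => match x with inl a => inl (f' a) | inr b => inr (g' b) end : (A + B)%graph).
    by case=> z /=; rewrite ?fK ?gK.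
  by case=> z /=; rewrite ?f'K ?g'K.
by case=> x [] y /=.
Qed.

Section Induced.
Variables (A : sgraph) (P : pred A).
Definition induced_rel (x y : {x : A | P x}) := sedge (val x) (val y).
Fact induced_sym : symmetric induced_rel.
Proof. by move=> x y; rewrite /induced_rel sedge_sym. Qed.
Fact induced_irr : irreflexive induced_rel.
Proof. by move=> x; rewrite /induced_rel sedge_irr. Qed.
Definition induced := SGraph induced_sym induced_irr.
End Induced.

Lemma induced_full (A : sgraph) (P : pred A) : (forall x, P x) -> A ~= induced P.
Proof.
move=> Px; exists (fun x : A => exist _ x (Px x) : induced P) => //.
exists (fun y : induced P => val y) => [x //|y]; exact: val_inj.
Qed.

Lemma induced_union (A : sgraph) (P Q R : pred A) :
  (forall x, R x = P x || Q x) ->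
  (forall x, P x -> ~~ Q x) -> (forall x y, P x -> Q y -> ~~ sedge x y) ->
  induced R ~= induced P + induced Q.
Proof.
move=> RE PQ nE.
have PR (x : induced P) : R (val x) by rewrite RE (valP x).
have QR (x : induced Q) : R (val x) by rewrite RE (valP x) orbT.
pose g (x : (induced P + induced Q)%graph) : induced R :=
  match x with inl a => exist _ (val a) (PR a) | inr b => exist _ (val b) (QR b) end.
have gI : injective g.
  move=> [a|b] [a'|b'] /(congr1 val) /= e; first by congr inl; apply: val_inj.
  - by have := PQ _ (valP a : P (val a)); rewrite (e : val a = val b') (valP b' : Q _).
  - by have := PQ _ (valP a' : P (val a')); rewrite -(e : val b = val a') (valP b : Q _).
  by congr inr; apply: val_inj.
have [h hK gK] : bijective g.
  apply: (inj_card_bij gI); rewrite -[X in X <= _]/#|{: {x : A | R x}}|.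
  rewrite card_sum !card_sig -cardUI [X in _ <= X + _](_ : _ = #|[pred x | R x]|) ?leq_addr //.
  by apply: eq_card => x; rewrite !inE RE.
exists h; first by exists g.
move=> x y; rewrite -{2}(gK x) -{2}(gK y) /=; case: (h x) => a; case: (h y) => b //=.
  by symmetry; apply/negbTE/nE; rewrite ?(valP a) ?(valP b).
by rewrite /induced_rel sedge_sym; symmetry; apply/negbTE/nE; rewrite ?(valP a) ?(valP b).
Qed.

Lemma index_eq (T : eqType) (s : seq T) x y :
  x \in s -> index x s = index y s -> x = y.
Proof.
move=> sx e; have sy : y \in s by rewrite -index_mem -e index_mem.
by rewrite -(nth_index x sx) e nth_index.
Qed.

(** Being equal or adjacent is an equivalence on [P] with classes of size [n]. A vertex is sent to
    the position of its class among the classes and to its own position in the class. *)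
Lemma induced_cliques (A : sgraph) (P : pred A) n : 0 < n ->
  (forall x y, P x -> sedge x y -> P y) ->
  (forall x, P x -> #|[set y | (y == x) || sedge x y]| = n) ->
  (forall x y z, P x -> sedge x y -> sedge y z -> (x == z) || sedge x z) ->
  exists2 m, #|[set x | P x]| = (m * n)%N & induced P ~= m * 'K_n.
Proof.
move=> n0 Pc Pn Pt; pose cls (x : A) := [set y : A | (y == x) || sedge x y].
have clsP x y : P x -> y \in cls x -> cls y = cls x.
  move=> Px; rewrite inE => /orP[/eqP->//|xy]; have Py := Pc _ _ Px xy.
  apply/setP=> z; rewrite !inE; apply/orP/orP=> [[/eqP->|yz]|[/eqP->|xz]].
  - by right.
  - by have := Pt _ _ _ Px xy yz; rewrite eq_sym => /orP.
  - by right; rewrite sedge_sym.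
  by have := Pt y x z Py; rewrite sedge_sym => /(_ xy xz); rewrite eq_sym => /orP.
have clsx x : x \in cls x by rewrite inE eqxx.
have clsE x y : P x -> P y -> (cls x == cls y) = (y \in cls x).
  move=> Px Py; apply/eqP/idP=> [->//|/(clsP _ _ Px)//].
pose K := [set cls x | x in [set x | P x]].
have partK : partition K [set x | P x].
  apply/and3P; split.
  - rewrite eqEsubset; apply/andP; split.
      apply/bigcupsP=> U /imsetP[x]; rewrite inE => Px ->.
      apply/subsetP=> y; rewrite !inE => /predU1P[->//|]; exact: Pc.
    apply/subsetP=> x Px; apply/bigcupP; exists (cls x) => //; exact: imset_f.
  - apply/trivIsetP=> _ _ /imsetP[x + ->] /imsetP[y + ->]; rewrite !inE => Px Py.
    apply: contraR => /pred0Pn[z /andP[/= zx zy]].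
    by rewrite -(clsP _ _ Px zx) (clsP _ _ Py zy).
  by apply/imsetP=> -[x _ e]; have := clsx x; rewrite -e inE.
have cardP : #|[set x | P x]| = (#|K| * n)%N.
  by apply: (card_uniform_partition _ partK) => _ /imsetP[x + ->]; rewrite inE; apply: Pn.
exists #|K| => //.
have h1 (x : induced P) : index (cls (val x)) (enum K) < #|K|.
  by rewrite cardE index_mem mem_enum imset_f // inE (valP x).
have h2 (x : induced P) : index (val x) (enum (cls (val x))) < n.
  by rewrite -(Pn _ (valP x)) cardE index_mem mem_enum.
pose f (x : induced P) : (#|K| * 'K_n)%graph := (Ordinal (h1 x), Ordinal (h2 x)).
have f1 x y : ((f x).1 == (f y).1) = (val y \in cls (val x)).
  rewrite -clsE ?(valP x) ?(valP y) //; apply/eqP/eqP=> [/(congr1 val) /= e|e].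
    by apply: index_eq e; rewrite mem_enum imset_f // inE (valP x).
  by apply: val_inj; rewrite /= e.
have f2 x y : val y \in cls (val x) -> ((f x).2 == (f y).2) = (x == y).
  move=> xy; apply/eqP/eqP=> [/(congr1 val) /=|-> //]; rewrite (clsP _ _ (valP x) xy) => e.
  by apply/val_inj/(index_eq _ e); rewrite mem_enum.
have fI : injective f.
  move=> x y e; have xy : val y \in cls (val x) by rewrite -f1 e.
  by apply/eqP; rewrite -(f2 _ _ xy) e.
exists f.
  apply: (inj_card_bij fI); rewrite card_prod !card_ord.
  by rewrite -[X in _ <= X]/#|{: {x : A | P x}}| card_sig -cardP cardsE.
move=> x y; rewrite /= /gcopies_rel /= f1 /complete_rel.
case: (boolP (val y \in cls (val x))) => [xy|]; last first.
  by rewrite inE negb_or => /andP[_ /negbTE].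
rewrite f2 //=; move: xy; rewrite inE -val_eqE eq_sym /= /induced_rel.
by case: eqP => //= -> _; rewrite sedge_irr.
Qed.

Lemma induced_complete (A : sgraph) (P : pred A) :
  (forall x y, P x -> P y -> x != y -> sedge x y) ->
  induced P ~= 'K_(#|[set x | P x]|).
Proof.
move=> Pe; have h (x : induced P) : index (val x) (enum [set x | P x]) < #|[set x | P x]|.
  by rewrite cardE index_mem mem_enum inE (valP x).
pose f (x : induced P) : complete_graph #|[set x | P x]| := Ordinal (h x).
have fI : injective f.
  move=> x y /(congr1 val) /= e; apply/val_inj/(index_eq _ e).
  by rewrite mem_enum inE (valP x).
exists f.
  by apply: (inj_card_bij fI); rewrite card_ord -[X in _ <= X]/#|{: {x : A | P x}}| card_sig cardsE.
move=> x y; rewrite /= /complete_rel (inj_eq fI) /induced_rel.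
have [->|xy] := eqVneq x y; first by rewrite sedge_irr.
by rewrite Pe ?(valP x) ?(valP y).
Qed.

Lemma gdist_le (A : sgraph) (x y : A) n : walk n x y -> gdist x y <= n.
Proof.
move=> w; rewrite /gdist; have [lt|le] := ltnP n #|A|; last first.
  by apply: leq_trans le; rewrite -{2}(size_iota 0 #|A|) find_size.
rewrite leqNgt; apply/negP=> /(before_find 0); rewrite nth_iota // add0n.
by rewrite w.
Qed.

(** [gdist] returns [#|A|] when its search fails, which is why [n] has to stay below that. *)
Lemma gdist_gt (A : sgraph) (x y : A) n :
  n < #|A| -> (forall k, k <= n -> ~~ walk k x y) -> n < gdist x y.
Proof.
move=> nA nw; rewrite ltnNge; apply/negP=> le; have lt := leq_ltn_trans le nA.
have : has (fun n => walk n x y) (iota 0 #|A|) by rewrite has_find size_iota.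
move/(nth_find 0); rewrite -/(gdist x y) nth_iota // add0n.
by rewrite (negPf (nw _ le)).
Qed.

Lemma walk_connect (A : sgraph) (x y : A) n : walk n x y -> connect (@sedge A) x y.
Proof. by case/existsP=> p /andP[pth /eqP e]; apply/connectP; exists p. Qed.

Lemma walk1 (A : sgraph) (x y : A) : walk 0 x y = (x == y).
Proof.
apply/existsP/eqP=> [[p]|->]; first by rewrite (tuple0 p) /= => /eqP.
by exists [tuple]; rewrite /= eqxx.
Qed.

Lemma walkS (A : sgraph) (x y : A) n :
  walk n.+1 x y = [exists z, sedge x z && walk n z y].
Proof.
apply/existsP/existsP=> [[p]|[z /andP[xz /existsP[p /andP[pp lp]]]]].
  case/tupleP: p => z p /= /andP[/andP[xz pp] lp]; exists z; rewrite xz /=.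
  by apply/existsP; exists p; rewrite pp.
by exists [tuple of z :: p]; rewrite /= xz pp.
Qed.

Lemma giso_refl (A : sgraph) : A ~= A.
Proof. by exists id => //; exists id. Qed.

Section Walks.
Variable A : sgraph.
(** Allowing equality pads short walks to a prescribed length, and in a commuting graph it turns
    adjacency into membership of a centraliser. *)
Definition adj (x y : A) := (x == y) || sedge x y.

Lemma path_walk x p : path adj x p -> exists2 n, n <= size p & walk n x (last x p).
Proof.
elim: p x => [|y p IHp] x /=; first by exists 0; rewrite // walk1.
case/andP=> xy /IHp[n np w]; case/predU1P: xy => [->|xy]; first by exists n; rewrite // leqW.
by exists n.+1; rewrite // walkS; apply/existsP; exists y; rewrite xy.
Qed.

Lemma walk_path k n x y : k <= n -> walk k x y ->
  exists p, [/\ size p = n, path adj x p & last x p = y].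
Proof.
elim: n k x => [|n IHn] [|k] x //.
- by move=> _; rewrite walk1 => /eqP->; exists [::].
- rewrite walk1 => _ /eqP->; have [|p [sp pp lp]] := IHn 0 y isT; first by rewrite walk1.
  by exists (y :: p); rewrite /= sp pp lp /adj eqxx.
rewrite ltnS walkS => kn /existsP[z /andP[xz /(IHn _ _ kn)[p [sp pp lp]]]].
by exists (z :: p); rewrite /= sp pp lp /adj xz orbT.
Qed.

Lemma diam_le n : 0 < #|A| ->
  (forall x y, exists p, [/\ size p <= n, path adj x p & last x p = y]) ->
  gconnected A /\ gdiam A <= n.
Proof.
move=> A0 h; split.
  split=> // x y; have [p [_ pp <-]] := h x y.
  by have [k _ /walk_connect] := path_walk pp.
apply/bigmax_leqP => x _; apply/bigmax_leqP => y _.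
have [p [sp pp <-]] := h x y; have [k kp w] := path_walk pp.
exact: leq_trans (gdist_le w) (leq_trans kp sp).
Qed.

Lemma diam_gt n (x y : A) : n < #|A| ->
  (forall p, size p = n -> path adj x p -> last x p <> y) -> n < gdiam A.
Proof.
move=> nA h; apply: (@leq_trans (gdist x y)); last first.
  apply: leq_trans (leq_bigmax x); exact: (leq_bigmax y).
apply: gdist_gt => // k kn; apply/negP=> /(walk_path kn)[p [sp pp lp]].
exact: h sp pp lp.
Qed.
End Walks.

Lemma split2 (A B C : sgraph) (P Q : pred A) :
  (forall x, P x || Q x) -> (forall x, P x -> ~~ Q x) ->
  (forall x y, P x -> Q y -> ~~ sedge x y) ->
  induced P ~= B -> induced Q ~= C -> A ~= B + C.
Proof.
move=> PQ dPQ nE PB QC; have RE x : predT x = P x || Q x by rewrite PQ.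
apply: giso_trans (induced_full (fun x => isT)) _.
exact: giso_trans (induced_union RE dPQ nE) (giso_union PB QC).
Qed.

Lemma split3 (A B C D : sgraph) (P Q R : pred A) :
  (forall x, [|| P x, Q x | R x]) -> (forall x, P x -> ~~ Q x) ->
  (forall x, P x || Q x -> ~~ R x) ->
  (forall x y, P x -> Q y -> ~~ sedge x y) ->
  (forall x y, P x || Q x -> R y -> ~~ sedge x y) ->
  induced P ~= B -> induced Q ~= C -> induced R ~= D -> A ~= B + C + D.
Proof.
move=> PQR dPQ dR e1 e2 PB QC RD.
apply: (@split2 _ _ _ (fun x => P x || Q x) R) => //; first by move=> x; rewrite -orbA.
exact: giso_trans (induced_union (fun x => erefl) dPQ e1) (giso_union PB QC).
Qed.

(** * Commuting graphs *)

Section Commuting.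
Variables (gT : finGroupType) (G : {group gT}).
Local Notation Gamma := (commuting_graph G).
Local Notation Z := 'Z(G).

Lemma vertexP (x : Gamma) : val x \in G :\: Z. Proof. exact: valP x. Qed.

Lemma card_vertices (P : pred gT) :
  #|[set x : Gamma | P (val x)]| = #|[set x in G :\: Z | P x]|.
Proof.
rewrite -(card_imset _ val_inj); apply: eq_card => x; rewrite [RHS]inE.
apply/imsetP/andP=> [[y + ->]|[Gx Px]]; first by rewrite inE => Py; split; first exact: vertexP.
by exists (exist _ x Gx : Gamma); rewrite ?inE.
Qed.

Lemma card_commuting : (#|Gamma| + #|Z| = #|G|)%N.
Proof.
have := card_vertices predT; rewrite [LHS](_ : _ = #|Gamma|); last first.
  by rewrite -cardsT; apply: eq_card => x; rewrite !inE.
move->; rewrite (_ : [set x in _ | _] = G :\: Z); last by apply/setP=> x; rewrite inE andbT.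
by rewrite cardsDS ?center_sub // subnK // subset_leq_card // center_sub.
Qed.

Lemma adj_cent (x y : Gamma) : adj x y = (val y \in 'C_G[val x]).
Proof.
have /setDP[Gy _] := vertexP y; rewrite in_setI Gy /= cent1E /adj.
rewrite [sedge x y]/(commuting_rel x y) /commuting_rel.
by have [->|_] := eqVneq x y; rewrite ?eqxx // eq_sym.
Qed.

Lemma edge_cent (x y : Gamma) : sedge x y -> val y \in 'C_G[val x].
Proof. by rewrite -adj_cent /adj orbC => ->. Qed.

Definition cent_card c (x : Gamma) := #|'C_G[val x]| == c.

(** The closed neighbourhood of such an [x] is ['C_G[x]] without the centre, and its members share
    this centraliser. *)
Lemma comm_cliques c : #|Z| < c ->
  {in G :\: Z, forall x, #|'C_G[x]| = c -> {in 'C_G[x] :\: Z, forall y, 'C_G[y] = 'C_G[x]}} ->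
  exists2 m, #|[set x in G :\: Z | #|'C_G[x]| == c]| = (m * (c - #|Z|))%N
    & induced (cent_card c) ~= m * 'K_(c - #|Z|).
Proof.
move=> cZ h; have Pc x y : cent_card c x -> sedge x y -> 'C_G[val y] = 'C_G[val x].
  move=> /eqP cx /edge_cent xy; apply: h (vertexP x) cx _ _; rewrite in_setD xy andbT.
  by case/setDP: (vertexP y).
rewrite -(card_vertices (fun x => #|'C_G[x]| == c)).
apply: induced_cliques; first by rewrite subn_gt0.
- by move=> x y cx xy; rewrite /cent_card (Pc x y).
- move=> x /eqP cx; rewrite -cx -cardsDS; last first.
    by rewrite subsetI center_sub center_sub_cent1 //; case/setDP: (vertexP x).
  have e := card_vertices (fun y => y \in 'C_G[val x]).
  rewrite (_ : [set y | _] = [set y : Gamma | val y \in 'C_G[val x]]).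
    rewrite e; apply: eq_card => y; rewrite [LHS]inE !in_setD in_setI.
    by case: (y \in Z); case: (y \in G); rewrite ?andbF.
  by apply/setP=> y; rewrite [LHS]inE [RHS]inE -adj_cent /adj eq_sym.
move=> x y z cx xy yz; rewrite -[_ || _]/(adj x z) adj_cent -(Pc _ _ cx xy).
exact: edge_cent.
Qed.

(** Commuting is then transitive on noncentral elements, so the components of the commuting graph
    are complete. *)
Definition centralisers_agree := {in G :\: Z, forall x, {in 'C_G[x] :\: Z, forall y, 'C_G[y] = 'C_G[x]}}.

Lemma abelian_centralisers_agree :
  {in G :\: Z, forall x, abelian 'C_G[x]} -> centralisers_agree.
Proof.
move=> ab x Gx y /setDP[Cy Zy]; have [Gy cy] := setIP Cy.
have [Gx' Zx] := setDP Gx.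
apply/eqP; rewrite eqEsubset; apply/andP; split; rewrite subsetI subsetIl sub_cent1.
  have := ab y; rewrite in_setD Zy Gy => /(_ isT) /centsP aC.
  apply/centP=> z Cz; apply: aC => //; by rewrite in_setI Gx' cent1C.
by apply/centP=> z Cz; apply: (centsP (ab x Gx)).
Qed.

Hypothesis oZ : #|Z| = 2.

Lemma comm_graph2 c1 c2 m1 m2 : centralisers_agree -> 2 < c1 -> 2 < c2 -> c1 != c2 ->
  {in G :\: Z, forall x, (#|'C_G[x]| == c1) || (#|'C_G[x]| == c2)} ->
  #|[set x in G :\: Z | #|'C_G[x]| == c1]| = (m1 * (c1 - 2))%N ->
  #|[set x in G :\: Z | #|'C_G[x]| == c2]| = (m2 * (c2 - 2))%N ->
  Gamma ~= m1 * 'K_(c1 - 2) + m2 * 'K_(c2 - 2).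
Proof.
move=> agr c12 c22 nc cc e1 e2.
have part c m : 2 < c -> #|[set x in G :\: Z | #|'C_G[x]| == c]| = (m * (c - 2))%N ->
    induced (cent_card c) ~= m * 'K_(c - 2).
  move=> lc e; have [||m'] := @comm_cliques c; rewrite ?oZ //; first by move=> x Gx _; apply: agr.
  by rewrite e => /eqP; rewrite eqn_pmul2r ?subn_gt0 // => /eqP <-.
have ne x y c c' : c != c' -> cent_card c x -> cent_card c' y -> ~~ sedge x y.
  move=> cc' /eqP cx /eqP cy; apply/negP=> /edge_cent xy; case/eqP: cc'; rewrite -cx -cy.
  by rewrite (agr _ (vertexP x)) // in_setD xy andbT; case/setDP: (vertexP y).
apply: (split2 _ _ (fun x y => ne x y _ _ nc) (part _ _ c12 e1) (part _ _ c22 e2)).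
  by move=> x; apply: cc; apply: vertexP.
by move=> x /eqP cx; rewrite /cent_card cx.
Qed.

Lemma comm_graph3 c1 c2 c3 m1 m2 m3 : centralisers_agree ->
  2 < c1 -> 2 < c2 -> 2 < c3 -> c1 != c2 -> c1 != c3 -> c2 != c3 ->
  {in G :\: Z, forall x, [|| #|'C_G[x]| == c1, #|'C_G[x]| == c2 | #|'C_G[x]| == c3]} ->
  #|[set x in G :\: Z | #|'C_G[x]| == c1]| = (m1 * (c1 - 2))%N ->
  #|[set x in G :\: Z | #|'C_G[x]| == c2]| = (m2 * (c2 - 2))%N ->
  #|[set x in G :\: Z | #|'C_G[x]| == c3]| = (m3 * (c3 - 2))%N ->
  Gamma ~= m1 * 'K_(c1 - 2) + m2 * 'K_(c2 - 2) + m3 * 'K_(c3 - 2).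
Proof.
move=> agr c12 c22 c32 nc nc1 nc2 cc e1 e2 e3.
have part c m : 2 < c -> #|[set x in G :\: Z | #|'C_G[x]| == c]| = (m * (c - 2))%N ->
    induced (cent_card c) ~= m * 'K_(c - 2).
  move=> lc e; have [||m'] := @comm_cliques c; rewrite ?oZ //; first by move=> x Gx _; apply: agr.
  by rewrite e => /eqP; rewrite eqn_pmul2r ?subn_gt0 // => /eqP <-.
have ne x y c c' : c != c' -> cent_card c x -> cent_card c' y -> ~~ sedge x y.
  move=> cc' /eqP cx /eqP cy; apply/negP=> /edge_cent xy; case/eqP: cc'; rewrite -cx -cy.
  by rewrite (agr _ (vertexP x)) // in_setD xy andbT; case/setDP: (vertexP y).
apply: (split3 _ _ _ (fun x y => ne x y _ _ nc) _ (part _ _ c12 e1) (part _ _ c22 e2) (part _ _ c32 e3)).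
- by move=> x; apply: cc; apply: vertexP.
- by move=> x /eqP cx; rewrite /cent_card cx.
- by move=> x /orP[] /eqP cx; rewrite /cent_card cx.
by move=> x y /orP[] cx cy; [apply: ne nc1 _ _ | apply: ne nc2 _ _].
Qed.

Lemma comm_graph1 c m : centralisers_agree -> 2 < c ->
  {in G :\: Z, forall x, #|'C_G[x]| = c} -> (#|G| - 2 = m * (c - 2))%N ->
  Gamma ~= m * 'K_(c - 2).
Proof.
move=> agr c2 cc e.
have [||m'] := @comm_cliques c; rewrite ?oZ //; first by move=> x Gx _; apply: agr.
have -> : [set x in G :\: Z | #|'C_G[x]| == c] = G :\: Z.
  by apply/setP=> x; rewrite inE; case: (boolP (x \in _ :\: _)) => //= /cc->; rewrite eqxx.
rewrite cardsDS ?center_sub // oZ e => /eqP; rewrite eqn_pmul2r ?subn_gt0 // => /eqP<-.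
apply: giso_trans; apply: induced_full => x; apply/eqP/cc; exact: vertexP.
Qed.

(* Centralisers of order four: [x] and [y] in the same one generate it modulo the centre. *)
Lemma cent4_agree : {in G :\: Z, forall x, #|'C_G[x]| = 4 ->
  {in 'C_G[x] :\: Z, forall y, 'C_G[y] = 'C_G[x]}}.
Proof.
move=> x /setDP[Gx Zx] cx y /setDP[Cy Zy]; have cGx : cent4 G x by split.
have [Zy'|[z Zz ->]] := cent4_cosets cGx Cy; first by rewrite Zy' in Zy.
have /centerP[Gz cz] := Zz.
apply/setP=> u; rewrite !in_setI; case Gu: (u \in G) => //=; rewrite !cent1E.
rewrite -[x * z]cz // !mulgA -[u * z]cz // -mulgA -[RHS](inj_eq (mulgI z)).
by rewrite !mulgA.
Qed.

Lemma comm_graph_K2 :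
  exists2 m, #|[set x in G :\: Z | #|'C_G[x]| == 4]| = (m * 2)%N
    & Gamma ~= m * 'K_2 + induced (fun x : Gamma => ~~ cent_card 4 x).
Proof.
have [||m] := @comm_cliques 4; rewrite ?oZ //; first exact: cent4_agree.
move=> em im; exists m => //; apply: (split2 _ _ _ im (giso_refl _)).
- by move=> x; case: (cent_card 4 x).
- by move=> x ->.
move=> x y /eqP cx; apply: contra => /edge_cent xy; rewrite /cent_card.
rewrite (cent4_agree (vertexP x) cx) ?cx // in_setD xy andbT.
by case/setDP: (vertexP y).
Qed.
End Commuting.

Lemma card_coset_preim (gT : finGroupType) (G Z : {group gT}) (B : {set coset_of Z}) :
  Z <| G -> B \subset G / Z -> #|[set x in G | coset Z x \in B]| = (#|Z| * #|B|)%N.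
Proof.
case/andP=> sZG /subsetP nZG sB; rewrite -sum1_card.
rewrite (partition_big (coset Z) (mem B)) /=; last by move=> x; rewrite inE => /andP[].
rewrite -[#|B|]sum1_card big_distrr /=; apply: eq_bigr => b Bb; rewrite muln1.
have [y [Ny Gy eb]] := quotient_lift (subsetP sB _ Bb).
rewrite sum1_card -(card_rcoset Z y); apply: eq_card => x.
rewrite [LHS]unfold_in /= inE; apply/andP/rcosetP=> [[/andP[Gx _] /eqP ex]|[z Zz ->]].
  by apply/rcosetP/rcoset_kercosetP; rewrite ?nZG // ex.
have Gz := subsetP sZG _ Zz; rewrite groupM // (cosetM (nZG _ Gz) Ny) coset_id // mul1g -eb.
by rewrite Bb eqxx.
Qed.

Lemma cent1_central_mul (gT : finGroupType) (G : {group gT}) z x :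
  z \in 'Z(G) -> 'C_G[z * x] = 'C_G[x].
Proof.
case/centerP=> Gz cz; apply/setP=> u; rewrite !in_setI; case Gu: (u \in G) => //=.
by rewrite !cent1E mulgA -[u * z]cz // -!mulgA (inj_eq (mulgI z)).
Qed.

(** The centre of ['C_G[x]] contains ['Z(G)] and also [x], so in prime index it is everything. *)
Lemma cent1_prime_abelian (gT : finGroupType) (G : {group gT}) x :
  x \in G :\: 'Z(G) -> prime #|'C_G[x] : 'Z(G)| -> abelian 'C_G[x].
Proof.
case/setDP=> Gx Zx pr; have sZC : 'Z(G) \subset 'C_G[x].
  by rewrite subsetI center_sub center_sub_cent1.
have sZZ : 'Z(G) \subset 'Z('C_G[x]).
  rewrite subsetI sZC (subset_trans (subsetIr G _)) // centS // subsetIl //.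
have := Lagrange_index (center_sub 'C_G[x]) sZZ => e.
have : #|'C_G[x] : 'Z('C_G[x])| %| #|'C_G[x] : 'Z(G)| by rewrite -e dvdn_mulr.
rewrite -[abelian _]/(_ \subset _); case/primeP: pr => _ h /h /orP[|] /eqP i.
  by apply: subset_trans (_ : 'C_G[x] \subset 'Z('C_G[x])) (subsetIr _ _); rewrite -indexg_eq1 i.
move: e; rewrite i -[RHS]muln1 => /eqP; rewrite eqn_pmul2l ?indexg_gt0 //.
rewrite indexg_eq1 => /subsetP sZ; case/negP: Zx; apply: sZ.
apply/centerP; split; first by rewrite inE Gx cent1id.
by move=> y /setIP[_ /cent1P/commute_sym].
Qed.

Lemma card_split2 (T : finType) (A : {set T}) (f : T -> nat) c1 c2 :
  c1 != c2 -> {in A, forall x, (f x == c1) || (f x == c2)} ->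
  (#|[set x in A | f x == c1]| + #|[set x in A | f x == c2]| = #|A|)%N.
Proof.
move=> nc h; rewrite -(cardsID [set x | f x == c1] A); congr (_ + _)%N; apply: eq_card => x.
  by rewrite !inE.
rewrite !inE; case Ax: (x \in A); rewrite ?andbF // andbT; have := h x Ax.
by have [->|] := eqVneq (f x) c1; rewrite // (negPf nc).
Qed.

Lemma card_split3 (T : finType) (A : {set T}) (f : T -> nat) c1 c2 c3 :
  c1 != c2 -> c1 != c3 -> c2 != c3 ->
  {in A, forall x, [|| f x == c1, f x == c2 | f x == c3]} ->
  (#|[set x in A | f x == c1]| + #|[set x in A | f x == c2]| +
   #|[set x in A | f x == c3]| = #|A|)%N.
Proof.
move=> n12 n13 n23 h; rewrite -(cardsID [set x | f x == c1] A) -addnA.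
congr (_ + _)%N; first by apply: eq_card => x; rewrite !inE.
rewrite -(@card_split2 _ (A :\: [set x | f x == c1]) f c2 c3) //; last first.
  by move=> x; rewrite !inE => /andP[/negPf nf /h]; rewrite nf.
congr (_ + _)%N; apply: eq_card => x; rewrite !inE; case: (x \in A); rewrite ?andbF // !andbT.
  by have [->|] := eqVneq (f x) c2; rewrite ?andbF ?andbT // eq_sym n12.
by have [->|] := eqVneq (f x) c3; rewrite ?andbF ?andbT // eq_sym n13.
Qed.

(** * Commuting graphs of SL(2,3) and SL(2,5) *)

Section SylowQuaternionGraph.
Variables (gT : finGroupType) (G T : {group gT}) (v : gT).
Hypotheses (cGv : cent4 G v) (sylT : 2.-Sylow(G) T) (qT : quat8 'Z(G)%G T).
Hypothesis cT : 'C_(G / 'Z(G))[coset 'Z(G) v] = T / 'Z(G).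
Hypothesis fT : {in T :\: 'Z(G), forall x,
  coset 'Z(G) x \in coset 'Z(G) v ^: 'N_(G / 'Z(G))(T / 'Z(G))}.
Let Z := 'Z(G)%G.
Let X := (G / Z)%G.
Let V := (T / Z)%G.
Let vb := coset Z v.
Let I := invols X vb.
Let nZ : Z <| G. Proof. exact: center_normal. Qed.
Let nZG : {subset G <= 'N(Z)}. Proof. exact/subsetP/normal_norm. Qed.
Let oZ : #|Z| = 2. Proof. by case: cGv. Qed.
Let Gv : v \in G. Proof. by case: cGv. Qed.
Let sTG : T \subset G. Proof. exact: pHall_sub sylT. Qed.
Let oV : #|V| = 4.
Proof.
rewrite card_quotient ?(subset_trans sTG) ?normal_norm // -divgS /= ?oZ; by case: qT => // _ ->.
Qed.
Let sylV : 2.-Sylow(X) V.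
Proof. by apply: quotient_pHall => //; rewrite (subset_trans sTG) ?normal_norm. Qed.
Let fV := fusedV fT.

Lemma quot_nt x : x \in G :\: Z -> coset Z x \in X /\ coset Z x != 1.
Proof.
case/setDP=> Gx Zx; rewrite mem_quotient //; split=> //.
by apply: contra Zx => /eqP/coset_idr; apply; apply: nZG.
Qed.

Lemma cent_invol x : x \in G :\: Z -> coset Z x \in I -> #|'C_G[x]| = 4.
Proof.
case/setDP=> Gx Zx /(coset_classP nZ Gx Gv)[g [z [Gg Zz ->]]].
rewrite (cent1_central_mul _ Zz); have [_ _ _ <-] := cGv.
by apply: card_cent1_class; rewrite memJ_class.
Qed.

(** ['C_G[x] / Z] contains the nontrivial image of [x] and lies in a group of prime order. *)
Lemma cent_prime x p : x \in G :\: Z -> prime p -> #|'C_X[coset Z x]| = p ->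
  #|'C_G[x]| = (2 * p)%N.
Proof.
move=> Gx pr oC; have [Xx x1] := quot_nt Gx; have [Gx' Zx] := setDP Gx.
have sZC : Z \subset 'C_G[x] by rewrite subsetI center_sub center_sub_cent1.
have sCN : 'C_G[x] \subset 'N(Z) by rewrite (subset_trans (subsetIl _ _)) ?normal_norm.
have sub : 'C_G[x] / Z \subset 'C_X[coset Z x].
  rewrite subsetI quotientS ?subsetIl //=.
  apply/subsetP=> _ /quotient_lift[u [Nu /setIP[Gu /cent1P cu] ->]].
  by rewrite cent1E -!cosetM ?nZG // cu.
have := cardSg sub; rewrite oC => d.
case/primeP: pr => _ h; case/orP: (h _ d) => /eqP e; last first.
  by rewrite -(Lagrange sZC) oZ -card_quotient // e.
have : coset Z x \in 'C_G[x] / Z by rewrite mem_quotient // inE Gx' cent1id.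
by rewrite (card1_trivg e) inE (negPf x1).
Qed.

Lemma cent_noninvol_card x : x \in G :\: Z -> coset Z x \notin I ->
  if #[coset Z x] == 3 then #|'C_G[x]| = 6 else #|'C_G[x]| = 10 /\ #|X| = 60.
Proof.
move=> Gx nI; have [Xx x1] := quot_nt Gx.
have [[-> /(cent_prime Gx (isT : prime 3)) ->]|[oX c5 /eqP/negPf->]] // :=
  cent_noninvol sylV oV cT fV Xx x1 nI.
by rewrite (cent_prime Gx (isT : prime 5) c5).
Qed.

Lemma sylow_quat_abelian : {in G :\: Z, forall x, abelian 'C_G[x]}.
Proof.
move=> x Gx; apply: cent1_prime_abelian => //.
have sZC : Z \subset 'C_G[x] by rewrite subsetI center_sub center_sub_cent1 //; case/setDP: Gx.
rewrite -divgS // oZ; have [Ix|nI] := boolP (coset Z x \in I); first by rewrite (cent_invol Gx Ix).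
by have := cent_noninvol_card Gx nI; case: eqP => [_ ->|_ [-> _]].
Qed.

Lemma sylow_quat_case x : x \in G :\: Z ->
  [/\ (#|'C_G[x]| == 4) = (coset Z x \in I), (#|'C_G[x]| == 6) = (#[coset Z x] == 3)
   & [|| #|'C_G[x]| == 4, #|'C_G[x]| == 6 | (#|'C_G[x]| == 10) && (#|X| == 60)]].
Proof.
move=> Gx; have [Ix|nI] := boolP (coset Z x \in I).
  rewrite (cent_invol Gx Ix); split=> //; symmetry; apply/negbTE.
  have [Xx _] := quot_nt Gx; have := Ix; rewrite (involP sylV oV cT fV Xx) => /andP[/eqP x2 x1].
  by rewrite (nt_prime_order (isT : prime 2) x2 x1).
by have := cent_noninvol_card Gx nI; case: eqP => [_ ->|_ [-> ->]].
Qed.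

Lemma card_cent_pred c (P : pred (coset_of Z)) : ~~ P 1 ->
  (forall x, x \in G :\: Z -> (#|'C_G[x]| == c) = P (coset Z x)) ->
  #|[set x in G :\: Z | #|'C_G[x]| == c]| = (2 * #|[set y in X | P y]|)%N.
Proof.
move=> P1 h; have sP : [set y in X | P y] \subset X.
  by apply/subsetP=> y; rewrite inE => /andP[].
rewrite -[X in (X * _)%N]oZ -(card_coset_preim nZ sP).
apply: eq_card => x; rewrite [LHS]inE [RHS]inE in_setD [coset Z x \in _]inE.
have [Zx|Zx] := boolP (x \in Z).
  by symmetry; rewrite (coset_id Zx) (negPf P1) !andbF.
case Gx: (x \in G) => //=; rewrite mem_quotient //=; by rewrite h // in_setD Zx.
Qed.

Lemma card_cent4 : #|[set x in G :\: Z | #|'C_G[x]| == 4]| = (2 * #|I|)%N.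
Proof.
rewrite (@card_cent_pred _ (mem I)); first last.
- by move=> x Gx; case: (sylow_quat_case Gx).
- by rewrite inE (involP sylV oV cT fV (group1 _)) eqxx andbF.
congr (2 * _)%N; apply: eq_card => y; rewrite inE andb_idl // => Iy.
by apply: subsetP Iy; apply: class_subG; rewrite // mem_quotient.
Qed.

Lemma card_cent6 : #|[set x in G :\: Z | #|'C_G[x]| == 6]|
  = (2 * #|[set y in X | #[y] == 3]|)%N.
Proof.
apply: card_cent_pred; first by rewrite order1.
by move=> x Gx; case: (sylow_quat_case Gx).
Qed.

Lemma SL23_graph : #|G| = 24 -> commuting_graph G ~= 3 * 'K_2 + 4 * 'K_4.
Proof.
move=> oG; have [[_ eX]|[]] := sylow_quat_card cGv sylT qT cT fT; last by rewrite oG.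
have c4 : #|[set x in G :\: Z | #|'C_G[x]| == 4]| = (3 * (4 - 2))%N.
  by rewrite card_cent4 (card_invols12 sylV oV cT fV eX).
have cs x : x \in G :\: Z -> (#|'C_G[x]| == 4) || (#|'C_G[x]| == 6).
  move=> Gx; have [_ _] := sylow_quat_case Gx; case/or3P=> [->|->|/andP[_]] //; first by rewrite orbT.
  by rewrite card_quotient ?normal_norm // -divgS ?center_sub // oZ oG.
apply: (comm_graph2 oZ _ _ _ _ cs c4) => //; first exact/abelian_centralisers_agree/sylow_quat_abelian.
have := @card_split2 _ _ (fun x => #|'C_G[x]|) 4 6 isT cs.
by rewrite c4 cardsDS ?center_sub // oG oZ => -[].
Qed.

Lemma SL25_graph : #|G| = 120 -> commuting_graph G ~= 15 * 'K_2 + 10 * 'K_4 + 6 * 'K_8.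
Proof.
move=> oG; have [[]|[_ oX]] := sylow_quat_card cGv sylT qT cT fT; first by rewrite oG.
have c4 : #|[set x in G :\: Z | #|'C_G[x]| == 4]| = (15 * (4 - 2))%N.
  by rewrite card_cent4 (card_invols60 sylV oV cT fV oX).
(* The elements of order three in [X] form one class of size 20 and lift to 40 vertices, ten cliques
   of four. The remaining [118 - 30 - 40 = 48] vertices give six cliques of eight. *)
have c6 : #|[set x in G :\: Z | #|'C_G[x]| == 6]| = (10 * (6 - 2))%N.
  rewrite card_cent6; have [d [i [Hd od Ii nHi di]]] := sixty_di sylV oV cT fV oX.
  have Xd : d \in X by case/setIP: Hd.
  have Xi : i \in X by apply: subsetP Ii; apply: class_subG; rewrite // mem_quotient.
  suff -> : [set y in X | #[y] == 3] = d ^: X by rewrite (card_class3 sylV oV cT fV oX).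
  apply/setP=> y; rewrite inE; apply/andP/idP=> [[Xy /eqP oy]|/imsetP[g Xg ->]].
    exact: (order_three_class sylV oV cT fV Xd od Xi di Xy oy).
  by rewrite groupJ // orderJ od.
have cs x : x \in G :\: Z -> [|| #|'C_G[x]| == 4, #|'C_G[x]| == 6 | #|'C_G[x]| == 10].
  by move=> Gx; have [_ _] := sylow_quat_case Gx; rewrite oX eqxx andbT.
apply: (comm_graph3 oZ _ _ _ _ _ _ _ cs c4 c6) => //; first exact/abelian_centralisers_agree/sylow_quat_abelian.
have := @card_split3 _ _ (fun x => #|'C_G[x]|) 4 6 10 isT isT isT cs.
by rewrite c4 c6 cardsDS ?center_sub // oG oZ => -[].
Qed.
End SylowQuaternionGraph.

(** * Commuting graphs of the groups of order 48 *)

Section FortyEightGraph.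
Variables (gT : finGroupType) (G Q : {group gT}) (v : gT).
Hypotheses (cGv : cent4 G v) (nQG : Q <| G) (qQ : quat8 'Z(G)%G Q) (vQ : v \notin Q).
Hypothesis fus : {in Q :\: 'Z(G) &, forall x y,
  coset 'Z(G) x \in coset 'Z(G) y ^: (G / 'Z(G))}.
Hypothesis oG : #|G| = 48.
Let Z := 'Z(G)%G.
Let X := (G / Z)%G.
Let E := (Q / Z)%G.
Let S := (G / Q)%G.
Let nZ : Z <| G. Proof. exact: center_normal. Qed.
Let nZG : {subset G <= 'N(Z)}. Proof. exact/subsetP/normal_norm. Qed.
Let nQ : {subset G <= 'N(Q)}. Proof. exact/subsetP/normal_norm. Qed.
Let sQG : {subset Q <= G}. Proof. exact/subsetP/normal_sub. Qed.
Let sZQ : {subset Z <= Q}. Proof. by case: qQ => /subsetP. Qed.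
Let oZ : #|Z| = 2. Proof. by case: cGv. Qed.
Let oQ : #|Q| = 8. Proof. by case: qQ. Qed.
Let Gv : v \in G. Proof. by case: cGv. Qed.
Let oX : #|X| = 24.
Proof. by rewrite card_quotient ?normal_norm // -divgS ?center_sub //= oZ oG. Qed.
Let oS : #|S| = 6.
Proof. by rewrite card_quotient ?normal_norm // -divgS ?normal_sub //= oQ oG. Qed.
Let oCX x : x \in Q :\: Z -> #|'C_X[coset Z x]| = 8.
Proof.
move=> Qx; have Ex := quatE_coset nQG Qx.
have := Lagrange (subsetIl X 'C[coset Z x]).
rewrite index_cent1 (quatE_class nQG fus Ex) (quatE_card1 cGv nQG qQ) oX => /eqP.
by rewrite -[24]/(8 * 3)%N eqn_pmul2r // => /eqP.
Qed.

(** The stabiliser of a coset in [X] has order eight and [G / Q] has order six, so the image of [x]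
    has order dividing [gcdn 8 6]. *)
Lemma fixes_quat_sqr x y : x \in G -> y \in Q :\: Z ->
  commute (coset Z x) (coset Z y) -> coset Q x ^+ 2 = 1.
Proof.
move=> Gx Qy cxy; have Xx : coset Z x \in X by apply: mem_quotient.
have Cx : coset Z x \in 'C_X[coset Z y] by rewrite in_setI Xx; apply/cent1P/commute_sym.
have x8 : coset Q x ^+ 8 = 1.
  have : coset Z (x ^+ 8) = 1.
    by rewrite cosetX ?nZG //; apply/eqP; rewrite -order_dvdn -(oCX Qy) order_dvdG.
  move/(coset_idr (nZG (groupX 8 Gx)))/sZQ => Qx8.
  by rewrite -cosetX ?nQ // coset_id.
have x6 : coset Q x ^+ 6 = 1 by apply/eqP; rewrite -order_dvdn -oS order_dvdG // mem_quotient.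
apply/eqP; rewrite -order_dvdn -[2]/(gcdn 8 6) dvdn_gcd !order_dvdn x8 x6 eqxx //.
Qed.

(** This describes [G / Q] as the symmetric group on three letters: the rotations are the powers of
    [D], and the reflections are the conjugates of the image of [v] by rotations. *)
Lemma three_vert : exists D, [/\ D \in S, #[D] = 3, D ^ coset Q v = D^-1,
  coset Q v ^+ 2 = 1 & forall s, s \in S -> s \in <[D]> \/ exists2 k, s = coset Q v ^ (D ^+ k) & true].
Proof.
have [||d Gd od] := @Cauchy _ 3 G; rewrite ?oG //.
have dd := quat_three_prod cGv nQG qQ vQ fus oG Gd od.
have V2 : coset Q v ^+ 2 = 1.
  by rewrite -cosetX ?nQ //; apply/coset_id/sZQ/cent4_sqr.
have oD : #[coset Q d] = 3.
  apply: nt_prime_order => //; first by rewrite -cosetX ?nQ // -od expg_order coset_id.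
  apply/eqP=> /(coset_idr (nQ Gd))/order_dvdG; by rewrite od oQ.
have DV : coset Q d ^ coset Q v = (coset Q d)^-1.
  apply/eqP; rewrite eq_sym eq_invg_mul -cosetJ ?nQ // -cosetM ?nQ ?groupJ //.
  by rewrite coset_id.
have SD : coset Q d \in S by apply: mem_quotient.
have SV : coset Q v \in S by apply: mem_quotient.
exists (coset Q d); split=> // s Ss.
move: (coset Q d) (coset Q v) oD DV V2 SD SV => D V oD DV V2 SD SV.
have [|sD] := boolP (s \in <[D]>); [by left | right].
have VD : V \notin <[D]>.
  apply/negP=> /order_dvdG; rewrite -orderE oD => V3.
  have V1 : V = 1.
    apply/eqP; rewrite -order_eq1 -dvdn1 -[1%N]/(gcdn 3 2) dvdn_gcd V3 order_dvdn V2 eqxx //.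
  move: DV; rewrite V1 conjg1 => /eqP; rewrite eq_sym eq_invg_mul -expg2 -order_dvdn oD //.
have iD : #|S : <[D]>| = 2 by rewrite -divgS ?cycle_subG // oS -orderE oD.
have : V * s^-1 \in <[D]>.
  have := index2_lcoset (K := S) (H := <[D]>%G) (x := V^-1) (y := s^-1).
  rewrite invgK cycle_subG iD => /(_ SD erefl); apply; rewrite in_setD groupV ?VD ?sD ?groupV //.
(* Here [s = F^-1 * V] with [F = D ^+ k]. As [V] inverts [F], conjugating [V] by [F ^+ 2] multiplies
   it on the left by the inverse of [F ^+ 4], which is [F^-1]; hence the factor two. *)
case/cycleP=> k e; exists (k * 2)%N => //; rewrite expgM.
have DkV : (D ^+ k) ^ V = (D ^+ k)^-1 by rewrite conjXg DV expgVn.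
have -> : s = (D ^+ k)^-1 * V by rewrite -e invMg invgK mulgKV.
have Dk3 : (D ^+ k) ^+ 3 = 1 by rewrite -expgM mulnC expgM -oD expg_order expg1n.
move: (D ^+ k) DkV Dk3 => F FV F3.
have VF : V * F = F^-1 * V by move: (conjgC F V); rewrite FV => e'; apply: (mulgI F); rewrite mulKVg mulgA e' mulgKV.
rewrite conjgE expg2 (mulgA V) VF -(mulgA F^-1 V F) VF !mulgA.
have FF : F * F = F^-1 by apply/eqP; rewrite eq_sym eq_invg_mul -expg2 -expgS F3.
by rewrite FF invgK mulgV mul1g.
Qed.

Lemma quat_noncomm q : q \in Q :\: Z -> exists2 r, r \in Q & q ^ r != q.
Proof.
move=> Qq; have [Eq q1] := setD1P (quatE_coset nQG Qq).
have : ~~ (E \subset [set 1; coset Z q]).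
  apply/negP=> /subset_leq_card; rewrite (quatE_card cGv nQG qQ) cards2.
  by case: (_ != _).
case/subsetPn=> y Ey; rewrite !inE negb_or => /andP[y1 yq].
have [|r Qr er] := @quatE_lift _ G Q y; first by rewrite !inE y1.
have [Qr' Zr] := setDP Qr; have [Qq' Zq] := setDP Qq.
exists r => //.
have Qqr : q * r \in Q :\: Z.
  rewrite in_setD (groupM Qq' Qr') andbT; apply: contra yq => Zqr.
  have : coset Z q * coset Z r = 1 by rewrite -cosetM ?nZG ?sQG // coset_id.
  move/eqP; rewrite -eq_invg_mul er => /eqP<-; rewrite eq_invg_mul -expg2.
  exact/eqP/(quatE_sqr nQG qQ).
have [t [t1 t2 Zt]] := center2_gen cGv; have [_ _ sq] := qQ.
have e : (q * r) ^+ 2 = r ^+ 2.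
  have [n1 /Zt[e1|->]] := sq _ Qqr; first by rewrite e1 eqxx in n1.
  by have [n2 /Zt[e2|-> //]] := sq _ Qr; rewrite e2 eqxx in n2.
have [q2 _] := sq q Qq; apply: contra q2 => /eqP qr.
by rewrite expg2 -eq_invg_mul -(expg2_conj_inv e) qr.
Qed.

(** The preimage [P] of the stabiliser of [q] modulo [Z] has order 16 and moves [q] inside a coset
    of [Z], and [Q] does move it; so ['C_G[q]] has order eight. Its quotient by the central [<[q]>],
    of order four, is cyclic. *)
Lemma cent_quat q : q \in Q :\: Z -> #|'C_G[q]| = 8 /\ abelian 'C_G[q].
Proof.
move=> Qq; have [Qq' Zq] := setDP Qq; have Gq := sQG Qq'.
pose P := (coset Z @*^-1 'C_X[coset Z q])%G.
have oP : #|P| = 16 by rewrite card_cosetpre oCX // oZ.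
have PP g : g \in G -> (g \in P) = (coset Z g \in 'C[coset Z q]).
  move=> Gg; apply/idP/idP=> [/morphpreP[_ /setIP[]] //|cg].
  by apply/morphpreP; split; [exact: nZG | rewrite in_setI mem_quotient].
have sCP : 'C_G[q] \subset P.
  apply/subsetP=> g /setIP[Gg /cent1P cg]; rewrite PP // cent1E -!cosetM ?nZG // cg.
  exact: eqxx.
have sPG : P \subset G by rewrite -(quotientGK nZ) morphpreS // subsetIl.
have sQP : Q \subset P.
  apply/subsetP=> g Qg; rewrite PP ?sQG // cent1E; apply/eqP/(centsP (quatE_abelian nQG qQ));
    by rewrite mem_quotient.
have [r Qr nr] := quat_noncomm Qq.
have ltP : #|'C_G[q]| < 16.
  rewrite -oP proper_card // properE sCP; apply/negP=> /subsetP/(_ r (subsetP sQP r Qr)).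
  case/setIP=> _ /cent1P cr; case/eqP: nr; apply/conjg_fixP/commgP.
  exact: commute_sym.
have ge8 : 8 <= #|'C_G[q]|.
  have : #|q ^: P| <= 2.
    rewrite -oZ -(card_rcoset Z q) subset_leq_card //; apply/subsetP=> _ /imsetP[g Pg ->].
    have Gg := subsetP sPG _ Pg; apply/rcoset_kercosetP; rewrite ?nZG ?groupJ //.
    move: Pg; rewrite PP // cent1E => /eqP c; rewrite cosetJ ?nZG // conjgE -c mulKg //.
  rewrite -index_cent1 => i2; have eC : 'C_P[q] = 'C_G[q].
    by apply/eqP; rewrite eqEsubset setSI //= subsetI sCP subsetIr.
  have := Lagrange sCP; rewrite oP; rewrite eC in i2.
  move: (indexg_gt0 P 'C_G[q]) i2; case: #|P : _| => [|[|[|]]] // _ _; first by rewrite muln1 => ->.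
  by move=> e; rewrite -(leq_pmul2r (isT : 0 < 2)) e.
have C8 : #|'C_G[q]| = 8.
  have := cardSg sCP; rewrite oP.
  case/dvdnP=> k e; move: ltP ge8 e; case: #|_| => // c; case: k => [|[|[|k]]] //.
  - by rewrite mul1n => ltP _ e; rewrite -e in ltP.
  - by move=> _ _ /eqP; rewrite -[16]/(2 * 8)%N eqn_pmul2l // => /eqP<-.
  move=> _ ge8 e; have : 3 * c.+1 <= 16 by rewrite e leq_pmul2r.
  by move=> h; have := leq_trans (leq_mul (leqnn 3) ge8) h.
split=> //; have [q2 Zq2] : q ^+ 2 != 1 /\ q ^+ 2 \in Z by case: qQ => _ _; apply.
have Cq : q \in 'C_G[q] by rewrite inE Gq cent1id.
have sZ : <[q]> \subset 'Z('C_G[q]).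
  rewrite cycle_subG; apply/centerP; split=> // y /setIP[_ /cent1P]; exact: commute_sym.
apply: (cyclic_factor_abelian sZ); apply: prime_cyclic.
rewrite card_quotient; last first.
  by rewrite cents_norm // centsC (subset_trans sZ) // subsetIr.
have oq : #[q] = 4.
  have q4 : #[q] %| 4.
    rewrite order_dvdn -[4%N]/(2 * 2)%N expgM; by rewrite (center_expn2 cGv Zq2).
  by case/dvdn4: q4 => // e; case/negP: q2; rewrite -order_dvdn e.
by rewrite -divgS ?cycle_subG // C8 -orderE oq.
Qed.

(** An element of order three modulo [Q] commutes with nothing in [Q] outside [Z], and its image
    generates its own centraliser in the symmetric group [S]; so its centraliser has [Z] as a
    subgroup of index three. *)
Lemma cent_three x D : D \in S -> #[D] = 3 -> D ^ coset Q v = D^-1 ->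
  x \in G -> coset Q x \in <[D]> -> coset Q x != 1 ->
  #|'C_G[x]| = 6 /\ abelian 'C_G[x].
Proof.
move=> SD oD DV Gx Dx x1; have Sx : coset Q x \in S by apply: mem_quotient.
have ox : #[coset Q x] = 3.
  have := order_dvdG Dx; rewrite -orderE oD => /(prime_nt_dvdP (isT : prime 3)) <- //.
  by rewrite order_eq1.
have nfix y : y \in Q :\: Z -> x ^ y != x.
  move=> Qy; apply/negP=> /eqP/conjg_fixP/commgP cxy.
  have cb : commute (coset Z x) (coset Z y).
    have Gy : y \in G by case/setDP: Qy => /sQG.
    by rewrite /commute -!cosetM ?nZG // cxy.
  have := fixes_quat_sqr Gx Qy cb; move/eqP; rewrite -order_dvdn ox //.
have Zx : x \notin Z.
  by apply: contra x1 => Zx; apply/eqP/coset_id/sZQ.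
have sZC : Z \subset 'C_G[x] by rewrite subsetI center_sub center_sub_cent1.
have CQ : 'C_G[x] :&: Q = Z.
  apply/eqP; rewrite eqEsubset subsetI sZC andbC; apply/andP; split; first by apply/subsetP.
  apply/subsetP=> y /setIP[/setIP[Gy /cent1P cy] Qy]; apply/negPn/negP=> Zy.
  have := nfix y; rewrite in_setD Zy Qy => /(_ isT)/eqP[].
  by apply/conjg_fixP/commgP/commute_sym.
have CS : #|'C_G[x] / Q| %| 3.
  have sub : 'C_G[x] / Q \subset 'C_S[coset Q x].
    rewrite subsetI quotientS ?subsetIl //=; apply/subsetP=> _ /quotient_lift[u [Nu /setIP[Gu /cent1P cu] ->]].
    by rewrite cent1E -!cosetM ?nQ // cu.
  have Cx : coset Q x \in 'C_S[coset Q x] by rewrite inE Sx cent1id.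
  apply: dvdn_trans (cardSg sub) _.
  have d6 : #|'C_S[coset Q x]| %| 6 by rewrite -oS cardSg // subsetIl.
  have d3 : 3 %| #|'C_S[coset Q x]| by rewrite -ox order_dvdG.
  have n6 : #|'C_S[coset Q x]| != 6.
    apply/eqP=> e6; have : coset Q v \in 'C_S[coset Q x].
      have /eqP-> : 'C_S[coset Q x] == S by rewrite eqEcard subsetIl e6 oS.
      exact: mem_quotient.
    case/setIP=> _ /cent1P cv; case/cycleP: Dx => k ek.
    have : coset Q x ^ coset Q v = (coset Q x)^-1 by rewrite ek conjXg DV expgVn.
    rewrite conjgE -cv mulKg => /eqP; rewrite eq_sym eq_invg_mul -expg2 -order_dvdn ox //.
  by case/dvdnP: d3 n6 d6 => k ->; case: k => [|[|[|k]]].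
have i3 : #|'C_G[x] : Z| %| 3.
  move: CS; rewrite card_quotient; last by rewrite subIset // normal_norm.
  by rewrite -indexgI CQ.
have ne : #|'C_G[x] : Z| != 1%N.
  rewrite indexg_eq1; apply: contra Zx => /subsetP; apply; by rewrite inE Gx cent1id.
have e3 : #|'C_G[x] : Z| = 3 by have /(prime_nt_dvdP (isT : prime 3)) := i3; apply.
split; first by rewrite -(Lagrange sZC) oZ e3.
by apply: cent1_prime_abelian; rewrite ?in_setD ?Zx // e3.
Qed.
(** [v] fixes some [q0] modulo [Z]. In the preimage [P] of the stabiliser of [q0], of order 16, the
    eight elements outside [Q] are four conjugates of [v] and four elements of the abelian group [B
    = 'C_G[q0]]. An [x] of the second kind has centraliser [B]. *)
Lemma cent_coset_v x : x \in Q :* v ->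
  x \in v ^: G \/ #|'C_G[x]| = 8 /\ abelian 'C_G[x].
Proof.
move=> Qvx; have nC := quatE_nocent cGv nQG qQ vQ.
have sEX : E \subset X by rewrite quotientS // normal_sub.
have nEX : X \subset 'N(E) by apply: quotient_norms (normal_norm nQG).
have Xv : coset Z v \in X by apply: mem_quotient.
(* The product of an element of [E] moved by [v] and its image is fixed by [v], and it is not
   trivial since [E] has exponent two. *)
have [q0 Qq0 fq0] : exists2 q, q \in Q :\: Z & coset Z q ^ coset Z v = coset Z q.
  have [e Ee nfe] : exists2 e, e \in E & e ^ coset Z v != e.
    apply/exists_inP; apply: contraR nC => /exists_inPn h; apply/centP=> e Ee.
    by apply/commute_sym/commgP/conjg_fixP/eqP; move: (h e Ee); rewrite negbK.
  have Eev : e ^ coset Z v \in E by rewrite memJ_norm // (subsetP nEX).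
  have [|q Qq eq] := @quatE_lift _ G Q (e * e ^ coset Z v).
    rewrite !inE groupM // andbT; apply: contra nfe; rewrite -eq_invg_mul => /eqP<-.
    by rewrite eq_invg_mul -expg2 (quatE_sqr nQG qQ).
  exists q => //; rewrite -eq conjMg -conjgM -expg2 -cosetX ?nZG //.
  rewrite (coset_id (cent4_sqr cGv)) conjg1; exact: (centsP (quatE_abelian nQG qQ)).
have [Qq0' Zq0] := setDP Qq0; have Gq0 := sQG Qq0'.
pose P := (coset Z @*^-1 'C_X[coset Z q0])%G.
have oP : #|P| = 16 by rewrite card_cosetpre oCX // oZ.
have PP g : g \in G -> (g \in P) = (coset Z g \in 'C[coset Z q0]).
  move=> Gg; apply/idP/idP=> [/morphpreP[_ /setIP[]] //|cg].
  by apply/morphpreP; split; [exact: nZG | rewrite in_setI mem_quotient].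
have sPG : P \subset G by rewrite -(quotientGK nZ) morphpreS // subsetIl.
have sQP : Q \subset P.
  apply/subsetP=> g Qg; rewrite PP ?sQG // cent1E; apply/eqP/(centsP (quatE_abelian nQG qQ));
    by rewrite mem_quotient.
have Pv : v \in P by rewrite PP //; apply/cent1P/commute_sym/commgP/conjg_fixP.
have [q qQ' ex] := rcosetP Qvx; have Px : x \in P by rewrite ex groupM // (subsetP sQP).
have Gx := subsetP sPG _ Px.
have xQ : x \notin Q by rewrite ex groupMl.
have Zx : x \notin Z by apply: contra xQ => /sZQ.
have [C8 aB] := cent_quat Qq0; pose B := 'C_G[q0]%G.
have sBP : B \subset P.
  apply/subsetP=> g /setIP[Gg /cent1P cg]; rewrite PP // cent1E -!cosetM ?nZG // cg.
  exact: eqxx.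
have iPB : #|P : B| = 2 by rewrite -divgS // oP C8.
have nBP : B <| P by apply: index2_normal.
have nQP : Q <| P by apply: normalS nQG.
have oCv : #|'C_G[v]| = 4 by case: cGv.
have vB : v \notin B.
  apply/negP=> Bv; have : B \subset 'C_G[v].
    by rewrite subsetI subsetIl sub_cent1; apply/centP=> y By; apply: (centsP aB).
  by move/subset_leq_card; rewrite oCv C8.
have oBQ : 4 <= #|B :\: Q|.
  have [r Qr nr] := quat_noncomm Qq0.
  have pBQ : B :&: Q \proper Q.
    rewrite properE subsetIr; apply/negP=> /subsetP/(_ r Qr)/setIP[/setIP[_ /cent1P cr] _].
    case/eqP: nr; apply/conjg_fixP/commgP; exact: commute_sym.
  have d8 : #|B :&: Q| %| 8 by rewrite -oQ cardSg // subsetIr.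
  have : #|B :&: Q| <= 4.
    by move: (proper_card pBQ) d8; rewrite oQ; case: #|_| => [|[|[|[|[|[|[|[|]]]]]]]].
  by rewrite cardsD C8 => h; rewrite -[4]/(8 - 4)%N leq_sub2l.
have ov : 4 <= #|v ^: P|.
  rewrite -index_cent1 -(leq_pmul2r (isT : 0 < 4)).
  apply: leq_trans (_ : #|P : 'C_P[v]| * #|'C_P[v]| <= _); last first.
    by rewrite leq_mul2l -oCv subset_leq_card ?orbT // setSI.
  by rewrite mulnC Lagrange ?subsetIl // oP.
have sv : v ^: P \subset P :\: Q.
  apply/subsetP=> _ /imsetP[g Pg ->]; rewrite in_setD (groupJ Pv Pg) andbT.
  by rewrite memJ_norm // nQ // (subsetP sPG).
have sBQ : B :\: Q \subset P :\: Q by apply: setSD.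
have dj : [disjoint v ^: P & B :\: Q].
  apply/pred0P=> u /=; apply/negbTE/negP=> /andP[/imsetP[g Pg ->] /setDP[Bv _]].
  by case/negP: vB; rewrite -(memJ_norm v (subsetP (normal_norm nBP) g Pg)).
have oPQ : #|P :\: Q| = 8 by rewrite cardsDS // oP oQ.
have eU : v ^: P :|: (B :\: Q) = P :\: Q.
  apply/eqP; rewrite eqEcard subUset sv sBQ /= oPQ.
  by move: dj; rewrite -leq_card_setU => /eqP->; rewrite -[8]/(4 + 4)%N leq_add.
have : x \in P :\: Q by rewrite in_setD xQ.
rewrite -eU => /setUP[xv|/setDP[Bx _]]; [left | right].
  by apply: subsetP xv; apply: imsetS.
have [_ cx] := setIP Bx; have Xx : coset Z x \in X by apply: mem_quotient.
have cq0 : coset Z q0 \in 'C[coset Z x].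
  by move: (cx); rewrite cent1C !cent1E -!cosetM ?nZG // => /eqP->.
have Eq0 : coset Z q0 \in E by apply: mem_quotient.
(* An element commuting with [x] but outside [P] would move [q0] modulo [Z]; then [x] would
   centralise two involutions of [E], hence [E], and would lie in [Q]. *)
have sCP : 'C_G[x] \subset P.
  apply/subsetP=> g /setIP[Gg /cent1P cg]; rewrite PP //.
  have Xg : coset Z g \in X by apply: mem_quotient.
  have cgb : coset Z g \in 'C[coset Z x] by apply/cent1P; rewrite /commute -!cosetM ?nZG // cg.
  apply/negPn/negP=> ng; case/negP: xQ.
  have e1 : coset Z q0 ^ coset Z g != coset Z q0.
    by apply: contra ng => /eqP/conjg_fixP/commgP/commute_sym/cent1P.
  have Ce1 : coset Z q0 ^ coset Z g \in 'C_E[coset Z x].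
    by rewrite in_setI memJ_norm ?(subsetP nEX) // Eq0 groupJ.
  have Ce0 : coset Z q0 \in 'C_E[coset Z x] by rewrite in_setI Eq0.
  have [_ q01] := setD1P (quatE_coset nQG Qq0).
  have eE : 'C_E[coset Z x] = E.
    apply/eqP; rewrite eqEcard subsetIl (quatE_card cGv nQG qQ) /=.
    have : #|'C_E[coset Z x]| %| 4 by rewrite -(quatE_card cGv nQG qQ) cardSg // subsetIl.
    have : 2 < #|'C_E[coset Z x]|.
      have := subset_leq_card (_ : [set 1; coset Z q0; coset Z q0 ^ coset Z g] \subset 'C_E[coset Z x]).
      rewrite !subUset !sub1set group1 Ce0 Ce1 => /(_ isT); apply: leq_trans.
      rewrite setUC cardsU1 cards2 !inE negb_or conjg_eq1 (negPf e1) eq_sym.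
      by have [+ _] := setD1P (quatE_coset nQG Qq0); rewrite eq_sym => ->.
    by case: #|_| => [|[|[|[|[|]]]]].
  have : coset Z x \in 'C_X(E).
    rewrite in_setI Xx; apply/centP=> y; rewrite -{1}eE => /setIP[_ /cent1P]; exact: commute_sym.
  rewrite (quatE_self_cent cGv nQG qQ vQ fus oG) => /quotient_lift[u [Nu Qu /rcoset_kercosetP]].
  by move/(_ (nZG Gx) Nu)/rcosetP=> [z Zz ->]; rewrite groupM // sZQ.
have sBC : B \subset 'C_G[x].
  by rewrite subsetI subsetIl sub_cent1; apply/centP=> y By; apply: (centsP aB).
suff eB : 'C_G[x] = B by rewrite eB C8.
(* If [v] commuted with [x], both would have the same centraliser, of order four, yet that of [x]
   contains [B]. *)
have nPC : ~~ (P \subset 'C_G[x]).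
  apply/negP=> /subsetP/(_ v Pv)/setIP[_ cv]; have Gx' : v \in G :\: Z by rewrite in_setD Gv andbT; case: cGv.
  have e : 'C_G[x] = 'C_G[v].
    by apply: (cent4_agree oZ Gx' oCv); rewrite in_setD Zx in_setI Gx cent1C cv.
  by have := subset_leq_card sBC; rewrite e oCv C8.
apply/esym/eqP; rewrite eqEcard sBC C8.
have := cardSg sBC; rewrite C8 => /dvdnP[k ek].
have lt : #|'C_G[x]| < 16 by rewrite -oP proper_card // properE sCP.
by move: lt; rewrite ek; case: k {ek} => [|[|k]] //; rewrite -[16]/(2 * 8)%N ltn_pmul2r.
Qed.

Lemma cent_case D x : D \in S -> #[D] = 3 -> D ^ coset Q v = D^-1 ->
  (forall s, s \in S -> s \in <[D]> \/ exists2 k, s = coset Q v ^ (D ^+ k) & true) ->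
  x \in G :\: Z ->
  [/\ abelian 'C_G[x], [|| #|'C_G[x]| == 4, #|'C_G[x]| == 6 | #|'C_G[x]| == 8],
    #|'C_G[x]| = 4 -> x \in v ^: G
    & (#|'C_G[x]| == 6) = (coset Q x \in <[D]>^#)].
Proof.
move=> SD oD DV Sd /setDP[Gx Zx].
have Sx : coset Q x \in S by apply: mem_quotient.
have oCv : #|'C_G[v]| = 4 by case: cGv.
have SV : coset Q v \in S by apply: mem_quotient.
have [Dx|nDx] := boolP (coset Q x \in <[D]>).
  have [Qx|Qx] := boolP (x \in Q).
    have [|-> aC] := @cent_quat x; first by rewrite in_setD Zx.
    split=> //.
    by rewrite (coset_id Qx) in_setD1 eqxx.
  have x1 : coset Q x != 1 by apply: contra Qx => /eqP/coset_idr; apply; apply: nQ.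
  have [-> aC] // := cent_three SD oD DV Gx Dx x1.
  by rewrite in_setD1 x1 Dx.
have [Dx|[k ex _]] := Sd _ Sx; first by rewrite Dx in nDx.
rewrite in_setD1 (negPf nDx) andbF.
have [g [Ng Gg eg]] : exists g, [/\ g \in 'N(Q), g \in G & D ^+ k = coset Q g].
  by apply: quotient_lift; rewrite groupX.
have Qv : x ^ g^-1 \in Q :* v.
  apply/rcoset_kercosetP; rewrite ?nQ ?groupJ ?groupV //.
  by rewrite cosetJ ?nQ ?groupV // ex eg morphV //= -conjgM mulgV conjg1.
have Gg' : g^-1 \in G by rewrite groupV.
have eC : 'C_G[x ^ g^-1] = 'C_G[x] :^ g^-1.
  by rewrite conjIg conjGid // cent1J.
have [xv|[c8 aC]] := cent_coset_v Qv; last first.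
  by rewrite eC cardJg in c8; rewrite eC abelianJ in aC; rewrite c8.
have xv' : x \in v ^: G.
  by case/imsetP: xv => h Gh e; rewrite -(conjgK g^-1 x) invgK e -conjgM memJ_class // groupM.
rewrite (card_cent1_class xv') oCv; split=> //.
apply: cent1_prime_abelian; rewrite ?in_setD ?Zx //.
have sZC : Z \subset 'C_G[x] by rewrite subsetI center_sub center_sub_cent1.
by rewrite -divgS // (card_cent1_class xv') oCv oZ.
Qed.

Lemma cent_class x : x \in G :\: Z ->
  [/\ abelian 'C_G[x], [|| #|'C_G[x]| == 4, #|'C_G[x]| == 6 | #|'C_G[x]| == 8]
    & #|'C_G[x]| = 4 -> x \in v ^: G].
Proof.
by have [D [SD oD DV _ Sd]] := three_vert; case/(cent_case SD oD DV Sd).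
Qed.

Lemma card_cent4_class : #|[set x in G :\: Z | #|'C_G[x]| == 4]| = 12.
Proof.
have [_ _ Zv oC] := cGv.
have -> : [set x in G :\: Z | #|'C_G[x]| == 4] = v ^: G.
  apply/setP=> x; rewrite inE; apply/andP/idP=> [[Gx /eqP]|xv]; first by case: (cent_class Gx).
  rewrite (card_cent1_class xv) oC eqxx; split=> //; case/imsetP: xv => g Gg ->.
  by rewrite in_setD (groupJ Gv Gg) andbT memJ_norm ?nZG.
by rewrite -index_cent1 -divgS ?subsetIl // oG oC.
Qed.

Lemma card_cent6_48 : #|[set x in G :\: Z | #|'C_G[x]| == 6]| = 16.
Proof.
have [D [SD oD DV _ Sd]] := three_vert.
have sD : <[D]>^# \subset S by rewrite subDset setUC subsetU // cycle_subG SD.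
have e : #|<[D]>^#| = 2 by have := cardsD1 1 <[D]>; rewrite group1 -orderE oD => -[].
have := card_coset_preim nQG sD; rewrite e oQ => h; rewrite -[16]/(8 * 2)%N -h.
apply: eq_card => x.
rewrite [LHS]inE [RHS]inE in_setD; case Gx: (x \in G); rewrite ?andbF //= andbT.
have [Zx|Zx] := boolP (x \in Z); first by rewrite coset_id ?sZQ // !inE eqxx.
by have [|_ _ _ ->] := cent_case SD oD DV Sd (x := x); rewrite ?in_setD ?Zx.
Qed.

Lemma FortyEight_graph : commuting_graph G ~= 6 * 'K_2 + 4 * 'K_4 + 3 * 'K_6.
Proof.
have cs x : x \in G :\: Z -> [|| #|'C_G[x]| == 4, #|'C_G[x]| == 6 | #|'C_G[x]| == 8].
  by case/cent_class.
apply: (comm_graph3 oZ (c1 := 4) (c2 := 6) (c3 := 8)) => //; rewrite ?card_cent4_class ?card_cent6_48 //.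
  by apply: abelian_centralisers_agree => x /cent_class[].
(* The remaining [46 - 12 - 16 = 18] vertices form three cliques of six. *)
have := @card_split3 _ _ (fun x => #|'C_G[x]|) 4 6 8 isT isT isT cs.
by rewrite card_cent4_class card_cent6_48 cardsDS ?center_sub // oG oZ => -[].
Qed.
End FortyEightGraph.

(** * Groups with an abelian subgroup of index two *)

Section AbelianIndexTwo.
Variables (gT : finGroupType) (G B : {group gT}).
Hypotheses (sBG : B \subset G) (iB : #|G : B| = 2) (aB : abelian B).
Hypotheses (oZ : #|'Z(G)| = 2) (B4 : 4 < #|B|).
Local Notation Z := 'Z(G).

(** [x] and the abelian group [B] generate [G]. This leaves only two kinds of noncentral elements:
    those of [B], with centraliser [B], and the others, with a centraliser of order four. *)
Lemma cent_pair x y : x \in G :\: B -> y \in B -> commute x y -> y \in Z.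
Proof.
move=> Gx By cxy; apply/centerP; split; first exact: subsetP By.
move=> g Gg; have [Bg|[b Bb ->]] := index2_cosets sBG iB Gx Gg.
  exact: (centsP aB).
by apply: commuteM; [exact: commute_sym | exact: (centsP aB)].
Qed.

Lemma center_sub_index2 : Z \subset B.
Proof.
apply/subsetP=> z Zz; apply/negPn/negP=> nBz; have /centerP[Gz cz] := Zz.
have sBZ : B \subset Z.
  by apply/subsetP=> y By; apply: (@cent_pair z) => //; rewrite ?in_setD ?nBz //; apply/cz/(subsetP sBG).
by have := subset_leq_card sBZ; rewrite oZ leqNgt (ltn_trans _ B4).
Qed.

Lemma cent1_outside x : x \in G :\: B -> #|'C_G[x]| = 4.
Proof.
move=> Gx; have [Gx' Bx] := setDP Gx.
have CB : 'C_G[x] :&: B = Z.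
  apply/eqP; rewrite eqEsubset subsetI center_sub_index2 andbT; apply/andP; split.
    by apply/subsetP=> y /setIP[/setIP[_ /cent1P cy] By]; apply: (cent_pair Gx By); apply: commute_sym.
  by rewrite subsetI center_sub center_sub_cent1.
have nB : B <| G by apply: index2_normal.
have i2 : #|'C_G[x] : 'C_G[x] :&: B| = 2.
  apply/eqP; rewrite eqn_leq; apply/andP; split.
    rewrite indexgI -iB -card_quotient ?(subset_trans (subsetIl _ _)) ?normal_norm //.
    by rewrite -(card_quotient (normal_norm nB)) subset_leq_card ?quotientS ?subsetIl.
  rewrite ltnNge; apply: contra Bx => h.
  have : #|'C_G[x] : 'C_G[x] :&: B| == 1%N by rewrite eqn_leq h indexg_gt0.
  by rewrite indexg_eq1 => /subsetP/(_ x); rewrite !in_setI Gx' cent1id; apply.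
by have := Lagrange (subsetIl 'C_G[x] B); rewrite i2 /= CB oZ => <-.
Qed.

Lemma cent1_inside x : x \in B :\: Z -> 'C_G[x] = B.
Proof.
case/setDP=> Bx Zx; apply/eqP; rewrite eqEsubset; apply/andP; split.
  apply/subsetP=> y /setIP[Gy /cent1P cy]; apply/negPn/negP=> By.
  by case/negP: Zx; apply: (@cent_pair y) => //; rewrite in_setD By.
by rewrite subsetI sBG sub_cent1; apply/centP=> y By; apply: (centsP aB).
Qed.

Lemma abelian_index2_graph : exists m k,
  [/\ (4 * m)%N = #|G|, (2 * k + 4)%N = #|G| & commuting_graph G ~= m * 'K_2 + 'K_k].
Proof.
have oG : #|G| = (2 * #|B|)%N by rewrite -iB mulnC Lagrange.
have [||m] := @comm_cliques _ G 4; rewrite ?oZ //; first exact: cent4_agree.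
have cE x : x \in G :\: Z -> (#|'C_G[x]| == 4) = (x \notin B).
  case/setDP=> Gx Zx; have [Bx|Bx] := boolP (x \in B).
    by rewrite cent1_inside ?in_setD ?Zx // gtn_eqF.
  by rewrite cent1_outside ?in_setD ?Bx.
have -> : #|[set x in G :\: Z | #|'C_G[x]| == 4]| = #|B|.
  have -> : [set x in G :\: Z | #|'C_G[x]| == 4] = G :\: B.
    apply/setP=> x; rewrite inE; apply/andP/setDP=> [[Gx]|[Gx Bx]].
      by rewrite cE //; case/setDP: Gx.
    have Zx : x \in G :\: Z by rewrite in_setD Gx andbT; apply: contra Bx; apply: (subsetP center_sub_index2).
    by rewrite cE.
  by rewrite cardsDS // oG mul2n -addnn addnK.
move=> em im; exists m, (#|B| - 2)%N; split.
- by rewrite oG em -[4%N]/(2 * 2)%N -mulnA (mulnC m).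
- by rewrite mulnBr -[(2 * 2)%N]/4%N subnK // (leq_mul2l 2 2) (leq_trans _ B4).
pose Q (x : commuting_graph G) := val x \in B.
have <- : #|[set x | Q x]| = (#|B| - 2)%N.
  rewrite (@card_vertices _ G (fun y => y \in B)) -oZ -cardsDS ?center_sub_index2 //; apply: eq_card => x.
  rewrite inE !in_setD; have [Bx|Bx] := boolP (x \in B); last by rewrite !andbF.
  by rewrite (subsetP sBG x Bx) !andbT.
have PQ x : cent_card 4 x = ~~ Q x by rewrite -cE //; exact: vertexP.
apply: (split2 _ _ _ im (induced_complete (P := Q) _)) => [x|x|x y|x y Qx Qy xy].
- by rewrite PQ; case: (Q x).
- by rewrite PQ.
- rewrite PQ => Qx Qy; apply/negP=> /edge_cent; rewrite in_setI cent1C => /andP[_ cyx].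
  have /setDP[Gx _] := vertexP x; have /setDP[_ Zy] := vertexP y.
  have : val x \in 'C_G[val y] by rewrite in_setI Gx.
  by rewrite cent1_inside ?in_setD ?Zy //; apply/negP.
have : adj x y; last by rewrite /adj (negPf xy).
rewrite adj_cent cent1_inside //; have /setDP[_ Zx] := vertexP x.
by rewrite in_setD Zx; exact: Qx.
Qed.
End AbelianIndexTwo.

(** * The commuting graph without its isolated edges *)

Section Delta.
Variables (gT : finGroupType) (G : {group gT}).
Local Notation Z := 'Z(G).
Definition big_cent := [set x in G :\: Z | #|'C_G[x]| != 4].
Definition Delta := induced (fun x : commuting_graph G => ~~ cent_card 4 x).

Lemma Delta_val (x : Delta) : val (val x) \in big_cent.
Proof. by rewrite inE vertexP; apply: (valP x). Qed.

Lemma Delta_adj (x y : Delta) : adj x y = (val (val y) \in 'C_G[val (val x)]).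
Proof. by rewrite -adj_cent. Qed.

Lemma Delta_lift x : x \in big_cent -> exists y : Delta, val (val y) = x.
Proof.
rewrite inE => /andP[Gx cx]; pose y : commuting_graph G := exist _ x Gx.
by exists (exist _ y cx : Delta).
Qed.

Lemma Delta_path (x : Delta) p : {subset p <= big_cent} ->
  path (fun a b => b \in 'C_G[a]) (val (val x)) p ->
  exists2 q, [seq val (val y) | y : Delta <- q] = p & path (@adj Delta) x q.
Proof.
elim: p x => [|a p IHp] x sp /=; first by exists [::].
case/andP=> xa pp; have [y ey] := Delta_lift (sp a (mem_head _ _)); subst a.
have [|q eq qp] := IHp y _ pp; first by move=> b bp; apply: sp; rewrite inE bp orbT.
by exists (y :: q); rewrite /= ?eq // Delta_adj xa.
Qed.

Hypothesis oZ : #|Z| = 2.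

Lemma Delta_le n : big_cent != set0 ->
  {in big_cent &, forall x y, exists p, [/\ size p <= n, {subset p <= big_cent},
     path (fun a b => b \in 'C_G[a]) x p & last x p = y]} ->
  gconnected Delta /\ gdiam Delta <= n.
Proof.
case/set0Pn=> x0 /Delta_lift[y0 _] h; apply: diam_le => [|x y].
  by apply/card_gt0P; exists y0.
have [p [sp pD pp lp]] := h _ _ (Delta_val x) (Delta_val y).
have [q eq qp] := Delta_path pD pp; exists q; split=> //.
  by rewrite -(size_map (fun y : Delta => val (val y))) eq.
apply/val_inj/val_inj; rewrite -lp -eq.
by rewrite (last_map (fun y : Delta => val (val y))).
Qed.

(** The route is [x], [a], [b], [y], where the hubs [a] and [b] commute with each other. *)
Lemma Delta_hub (U : {set gT}) : U != set0 -> U \subset big_cent ->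
  {in U &, forall a b, commute a b} ->
  {in big_cent, forall x, exists2 u, u \in U & commute x u} ->
  gconnected Delta /\ gdiam Delta <= 3.
Proof.
case/set0Pn=> u0 Uu0 /subsetP sU cU hub.
have G_big x : x \in big_cent -> x \in G by rewrite inE => /andP[/setDP[]].
apply: Delta_le => [|x y Bx By]; first by apply/set0Pn; exists u0; apply: sU.
have [a Ua cxa] := hub x Bx; have [b Ub cyb] := hub y By.
exists [:: a; b; y]; split=> //= [z|].
  by rewrite !in_cons in_nil orbF => /or3P[]/eqP-> //; apply: sU.
rewrite !in_setI (G_big _ (sU _ Ua)) (G_big _ (sU _ Ub)) (G_big _ By) /= andbT; apply/and3P; split; apply/cent1P.
- exact: commute_sym.
- exact: cU.
exact: cyb.
Qed.

Lemma cent4_graph : (4 * #|[set x in G :\: Z | #|'C_G[x]| == 4]|)%N = #|G| ->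
  exists2 m, (8 * m)%N = (#|commuting_graph G| + 2)%N & commuting_graph G ~= m * 'K_2 + Delta.
Proof.
have [m -> im] := comm_graph_K2 oZ => e; exists m => //.
by rewrite -[X in (_ + X)%N]oZ card_commuting -e -[8%N]/(4 * 2)%N -mulnA (mulnC m).
Qed.
End Delta.

(** * Odd normal subgroups inverted by [v] *)

Section InvertedCore.
Variables (gT : finGroupType) (G N : {group gT}) (v : gT).
Hypotheses (cGv : cent4 G v) (nNG : N <| G) (oN : odd #|N|) (ntN : N :!=: 1).
Local Notation Z := 'Z(G).
Let C := 'C_G(N)%G.
Let Gv : v \in G. Proof. by case: cGv. Qed.
Let oZ : #|Z| = 2. Proof. by case: cGv. Qed.
Let nN : {subset G <= 'N(N)}. Proof. exact/subsetP/normal_norm. Qed.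
Let sNG : N \subset G. Proof. exact: normal_sub. Qed.
Let invN : acts_by_inversion v N. Proof. exact: (cent4_odd_inversion cGv nNG oN). Qed.
Let aN : abelian N. Proof. exact: inversion_abelian invN. Qed.
Let sNC : N \subset C.
Proof. by rewrite subsetI sNG. Qed.
Let nCG : C <| G.
Proof. by rewrite /normal subsetIl normsI ?normG // norms_cent ?normal_norm. Qed.
Let sZC : Z \subset C.
Proof. by rewrite setIS ?centS. Qed.

Lemma odd_cent1_neq4 x n : n \in N -> n != 1 -> commute x n -> #|'C_G[x]| != 4.
Proof.
move=> Nn n1 cxn; apply: contra n1 => /eqP C4; rewrite -order_eq1 -dvdn1.
have d4 : #[n] %| 4.
  by rewrite -C4 order_dvdG // in_setI (subsetP sNG) //=; apply/cent1P; apply: commute_sym.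
have on : odd #[n] by apply: dvdn_odd oN; rewrite order_dvdG.
have co : coprime #[n] 4 by rewrite (@coprimeXr 2 _ 2) // coprimen2.
by rewrite -(eqP co) dvdn_gcd dvdnn.
Qed.

Lemma odd_core_big n : n \in N -> n != 1 -> n \in big_cent G.
Proof.
move=> Nn n1; rewrite inE in_setD (subsetP sNG) // (odd_cent1_neq4 Nn) // !andbT.
by apply: contra n1 => Zn; apply/eqP; apply: (cent4_odd_TI cGv nNG oN).
Qed.

Lemma inverted_class : v ^: G \subset v *: C.
Proof.
apply/subsetP=> _ /imsetP[x Gx ->]; rewrite mem_lcoset -[v ^ x]/(conjg v x) -[v^-1 * _]commgEl.
by rewrite -invg_comm groupV; apply: (cent_inverted_comm cGv nNG oN Gx).
Qed.

Lemma card_inverted_class : (4 * #|v ^: G|)%N = #|G|.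
Proof. by case: cGv => _ _ _ <-; rewrite -index_cent1 Lagrange ?subsetIl. Qed.

Lemma cent4_sub_lcoset x : x \in G :\: Z -> #|'C_G[x]| = 4 -> x \in v *: C.
Proof.
case/setDP=> Gx Zx Cx; have cGx : cent4 G x by split.
rewrite mem_lcoset in_setI groupM ?groupV //=; apply: two_inversions_cent.
  by apply: acts_by_inversionV (nN Gv).
exact: (cent4_odd_inversion cGx nNG oN).
Qed.

Lemma class_cent4 x : x \in v ^: G -> (x \in G :\: Z) && (#|'C_G[x]| == 4).
Proof.
move=> vx; rewrite (card_cent1_class vx); case: (cGv) => _ _ Zv ->; rewrite eqxx andbT in_setD.
case/imsetP: vx => g Gg ->; rewrite (groupJ Gv Gg) memJ_norm ?Zv //.
by apply: (subsetP (normal_norm (center_normal G))).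
Qed.

Lemma inverted_notin_cent : v \notin C.
Proof.
apply/negP=> Cv; case/negP: ntN; rewrite -(setIidPl (_ : N \subset 'C[v])) ?(cent4_odd_cent1 cGv) //.
by rewrite sub_cent1; case/setIP: Cv.
Qed.

(** The class of [v] comprises a quarter of [G] and lies in a single coset of [C]. *)
Lemma cent_index_le : #|G : C| <= 4.
Proof.
rewrite -(leq_pmul2r (cardG_gt0 C)) mulnC Lagrange ?subsetIl //.
by rewrite -card_inverted_class leq_mul2l /= -(card_lcoset C v) subset_leq_card ?inverted_class.
Qed.

Lemma cent_index : 2.-nat #|G : C| -> #|G : C| = 2 \/ #|G : C| = 4.
Proof.
have ne1 : #|G : C| != 1%N.
  by rewrite indexg_eq1; apply: contra inverted_notin_cent => /subsetP->.
have := cent_index_le; have := indexg_gt0 G C; move: #|G : C| ne1 => [|[|[|[|[|]]]]] //= _ _ _; auto.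
Qed.

Section IndexFour.
Hypothesis iC : #|G : C| = 4.

Lemma index4_class : v ^: G = v *: C.
Proof.
apply/eqP; rewrite eqEcard inverted_class card_lcoset -(leq_pmul2l (isT : 0 < 4)).
by rewrite /= card_inverted_class -(Lagrange (normal_sub nCG)) iC mulnC.
Qed.

(** Otherwise [G / C] is cyclic of order four with the image of [v] as its involution, so [x ^+ 2]
    lies in [v *: C], which is the class of [v]. Then [v] is the square of some [s] in ['C_G[v]],
    but all squares there are central. *)
Lemma index4_sqr x : x \in G -> x ^+ 2 \in C.
Proof.
move=> Gx; apply: contraT => Cx2; set y := coset C x.
have nC : {subset G <= 'N(C)} by apply/subsetP/normal_norm.
have oGC : #|G / C| = 4 by rewrite card_quotient ?normal_norm.
have Yy : y \in G / C by rewrite mem_quotient.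
have y2 : y ^+ 2 != 1.
  by rewrite -cosetX ?nC //; apply: contra Cx2 => /eqP/coset_idr; apply; rewrite nC ?groupX.
have oy : #[y] = 4.
  have : #[y] %| 4 by rewrite -oGC order_dvdG.
  case/dvdn4=> // oy; first by rewrite (eqP (_ : y == 1)) ?expg1n ?eqxx // -?order_eq1 ?oy in y2.
  by rewrite -oy expg_order eqxx in y2.
have eY : G / C = <[y]> by apply/esym/eqP; rewrite eqEcard cycle_subG Yy oGC -orderE oy.
have v1 : coset C v != 1.
  by apply: contra inverted_notin_cent => /eqP/coset_idr; apply; apply: nC.
have v2 : coset C v ^+ 2 = 1.
  by rewrite -cosetX ?nC //; apply/coset_id/(subsetP sZC)/(cent4_sqr cGv).
have ev : coset C v = y ^+ 2.
  have : coset C v \in <[y]> by rewrite -eY mem_quotient.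
  case/cyclePmin=> i; rewrite oy => i4 e; move: i4 v1 v2; rewrite e -expgM.
  case: i {e} => [|[|[|[|]]]] //=; rewrite ?eqxx ?(negPf y2) //.
    by move=> _ _ e; rewrite e eqxx in y2.
  by move=> _ _; rewrite -[(3 * 2)%N]/(4 + 2)%N expgD -{1}oy expg_order mul1g => e; rewrite e eqxx in y2.
have : x ^+ 2 \in v *: C.
  have : coset C (x ^+ 2) = coset C v by rewrite ev cosetX ?nC.
  move/(rcoset_kercosetP (nC _ (groupX 2 Gx)) (nC _ Gv)).
  by rewrite norm_rlcoset ?nC.
rewrite -index4_class => /imsetP[g Gg e]; pose s := x ^ g^-1.
have es : s ^+ 2 = v by rewrite -conjXg e conjgK.
have Cs : s \in 'C_G[v].
  by rewrite in_setI groupJ ?groupV //=; apply/cent1P; rewrite -es; apply: commuteX.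
case: (cGv) => _ _ /negP[]; rewrite -es; have [Zs|[z Zz ->]] := cent4_cosets cGv Cs.
  exact: groupX.
have cz : commute v z by case/centerP: Zz => _ cz; apply/commute_sym/cz.
by rewrite expgMn //; apply: groupM; [apply: (cent4_sqr cGv) | apply: groupX].
Qed.

(** If [x] fixed no nonidentity element of [N] it would invert [N], as [x ^+ 2] centralises [N];
    then it would lie in [v *: C], the class of [v], and have a centraliser of order four. *)
Lemma index4_big x : x \in big_cent G -> exists n, [/\ n \in N, n != 1 & commute x n].
Proof.
rewrite inE => /andP[/setDP[Gx Zx] Cx].
have [cNx|/trivgPn[n /setIP[Nn /cent1P cn] n1]] := eqVneq 'C_N[x] 1; last first.
  by exists n; split=> //; apply: commute_sym.
case/negP: Cx; have ix : acts_by_inversion x N.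
  by apply: fixfree_inversion cNx; rewrite ?nN //; case/setIP: (index4_sqr Gx).
suff : x \in v ^: G by case/class_cent4/andP.
rewrite index4_class mem_lcoset in_setI groupM ?groupV //=; apply: two_inversions_cent => //.
exact: acts_by_inversionV (nN Gv).
Qed.

Lemma index4_Delta : gconnected (Delta G) /\ gdiam (Delta G) <= 3.
Proof.
apply: (@Delta_hub _ _ (N :\ 1)).
- by have [n Nn n1] := trivgPn _ ntN; apply/set0Pn; exists n; rewrite !inE n1.
- by apply/subsetP=> n /setD1P[n1 Nn]; apply: odd_core_big.
- by move=> n m /setD1P[_ Nn] /setD1P[_ Nm]; apply: (centsP aN).
by move=> x /index4_big[n [Nn n1 cn]]; exists n; rewrite // !inE n1.
Qed.

Lemma index4_graph : exists (m : nat) (D : sgraph),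
  [/\ (8 * m)%N = (#|commuting_graph G| + 2)%N, commuting_graph G ~= m * 'K_2 + D,
      gconnected D & gdiam D <= 3].
Proof.
have [|m em im] := cent4_graph oZ.
  rewrite -[RHS]card_inverted_class; congr (4 * _)%N; apply: eq_card => x.
  rewrite inE; apply/idP/idP=> [/andP[Gx /eqP Cx]|/class_cent4//].
  by rewrite index4_class cent4_sub_lcoset.
by have [cD dD] := index4_Delta; exists m, (Delta G).
Qed.
End IndexFour.

Lemma index2_inverts x : #|G : C| = 2 -> x \in G -> x \notin C -> acts_by_inversion x N.
Proof.
move=> iC Gx Cx n Nn; have vC := inverted_notin_cent.
have /setIP[_ /centP cvx] : v^-1 * x \in C by apply: (index2_lcoset (subsetIl _ _) iC); rewrite in_setD ?vC ?Cx.
rewrite -(mulKVg v x) conjgM invN // conjgE -(cvx n^-1) ?groupV //.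
by rewrite mulKg.
Qed.

Lemma index2_abelian_graph : #|G : C| = 2 -> abelian C -> exists m k : nat,
  [/\ (4 * m)%N = (#|commuting_graph G| + 2)%N, (2 * k + 2)%N = #|commuting_graph G|
    & commuting_graph G ~= m * 'K_2 + 'K_k].
Proof.
move=> iC aC; have C6 : 4 < #|C|.
  have d2 : 2 %| #|C| by rewrite -oZ cardSg.
  have dN : #|N| %| #|C| by rewrite cardSg.
  have : 2 * #|N| %| #|C| by rewrite Gauss_dvd ?d2 // coprime2n.
  move/dvdn_leq=> /(_ (cardG_gt0 C)); apply: leq_trans.
  have : 1 < #|N| by rewrite cardG_gt1.
  rewrite leq_eqVlt => /predU1P[N2|N3]; first by move: oN; rewrite -N2.
  by apply: (@leq_trans (2 * 3)%N) => //; rewrite leq_mul2l.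
have [m [k [em ek im]]] := abelian_index2_graph (subsetIl _ _) iC aC oZ C6.
have := card_commuting G; rewrite oZ => eG; exists m, k; split=> //; first by rewrite eG.
by apply/eqP; rewrite -(eqn_add2r 2) eG -addnA ek.
Qed.
End InvertedCore.

(** * Two-groups of small order *)

Lemma small_2group_abelian (gT : finGroupType) (S : {group gT}) :
  2.-group S -> #|S| < 8 -> abelian S.
Proof.
move=> pS; have [[|[|[|n]]] oS] := p_natP pS => S8.
- by rewrite (card1_trivg oS) abelian1.
- by rewrite cyclic_abelian // prime_cyclic // oS.
- by rewrite (card_p2group_abelian _ oS).
by move: S8; rewrite oS !expnS !mulnA -[8%N]/(8 * 1)%N ltn_pmul2l // ltnNge expn_gt0.
Qed.

Lemma group4_isog (gT : finGroupType) (T : {group gT}) :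
  #|T| = 4 -> T \isog [set: 'Z_4] \/ T \isog 'D_4.
Proof.
move=> oT; have aT : abelian T by apply: (@card_p2group_abelian _ 2).
have [cT|ncT] := boolP (cyclic T).
  left; rewrite isog_cyclic_card // cardsT card_ord oT eqxx andbT.
  by apply/cyclicP; exists Zp1; apply: Zp_cycle.
have ox x : x \in T -> x != 1 -> #[x] = 2.
  move=> Tx x1; have : #[x] %| 4 by rewrite -oT order_dvdG.
  case/dvdn4=> // ox; first by rewrite -order_eq1 ox in x1.
  by case/cyclicP: ncT; exists x; apply/esym/eqP; rewrite eqEcard cycle_subG Tx -orderE ox oT.
have [x Tx x1] : exists2 x, x \in T & x != 1.
  by apply/trivgPn; rewrite -cardG_gt1 oT.
have [y Ty Xy] : exists2 y, y \in T & y \notin <[x]>.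
  apply/subsetPn; apply/negP=> /subset_leq_card.
  by rewrite oT -orderE ox.
have xy : x != y by apply: contraNneq Xy => <-; exact: cycle_id.
have y1 : y != 1 by apply: contraNneq Xy => ->; exact: group1.
have eT : <<[set x; y]>> = T.
  apply/eqP; rewrite eqEcard gen_subG subUset !sub1set Tx Ty oT /=.
  have sX : <[x]> \proper <<[set x; y]>>.
    rewrite properE cycle_subG mem_gen ?inE ?eqxx //=; apply/subsetPn; exists y => //.
    by rewrite mem_gen // !inE eqxx orbT.
  have d4 : #|<<[set x; y]>>| %| 4 by rewrite -oT cardSg // gen_subG subUset !sub1set Tx.
  have := proper_card sX; rewrite -orderE ox //.
  by case/dvdn4: d4 => ->.
by right; have := involutions_gen_dihedral (ox x Tx x1) (ox y Ty y1) xy; rewrite /= eT oT.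
Qed.

Lemma group8_isog (gT : finGroupType) (T : {group gT}) :
  #|T| = 8 -> ~~ abelian T -> T \isog 'Q_8 \/ T \isog 'D_8.
Proof.
move=> oT naT; have pT : 2.-group T by rewrite /pgroup oT.
have es : extraspecial T by apply: (p3group_extraspecial pT naT); rewrite oT.
by case/orP: (card_isog8_extraspecial oT es); auto.
Qed.

Lemma Z2_sqr (i : 'Z_2) : i * i = 1.
Proof. by apply: val_inj; case: i => [[|[|]]]. Qed.

(** * Groups with a normal 2-complement *)

Section Complement.
Variables (gT : finGroupType) (G T : {group gT}) (v : gT).
Hypotheses (cGv : cent4 G v) (sylT : 2.-Sylow(G) T) (sCT : 'C_G[v] \subset T).
Hypothesis hcG : has_2compl G.
Let N := 'O_2^'(G)%G.
Let C := 'C_G(N)%G.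
Local Notation Z := 'Z(G).
Let Gv : v \in G. Proof. by case: cGv. Qed.
Let oZ : #|Z| = 2. Proof. by case: cGv. Qed.
Let nNG : N <| G. Proof. exact: pcore_normal. Qed.
Let oN : odd #|N|.
Proof. by rewrite odd_2'nat; exact: pcore_pgroup. Qed.
Let sTG : T \subset G. Proof. exact: pHall_sub sylT. Qed.
Let pT : 2.-group T. Proof. exact: pHall_pgroup sylT. Qed.

Lemma complement_sdprod : N ><| T = G.
Proof.
apply/(sdprod_Hall_pcoreP (has_2compl_Hall hcG)).
by rewrite (eq_pHall _ _ (negnK 2)).
Qed.

Let eNT : N * T = G. Proof. exact: sdprodW complement_sdprod. Qed.

Let invN : acts_by_inversion v N. Proof. exact: (cent4_odd_inversion cGv nNG oN). Qed.
Let aN : abelian N. Proof. exact: inversion_abelian invN. Qed.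
Let sNG : N \subset G. Proof. exact: normal_sub. Qed.
Let nN : {subset G <= 'N(N)}. Proof. exact/subsetP/normal_norm. Qed.
Let sNC : N \subset C. Proof. by rewrite subsetI sNG. Qed.

Lemma complement_index : #|T : C| = #|G : C|.
Proof.
have nCT : T \subset 'N(C) by rewrite (subset_trans sTG) // normsI ?normG // norms_cent ?normal_norm.
have eTC : T * C = G.
  by apply/eqP; rewrite eqEsubset mul_subG ?subsetIl //= (normC nCT) -{1}eNT mulSg.
by apply/eqP; rewrite -(eqn_pmul2r (cardG_gt0 C)) LagrangeMr eTC mulnC Lagrange ?subsetIl.
Qed.

Lemma complement_card_image : #|conj_aut N @* T| = #|G : C|.
Proof.
rewrite card_morphim ker_conj_aut (setIidPr _) ?(subset_trans sTG) ?normal_norm //.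
rewrite -complement_index -(indexgI T C) -(indexgI T 'C(N)) /=.
by rewrite (setIA T G) (setIidPl sTG).
Qed.

Lemma complement_2index : 2.-nat #|G : C|.
Proof. by rewrite -complement_index; apply: pnat_dvd pT; apply: dvdn_indexg. Qed.

Hypothesis ntN : N :!=: 1.

Lemma complement_image :
  conj_aut N @* T \isog [set: 'Z_2] \/ conj_aut N @* T \isog [set: 'Z_2 * 'Z_2].
Proof.
have oI := complement_card_image.
have [iC|iC] := cent_index cGv nNG oN ntN complement_2index; rewrite iC in oI; [left|right].
  rewrite isog_cyclic_card ?prime_cyclic ?oI //; last by rewrite cardsT card_ord.
  by rewrite cardsT card_ord.
have sqr : {in conj_aut N @* T, forall x, x ^+ 2 = 1}.
  move=> _ /morphimP[x nNx Tx ->]; rewrite -morphX //.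
  apply: mker; rewrite ker_conj_aut.
  by case/setIP: (index4_sqr cGv nNG oN ntN iC (subsetP sTG x Tx)).
have ab : 2.-abelem (conj_aut N @* T) by apply/abelemP => //; split=> //; exact: exponent2_abelian.
rewrite (isog_abelem_card _ ab) oI cardsT card_prod !card_ord eqxx andbT.
have sqrZ : {in [set: 'Z_2 * 'Z_2], forall x, x ^+ 2 = 1}.
  by case=> i j _; rewrite expgS expg1; congr pair; rewrite /= Z2_sqr.
by apply/abelemP => //; split=> //; exact: exponent2_abelian.
Qed.

(* Here [C] is nonabelian, so [T] has a cyclic maximal subgroup [X] of order
   at least 8, and the elements with centralisers of order 4 are those outside
   [C] and [M = N X]; everything else commutes with a fixed element of [N] or
   with the square of a generator of [X]. *)
Lemma index2_nonabelian_graph : #|G : C| = 2 -> ~~ abelian C ->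
  exists (m : nat) (D : sgraph),
  [/\ (8 * m)%N = (#|commuting_graph G| + 2)%N, commuting_graph G ~= m * 'K_2 + D,
      gconnected D & gdiam D <= 3].
Proof.
move=> iC naC; pose S := (T :&: C)%G; have sCG : C \subset G := subsetIl _ _.
have eC : C = N * S :> {set gT} by rewrite (group_modl T sNC) eNT; apply/esym/setIidPr.
have naS : ~~ abelian S.
  apply: contra naC => aS; rewrite eC abelianM aN aS /=.
  by rewrite subIset // subsetIr orbT.
have S8 : 8 <= #|S|.
  by rewrite leqNgt; apply: contra naS; apply: small_2group_abelian; apply: pgroupS pT; apply: subsetIl.
have oTS : #|T| = (2 * #|S|)%N.
  by rewrite -(LagrangeI T C) complement_index iC mulnC.
have T16 : 16 <= #|T| by rewrite oTS (leq_mul2l 2 8).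
have T4 : 4 < #|T| by apply: leq_trans T16.
have [X [cX sXT iX [_ sZX] _]] := extremal2_cyclic (cent4_extremal cGv sylT sCT T4) (cent4_nonabelian cGv sylT sCT T4).
rewrite (cent4_centerT cGv sylT sCT T4) in sZX.
have sXG : X \subset G := subset_trans sXT sTG.
have oTX : #|T| = (2 * #|X|)%N by rewrite -iX mulnC Lagrange.
have X8 : 8 <= #|X| by rewrite -(leq_pmul2l (isT : 0 < 2)) -oTX.
have aX : abelian X := cyclic_abelian cX.
pose M := (N <*> X)%G.
have eM : M = N * X :> {set gT} by rewrite /= norm_joinEr // (subset_trans sXG) ?normal_norm.
have sNM : N \subset M by apply: joing_subl.
have sXM : X \subset M by apply: joing_subr.
have sMG : M \subset G by rewrite join_subG sNG.
have coN (H : {group gT}) : H \subset T -> coprime #|N| #|H|.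
  move=> sHT; have [n oH] := p_natP (pgroupS sHT pT).
  by rewrite oH coprimeXr // coprimen2.
have oG : #|G| = (2 * #|M|)%N.
  by rewrite -(sdprod_card complement_sdprod) eM coprime_cardMg ?coN // oTX mulnCA.
have oG' : #|G| = (2 * #|C|)%N by rewrite -(Lagrange sCG) iC mulnC.
(* If [M] centralised [N], then [S] would contain [X] and equal it by order, but [S] is not
   abelian. *)
have MC : ~~ (M \subset C).
  apply: contra naS => sMC; suff -> : S :=: X by [].
  apply/esym/eqP; rewrite eqEcard subsetI sXT (subset_trans sXM sMC) /=.
  by rewrite -(leq_pmul2l (isT : 0 < 2)) -oTS oTX.
have [m0 Mm0 Cm0] := subsetPn MC.
have eMC : M * C = G.
  apply/eqP; rewrite eqEsubset mul_subG //=; apply/subsetP=> y Gy.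
  have Dm0 : m0 \in G :\: C by rewrite in_setD Cm0 (subsetP sMG).
  have [Cy|[c Cc ->]] := index2_cosets sCG iC Dm0 Gy; apply/mulsgP; last by exists m0 c.
  by exists 1 y; rewrite ?mul1g.
have oMC : (#|M| = 2 * #|M :&: C|)%N.
  have : #|M : C| == 2 by rewrite -(eqn_pmul2r (cardG_gt0 C)) LagrangeMr eMC oG'.
  by move/eqP=> i2; rewrite -(LagrangeI M C) i2 mulnC.
(* Such an element is conjugate under [N] to some [s] in [X], whose centraliser contains [X], of
   order at least eight. *)
have inM x : x \in M -> x \notin C -> #|'C_G[x]| != 4.
  rewrite -[x \in _]/(x \in (M : {set gT})) eM => /mulsgP[n s Nn Xs ->] Cns.
  have Gs := subsetP sXG s Xs; have Cs : s \notin C by rewrite -(groupMl _ (subsetP sNC n Nn)).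
  have invs := index2_inverts cGv nNG oN ntN iC Gs Cs.
  rewrite conjgC; have [|m Nm ->] := @inversion_coset_conj _ N s (n ^ s) oN invs.
    by rewrite memJ_norm // nN.
  rewrite (@card_cent1_class _ G s); last by rewrite memJ_class // (subsetP sNG).
  apply/eqP=> e4; have : #|X| <= 4.
    by rewrite -e4 subset_leq_card // subsetI sXG sub_cent1; apply: (subsetP aX).
  by rewrite leqNgt (leq_trans _ X8).
have sZC : Z \subset C by rewrite setIS ?centS.
have sZM : Z \subset M := subset_trans sZX sXM.
pose K := [set x in G :\: Z | #|'C_G[x]| == 4].
have sK : K \subset (G :\: C) :\: (M :\: C).
  apply/subsetP=> x; rewrite inE => /andP[Gx /eqP Cx]; have [Gx' Zx] := setDP Gx.
  have Cx' : x \notin C.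
    have := cent4_sub_lcoset cGv nNG oN Gx Cx; rewrite mem_lcoset => vx.
    by apply: contra (inverted_notin_cent cGv nNG oN ntN) => Cx'; rewrite -groupV -(groupMr _ Cx').
  rewrite !in_setD Cx' Gx' /= andbT; apply: contraTN (introT eqP Cx) => Mx; exact: inM.
(* Both [M] and [C] have index two and their intersection has index four, so the elements outside
   both are as many as the conjugates of [v]. *)
have oD : #|(G :\: C) :\: (M :\: C)| = #|M :&: C|.
  rewrite cardsDS ?setSD // cardsDS // cardsD oG' mul2n -addnn addnK.
  have -> : #|C| = #|M| by apply/eqP; rewrite -(eqn_pmul2l (isT : 0 < 2)) -oG -oG'.
  by rewrite subKn // subset_leq_card ?subsetIl.
have vK : v ^: G \subset K.
  by apply/subsetP=> x /(class_cent4 cGv)/andP[Gx Cx]; rewrite inE Gx.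
have oV : #|v ^: G| = #|M :&: C|.
  by apply/eqP; rewrite -(eqn_pmul2l (isT : 0 < 4)) (card_inverted_class cGv) oG oMC mulnA.
have eK : K = (G :\: C) :\: (M :\: C).
  by apply/eqP; rewrite eqEcard sK oD -oV subset_leq_card.
have oK : (4 * #|K|)%N = #|G| by rewrite eK oD -oV (card_inverted_class cGv).
have [m em im] := cent4_graph oZ oK.
(* The square lies in [C] because [C] has index two, and it is not central because a generator of
   [X] has order at least eight. *)
have [a eX] := cyclicP cX; pose h := a ^+ 2.
have Xa : a \in X by rewrite eX cycle_id.
have Ga := subsetP sXG a Xa.
have Xh : h \in X by rewrite groupX.
have Ch : h \in C.
  have [Ca|Ca] := boolP (a \in C); first exact: groupX.
  have := @index2_lcoset _ G C a^-1 a sCG iC; rewrite !in_setD !groupV Ca Ga invgK => /(_ isT isT).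
  by rewrite -expg2.
have Zh : h \notin Z.
  apply/negP=> Zh; have := center_expn2 cGv Zh; rewrite -expgM => /eqP; rewrite -order_dvdn orderE -eX.
  by move/dvdn_leq=> /(_ isT); rewrite leqNgt (leq_trans _ X8).
have [n Nn n1] := trivgPn _ ntN.
have cC x : x \in C -> commute x n by case/setIP=> _ /centP/(_ n Nn).
have cM x : x \in M -> commute x h.
  rewrite -[x \in _]/(x \in (M : {set gT})) eM => /mulsgP[b s Nb Xs ->].
  apply/commute_sym/commuteM; last exact: (centsP aX).
  by case/setIP: Ch => _ /centP/(_ b Nb).
have [cD dD] : gconnected (Delta G) /\ gdiam (Delta G) <= 3.
  apply: (@Delta_hub _ _ [set n; h]).
  - by apply/set0Pn; exists n; rewrite !inE eqxx.
  - rewrite subUset !sub1set (odd_core_big cGv nNG oN Nn n1) inE in_setD Zh (subsetP sXG) //=.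
    exact: (odd_cent1_neq4 nNG oN Nn n1 (cC h Ch)).
  - have cnh := cC h Ch.
    by move=> x y /set2P[]-> /set2P[]-> //; apply: commute_sym.
  move=> x; rewrite inE => /andP[Gx Cx]; have [Gx' Zx] := setDP Gx.
  have : x \notin K by rewrite inE Gx Cx.
  rewrite eK !in_setD Gx' andbT; have [Cx' _|Cx'] := boolP (x \in C).
    by exists n; [rewrite !inE eqxx | apply: cC].
  by rewrite /= andbT negbK => Mx; exists h; [rewrite !inE eqxx orbT | apply: cM].
by exists m, (Delta G).
Qed.

Lemma complement_graph :
  (exists m k : nat,
     [/\ (4 * m)%N = (#|commuting_graph G| + 2)%N, (2 * k + 2)%N = #|commuting_graph G|
       & commuting_graph G ~= m * 'K_2 + 'K_k])
  \/ (exists (m : nat) (D : sgraph),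
     [/\ (8 * m)%N = (#|commuting_graph G| + 2)%N, commuting_graph G ~= m * 'K_2 + D,
         gconnected D & gdiam D <= 3]).
Proof.
have [iC|iC] := cent_index cGv nNG oN ntN complement_2index; last first.
  by right; apply: (index4_graph cGv nNG oN ntN iC).
have [aC|naC] := boolP (abelian C); last by right; apply: index2_nonabelian_graph.
by left; apply: (index2_abelian_graph cGv nNG oN ntN iC aC).
Qed.

Lemma complement_type :
  [\/ T \isog [set: 'Z_4], T \isog 'D_4, T \isog 'D_8 | T \isog 'Q_8]
  \/ (exists2 k : nat, 4 <= k & isog_D_SD_Q T k).
Proof.
have sC : 4 <= #|T| by case: cGv => _ _ _ <-; apply: subset_leq_card.
move: sC; rewrite leq_eqVlt => /predU1P[/esym o4|T4].
  by left; case: (group4_isog o4) => i; [apply: Or41 | apply: Or42].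
have naT := cent4_nonabelian cGv sylT sCT T4.
have [k ok ik] := extremal2_isog (cent4_extremal cGv sylT sCT T4).
have [k4|k4] := leqP 4 k; first by right; exists k.
have o8 : #|T| = 8.
  rewrite ok; move: k4 ok T4 => {ik}; case: k => [|[|[|[|k]]]] // _ -> //.
by left; case: (group8_isog o8 naT) => i; [apply: Or44 | apply: Or43].
Qed.
End Complement.

(** * Commuting graphs of 2-groups *)

Lemma order8_graph (gT : finGroupType) (G : {group gT}) :
  #|'Z(G)| = 2 -> #|G| = 8 -> commuting_graph G ~= 3 * 'K_2.
Proof.
move=> oZ oG; have C4 : {in G :\: 'Z(G), forall x, #|'C_G[x]| = 4}.
  move=> x /setDP[Gx Zx]; have sZC : 'Z(G) \subset 'C_G[x].
    by rewrite subsetI center_sub center_sub_cent1.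
  have lt2 : 2 < #|'C_G[x]|.
    rewrite -oZ proper_card // properE sZC; apply/subsetPn; exists x => //.
    by rewrite in_setI Gx cent1id.
  have lt8 : #|'C_G[x]| < 8.
    rewrite -oG proper_card // properE subsetIl; apply: contra Zx => sGC.
    apply/centerP; split=> // y Gy; apply/commute_sym/cent1P.
    by case/setIP: (subsetP sGC y Gy).
  have := cardSg (subsetIl G 'C[x]); rewrite /= oG; move: lt2 lt8.
  by case: #|'C_G[x]| => [|[|[|[|[|[|[|[|]]]]]]]].
apply: (comm_graph1 oZ _ _ C4) => //; last by rewrite oG.
by move=> x Gx; apply: (cent4_agree oZ Gx (C4 x Gx)).
Qed.

Lemma two_group_graph (gT : finGroupType) (G : {group gT}) (v : gT) :
  2.-group G -> cent4 G v ->
  ((G \isog 'Q_8 \/ G \isog 'D_8) /\ commuting_graph G ~= 3 * 'K_2)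
  \/ (exists k : nat,
       [/\ 4 <= k, isog_D_SD_Q G k
         & commuting_graph G ~= (2 ^ (k - 2)) * 'K_2 + 'K_(2 ^ (k - 1) - 2)]).
Proof.
move=> pG cGv; have [oZ Gv Zv oC] := cGv.
have sylG : 2.-Sylow(G) G by rewrite pHallE subxx /= part_pnat_id.
have sC := subsetIl G 'C[v].
have naG : ~~ abelian G.
  by apply: contra Zv => aG; rewrite (center_idP aG).
have G8 : 8 <= #|G| by rewrite leqNgt; apply: contra naG; apply: small_2group_abelian.
have G4 : 4 < #|G| by apply: leq_trans G8.
have ext := cent4_extremal cGv sylG sC G4; have [k ok ik] := extremal2_isog ext.
have [k4|k4] := leqP 4 k.
  have [X [cX sXG iX [_ sZX] _]] := extremal2_cyclic ext naG.
  have X4 : 4 < #|X|.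
    rewrite -(ltn_pmul2r (isT : 0 < 2)) -[X in _ < _ * X]iX Lagrange // ok.
    by apply: (@leq_trans (2 ^ 4)) => //; rewrite leq_exp2l.
  have [m [n [em en im]]] := abelian_index2_graph sXG iX (cyclic_abelian cX) oZ X4.
  have ek : #|G| = (4 * 2 ^ (k - 2))%N.
    by rewrite ok -(expnD 2 2) subnKC // ltnW // ltnW.
  right; exists k; split=> //; have -> : (2 ^ (k - 2))%N = m.
    by apply/eqP; rewrite -(eqn_pmul2l (isT : 0 < 4)) -ek em.
  suff -> : (2 ^ (k - 1) - 2)%N = n by [].
  apply/eqP; rewrite -(eqn_pmul2l (isT : 0 < 2)) mulnBr -expnS subn1 prednK; last exact: leq_trans k4.
  by rewrite -ok -en addnK.
have o8 : #|G| = 8.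
  by rewrite ok; move: k4 ok G4 => {ik}; case: k => [|[|[|[|k]]]] // _ ->.
by left; split; [exact: group8_isog | exact: order8_graph].
Qed.

Lemma card_Delta (gT : finGroupType) (G : {group gT}) : #|Delta G| = #|big_cent G|.
Proof.
rewrite card_sig -(@card_vertices _ G (fun x => #|'C_G[x]| != 4)).
by apply: eq_card => x; rewrite !inE.
Qed.

(** * Extensions of the groups of order 48 by a nontrivial odd kernel *)

Section FortyEightExtension.
Variables (gT : finGroupType) (G Q N : {group gT}) (v : gT) (a b : coset_of N).
Hypotheses (cGv : cent4 G v) (nQG : Q <| G) (qQ : quat8 'Z(G)%G Q) (vQ : v \notin Q).
Hypothesis fus : {in Q :\: 'Z(G) &, forall x y,
  coset 'Z(G) x \in coset 'Z(G) y ^: (G / 'Z(G))}.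
Hypotheses (nNG : N <| G) (oN : odd #|N|) (iN : #|G : N| = 48) (ntN : N :!=: 1).
Hypotheses (Ya : a \in G / N) (R : rel48 a b (coset N v)).
Hypothesis gen : <<[set a; b; coset N v]>> = G / N.
Local Notation Z := 'Z(G).
Let Y := (G / N)%G.
Let C := 'C_G(N)%G.
Let Gv : v \in G. Proof. by case: cGv. Qed.
Let oZ : #|Z| = 2. Proof. by case: cGv. Qed.
Let nN : {subset G <= 'N(N)}. Proof. exact/subsetP/normal_norm. Qed.
Let sNG : N \subset G. Proof. exact: normal_sub. Qed.
Let sCG : C \subset G. Proof. exact: subsetIl. Qed.
Let invN : acts_by_inversion v N. Proof. exact: (cent4_odd_inversion cGv nNG oN). Qed.
Let aN : abelian N. Proof. exact: inversion_abelian invN. Qed.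
Let sNC : N \subset C. Proof. by rewrite subsetI sNG. Qed.
Let nCG : C <| G.
Proof. by rewrite /normal subsetIl normsI ?normG // norms_cent ?normal_norm. Qed.
Let sZC : Z \subset C. Proof. by rewrite setIS ?centS. Qed.
Let oY : #|Y| = 48. Proof. by rewrite card_quotient ?normal_norm. Qed.
Let iN4 : 4 < #|G : N|. Proof. by rewrite iN. Qed.

(** [a] and [b] come from [C] and [v ^+ 2] is central, so [G / C] is generated by the image of [v]
    and has order at most two; and [v] does not centralise [N]. *)
Lemma ext48_index : #|G : C| = 2.
Proof.
have nC : {subset G <= 'N(C)} by apply/subsetP/normal_norm.
have nCv : v \in 'N(C) := nC v Gv.
pose H := (C <*> <[v]>)%G.
have sHG : H \subset G by rewrite join_subG sCG cycle_subG.
have sNH : N \subset H := subset_trans sNC (joing_subl _ _).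
have eH : H :=: G.
  apply/eqP; rewrite eqEsubset sHG /= -(quotientSGK (normal_norm nNG) sNH) -gen gen_subG.
  rewrite !subUset !sub1set /= mem_quotient ?mem_gen ?inE ?cycle_id ?orbT // andbT.
  have sab := rel48_sub_cent cGv nNG oN Ya R.
  have sabH := subset_trans sab (quotientS N (joing_subl C <[v]>)).
  by apply/andP; split; apply: (subsetP sabH); rewrite mem_gen // !inE eqxx ?orbT.
have eQ : G / C = <[coset C v]>.
  by rewrite -eH quotientYidl ?cycle_subG // quotient_cycle.
have o2 : #|G : C| %| 2.
  rewrite -card_quotient ?normal_norm // eQ -orderE order_dvdn -cosetX //.
  by apply/eqP/coset_id/(subsetP sZC)/(cent4_sqr cGv).
have := cent_index cGv nNG oN ntN; case=> [|//|i4]; first by apply: pnat_dvd o2 _.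
by rewrite i4 in o2.
Qed.

Lemma outside_inverts x : x \in G -> x \notin C -> acts_by_inversion x N.
Proof. exact: (index2_inverts cGv nNG oN ntN ext48_index). Qed.

(** In [G / N], of order 48, elements with a centraliser of order four are conjugate to the image of
    [v]. So [x] lies in a coset [N * v ^ g], whose elements are conjugate by
    [inversion_coset_conj]. *)
Lemma ext48_cent4 x : x \in G :\: Z -> #|'C_G[x]| = 4 -> x \in v ^: G.
Proof.
move=> Gx Cx; have [Gx' Zx] := setDP Gx; have cGx : cent4 G x by split.
have [cYv nQY qQY vQY fusY] := quat_odd_quotient cGv nQG qQ vQ fus nNG oN iN4.
have [_ [_ Yx Zbx CYx]] := cent4_quotient cGx nNG oN iN4.
have Yx' : coset N x \in Y :\: 'Z(Y) by rewrite in_setD Zbx.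
have [_ _ /(_ CYx)] := cent_class cYv nQY qQY vQY fusY oY Yx'.
move=> /(coset_classP nNG Gx' Gv)[g [n [Gg Nn ->]]].
have Gvg : v ^ g \in G := groupJ Gv Gg.
have iv : acts_by_inversion (v ^ g) N by apply: acts_by_inversionJ (nN Gg).
rewrite conjgC; have [|m Nm ->] := @inversion_coset_conj _ N (v ^ g) (n ^ (v ^ g)) oN iv.
  by rewrite memJ_norm // nN.
by rewrite -conjgM memJ_class // groupM // (subsetP sNG).
Qed.

(** If [y] were central modulo [N] it would be [n * z] with [z] in [Z]; then [n] commutes with [x],
    which inverts [N], so [n ^+ 2 = 1] and odd order gives [n = 1]. *)
Lemma ext48_quotient_noncentral x y : x \in G -> x \notin C -> y \in G :\: Z ->
  commute x y -> coset N y \in Y :\: 'Z(Y).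
Proof.
move=> Gx Cx /setDP[Gy Zy] cxy; rewrite in_setD mem_quotient // andbT.
have [eZ _] := cent4_quotient cGv nNG oN iN4; rewrite /= eZ; apply: contra Zy.
case/quotient_lift=> z [Nz Zz /(rcoset_kercosetP (nN Gy) Nz)/rcosetP[n Nn ey]].
have cxz : commute x z by case/centerP: Zz => _ cz; apply/commute_sym/cz.
have cxn : commute x n.
  have -> : n = y * z^-1 by rewrite ey mulgK.
  by apply: commuteM => //; apply: commuteV.
suff n1 : n = 1 by rewrite ey n1 mul1g.
have n2 : n ^+ 2 = 1.
  apply/eqP; rewrite expg2 -eq_invg_mul -(outside_inverts Gx Cx Nn).
  by rewrite conjgE -cxn mulKg.
have co : coprime #[n] 2 by rewrite coprimen2; apply: dvdn_odd oN; rewrite order_dvdG.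
apply/eqP; rewrite -order_eq1 -dvdn1 -[X in _ %| X](eqP co).
by rewrite dvdn_gcd dvdnn order_dvdn n2 eqxx.
Qed.

(** Of the 24 elements of [G / N] outside [C / N] at most 12 have a centraliser of order four, and
    the others, at least 12, cannot all lie in one centraliser of order at most eight. *)
Lemma ext48_far : exists x y, [/\ x \in big_cent G, y \in big_cent G, x \notin C, y \notin C
  & coset N y \notin 'C_Y[coset N x]].
Proof.
have [cYv nQY qQY vQY fusY] := quat_odd_quotient cGv nQG qQ vQ fus nNG oN iN4.
pose K := [set y in Y :\: 'Z(Y) | #|'C_Y[y]| == 4].
pose D := (Y :\: C / N) :\: K.
have oK : #|K| = 12 := card_cent4_class cYv nQY qQY vQY fusY oY.
have sCY : C / N \subset Y by rewrite quotientS.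
have iCY : #|C / N| = 24.
  rewrite card_quotient; last exact: subset_trans sCG (normal_norm nNG).
  by have := Lagrange_index sCG sNC; rewrite ext48_index iN => /eqP; rewrite (eqn_pmul2l (n2 := 24)) // => /eqP.
have oD : 12 <= #|D|.
  rewrite cardsD leq_subRL ?subset_leq_card ?subsetIl // cardsDS // oY iCY.
  by rewrite (leq_add2r 12 _ 12) -oK subset_leq_card ?subsetIr.
have liftD y : y \in D -> exists x, [/\ y = coset N x, x \in big_cent G & x \notin C].
  case/setDP=> /setDP[/quotient_lift[x [Nx Gx ->]] CNx] Kx; exists x.
  have Cx : x \notin C by apply: contra CNx => Cx; rewrite mem_quotient.
  have Zx : x \notin Z by apply: contra Cx; apply: (subsetP sZC).
  split=> //; rewrite inE in_setD Zx Gx /=; apply: contra Kx => /eqP C4.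
  have cGx : cent4 G x by split.
  have [_ [_ Yx Zbx CYx]] := cent4_quotient cGx nNG oN iN4.
  by rewrite inE in_setD Zbx Yx CYx.
have [y1 Dy1] : exists y, y \in D by apply/set0Pn; rewrite -card_gt0 (leq_trans _ oD).
have [x [ex Bx Cx]] := liftD y1 Dy1.
have : ~~ (D \subset 'C_Y[coset N x]).
  apply/negP=> /subset_leq_card; rewrite leqNgt => /negP[]; apply: leq_trans oD.
  have Gx : x \in G :\: Z by move: Bx; rewrite inE => /andP[].
  have Yx : coset N x \in Y :\: 'Z(Y).
    by apply: (ext48_quotient_noncentral (x := x)) => //; case/setDP: Gx.
  by have [_ /or3P[]/eqP-> _] := cent_class cYv nQY qQY vQY fusY oY Yx.
case/subsetPn=> y2 /liftD[y [-> By Cy]] nxy.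
by exists x, y.
Qed.

Lemma cent_big x : x \in C -> x \notin Z -> x \in big_cent G.
Proof.
move=> Cx Zx; have [Gx cx] := setIP Cx; rewrite inE in_setD Zx Gx /=.
have [n Nn n1] := trivgPn _ ntN; apply: (odd_cent1_neq4 nNG oN Nn n1).
exact: (centP cx).
Qed.

(** The centraliser of [x] has even order above four and meets [C] in index at most two, so the
    intersection is larger than [Z]. *)
Lemma ext48_hub x : x \in big_cent G -> exists2 u, u \in C :\: Z & commute x u.
Proof.
rewrite inE => /andP[/setDP[Gx Zx] C4].
have sZx : Z \subset 'C_G[x] by rewrite subsetI center_sub center_sub_cent1.
have lt2 : 2 < #|'C_G[x]|.
  rewrite -oZ proper_card // properE sZx; apply/subsetPn; exists x => //.
  by rewrite in_setI Gx cent1id.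
have d2 : 2 %| #|'C_G[x]| by rewrite -oZ cardSg.
have lt4 : 4 < #|'C_G[x]|.
  by move: C4 lt2 d2; case: #|'C_G[x]| => [|[|[|[|[|]]]]].
have le2 : #|'C_G[x] : C| <= 2.
  rewrite -(leq_pmul2r (cardG_gt0 C)) LagrangeMr -[X in _ <= X * _]ext48_index mulnC.
  by rewrite Lagrange // subset_leq_card // mul_subG ?subsetIl.
have : ~~ ('C_G[x] :&: C \subset Z).
  apply/negP=> /subset_leq_card; rewrite oZ => le; move: lt4.
  by rewrite -(LagrangeI 'C_G[x] C) ltnNge => /negP[]; apply: (leq_mul le le2).
case/subsetPn=> u /setIP[/setIP[Gu /cent1P cu] Cu] Zu; exists u; first by rewrite in_setD Zu.
exact: commute_sym.
Qed.

(** Any two vertices are joined by [x], [u], [n], [w], [y] with [n] in [N] and [u], [w] in [C]. For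
    the pair of [ext48_far] three steps do not suffice: the inner vertices stay noncentral modulo
    [N], where commuting is transitive, so the images of the ends would commute. *)
Lemma ext48_graph : exists (m : nat) (D : sgraph),
  [/\ (8 * m)%N = (#|commuting_graph G| + 2)%N, commuting_graph G ~= m * 'K_2 + D,
      gconnected D & gdiam D = 4].
Proof.
have [|m em im] := cent4_graph oZ.
  rewrite -[RHS](card_inverted_class cGv); congr (4 * _)%N; apply: eq_card => x.
  rewrite inE; apply/idP/idP=> [/andP[Gx /eqP Cx]|/(class_cent4 cGv)//].
  exact: ext48_cent4.
have G_big x : x \in big_cent G -> x \in G :\: Z by rewrite inE => /andP[].
have [n Nn n1] := trivgPn _ ntN; have Bn := odd_core_big cGv nNG oN Nn n1.
have Gn := subsetP sNG n Nn.
have [cD dD] : gconnected (Delta G) /\ gdiam (Delta G) <= 4.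
  apply: Delta_le => [|x y Bx By]; first by apply/set0Pn; exists n.
  have [u /setDP[Cu Zu] cxu] := ext48_hub Bx; have [w /setDP[Cw Zw] cyw] := ext48_hub By.
  have [Gu /centP/(_ n Nn) cun] := setIP Cu; have [Gw /centP/(_ n Nn) cwn] := setIP Cw.
  have /setDP[Gy _] := G_big y By.
  exists [:: u; n; w; y]; split=> //= [z|].
    by rewrite !in_cons in_nil orbF => /or4P[]/eqP-> //; apply: cent_big.
  rewrite !in_setI Gu Gn Gw Gy /= andbT; apply/and4P; split; apply/cent1P.
  - exact: commute_sym.
  - exact: commute_sym.
  - exact: cwn.
  exact: cyw.
exists m, (Delta G); split=> //; apply/eqP; rewrite eqn_leq dD /=.
have [x [y [Bx By Cx Cy nxy]]] := ext48_far.
have [x' ex] := Delta_lift Bx; have [y' ey] := Delta_lift By.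
apply: (@diam_gt _ 3 x' y').
  rewrite card_Delta; apply: (@leq_trans #|C :\: Z|).
    rewrite cardsDS // oZ ltn_subRL; apply: (@leq_trans 24) => //.
    have oG : #|G| = (2 * #|C|)%N by rewrite -ext48_index mulnC Lagrange.
    by rewrite -(leq_pmul2l (isT : 0 < 2)) -oG -(Lagrange sNG) iN leq_pmull.
  by apply: subset_leq_card; apply/subsetP=> u /setDP[]; apply: cent_big.
have [cYv nQY qQY vQY fusY] := quat_odd_quotient cGv nQG qQ vQ fus nNG oN iN4.
have agree : centralisers_agree Y.
  by apply: abelian_centralisers_agree => u Yu; case: (cent_class cYv nQY qQY vQY fusY oY Yu).
case=> [|c [|d [|e [|]]]] //= _ /and4P[xc cd de _] ee; subst e.
rewrite !Delta_adj ex ey in xc cd de.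
move: (Delta_val c) (Delta_val d) xc cd de; set C1 := val (val c); set C2 := val (val d).
move=> /G_big G1 /G_big G2 x1 c12 c2y; have [Gx _] := setDP (G_big x Bx); have [Gy _] := setDP (G_big y By).
have [_ /cent1P cx1] := setIP x1; have [_ /cent1P c21] := setIP c12; have [_ /cent1P cy2] := setIP c2y.
have Yx := ext48_quotient_noncentral Gx Cx (G_big x Bx) (commute_refl x).
have Yc := ext48_quotient_noncentral Gx Cx G1 (commute_sym cx1).
have Yd := ext48_quotient_noncentral Gy Cy G2 cy2.
have toY u w : u \in G -> w \in G -> commute u w -> coset N w \in 'C_Y[coset N u].
  move=> Gu Gw cuw; rewrite in_setI mem_quotient //; apply/cent1P.
  by rewrite /commute -!cosetM ?nN // cuw.
have Gc : C1 \in G by case/setDP: G1. have Gd : C2 \in G by case/setDP: G2.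
have e1 : 'C_Y[coset N C1] = 'C_Y[coset N x].
  apply: (agree _ Yx); case/setDP: Yc => _ Zc; rewrite in_setD Zc; apply: toY => //; exact: commute_sym.
have e2 : 'C_Y[coset N C2] = 'C_Y[coset N C1].
  apply: (agree _ Yc); case/setDP: Yd => _ Zd; rewrite in_setD Zd; apply: toY => //; exact: commute_sym.
case/negP: nxy; rewrite -e1 -e2; apply: toY => //; exact: commute_sym.
Qed.
End FortyEightExtension.

(** * From isolated edges to centralisers of order four, and the classification *)

Lemma isolated_edge_cent4 (gT : finGroupType) (G : {group gT})
    (v w : commuting_graph G) :
  'Z(G) != 1 -> isolated_edge v w -> cent4 G (val v).
Proof.
move=> ntZ [vw comp]; have /setDP[Gv Zv] := vertexP v; have /setDP[Gw Zw] := vertexP w.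
have sZC : 'Z(G) \subset 'C_G[val v] by rewrite subsetI center_sub center_sub_cent1.
have eC : 'C_G[val v] :\: 'Z(G) = [set val v; val w].
  apply/eqP; rewrite eqEsubset subUset !sub1set !in_setD Zv Zw in_setI Gv cent1id.
  rewrite (edge_cent vw) !andbT; apply/subsetP=> y /setDP[Cy Zy].
  have Gy : y \in G :\: 'Z(G) by rewrite in_setD Zy; case/setIP: Cy.
  pose y' : commuting_graph G := exist _ y Gy.
  have : y' \in [set x | connect (@sedge (commuting_graph G)) v x].
    rewrite inE; have : adj v y' by rewrite adj_cent.
    by case/orP=> [/eqP->|/connect1//]; apply: connect0.
  by rewrite comp => /set2P[e|e]; rewrite -[y]/(val y') e !inE eqxx ?orbT.
have vw' : val v != val w.
  by apply: contraTneq vw => /val_inj->; rewrite sedge_irr.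
have := cardsDS sZC; rewrite eC cards2 vw' => e2.
have lt : #|'Z(G)| < #|'C_G[val v]| by rewrite -subn_gt0 -e2.
have eq : #|'C_G[val v]| = (#|'Z(G)| + 2)%N by rewrite e2 subnKC // ltnW.
(* The order of the centre divides that of ['C_G[val v]], which is larger by two; hence it divides
   two. *)
have oZ : #|'Z(G)| = 2.
  apply/eqP; rewrite eqn_leq cardG_gt1 ntZ andbT; apply: dvdn_leq => //.
  by rewrite -(dvdn_addr 2 (dvdnn #|'Z(G)|)) -eq cardSg.
by split=> //; rewrite eq oZ.
Qed.

Theorem theorem3p18 (gT : finGroupType) (G : {group gT})
    (v w : commuting_graph G) :
  'Z(G) != 1 ->
  isolated_edge v w ->
     (* (i) *)
     (G \isog 'SL_2(3) /\ commuting_graph G ~= 3 * 'K_2 + 4 * 'K_4)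
  \/ (* (ii) *)
     (G \isog 'SL_2(5)
      /\ commuting_graph G ~= 15 * 'K_2 + 10 * 'K_4 + 6 * 'K_8)
  \/ (* (iii) *)
     ((G \isog 'GL_2(3) \/ isog_J G)
      /\ commuting_graph G ~= 6 * 'K_2 + 4 * 'K_4 + 3 * 'K_6)
  \/ (* (iv) *)
     ((G \isog 'Q_8 \/ G \isog 'D_8) /\ commuting_graph G ~= 3 * 'K_2)
  \/ (* (v) *)
     (exists k : nat,
       [/\ 4 <= k, isog_D_SD_Q G k
         & commuting_graph G ~= (2 ^ (k - 2)) * 'K_2 + 'K_(2 ^ (k - 1) - 2)])
  \/ (* (vi) *)
     (exists N : {group gT},
       [/\ [/\ N <| G, abelian N, N :!=: 1 & odd #|N|],
           GL23_quotient_SL_centralises G N \/ J_quotient_SL_centralises G N,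
           acts_by_inversion (val v) N
         & exists (m : nat) (D : sgraph),
             [/\ (8 * m)%N = (#|commuting_graph G| + 2)%N,
                 commuting_graph G ~= m * 'K_2 + D,
                 gconnected D & gdiam D = 4]])
  \/ (* (vii) *)
     (exists N H : {group gT},
       [/\ [/\ N ><| H = G, abelian N, N :!=: 1 & odd #|N|],
           [\/ H \isog [set: 'Z_4], H \isog 'D_4, H \isog 'D_8
             | H \isog 'Q_8]
           \/ (exists2 k : nat, 4 <= k & isog_D_SD_Q H k),
           conj_aut N @* H \isog [set: 'Z_2]
           \/ conj_aut N @* H \isog [set: 'Z_2 * 'Z_2],
           acts_by_inversion (val v) N
         & (* (a) *)
           (exists m k : nat,
             [/\ (4 * m)%N = (#|commuting_graph G| + 2)%N,
                 (2 * k + 2)%N = #|commuting_graph G|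
               & commuting_graph G ~= m * 'K_2 + 'K_k])
           \/ (* (b) *)
           (exists (m : nat) (D : sgraph),
             [/\ (8 * m)%N = (#|commuting_graph G| + 2)%N,
                 commuting_graph G ~= m * 'K_2 + D,
                 gconnected D & gdiam D <= 3])]).
Proof.
move=> ntZ iso; have cGv := isolated_edge_cent4 ntZ iso.
have [T sylT sCT] := cent4_Sylow cGv.
case: (trichotomy (leqnn _) cGv sylT sCT) => [hcG|[_ qT cT fT]|[Q [nQG qQ vQ oT fus]]].
- do 3 right; pose N := 'O_2^'(G)%G.
  have nNG : N <| G by apply: pcore_normal.
  have oN : odd #|N| by rewrite odd_2'nat; apply: pcore_pgroup.
  have defG := complement_sdprod sylT hcG.
  have [N1|ntN] := eqVneq (N : {set gT}) 1.
    have pG : 2.-group G.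
      by move: defG; rewrite -/N N1 sdprod1g => <-; apply: pHall_pgroup sylT.
    by case: (two_group_graph pG cGv) => [?|?]; [left | right; left].
  do 3 right; exists N, T; have invN := cent4_odd_inversion cGv nNG oN.
  split=> //.
  + by split=> //; apply: inversion_abelian invN.
  + exact: complement_type cGv sylT sCT.
  + exact: complement_image cGv sylT hcG ntN.
  exact: complement_graph cGv sylT sCT hcG ntN.
- have [[oG _]|[oG _]] := sylow_quat_card cGv sylT qT cT fT.
    left; have [q [d [_ _ R gen]]] := sylow_quat_SL23 cGv sylT qT cT fT oG.
    by split; [exact: SL23_isog R gen oG | exact: SL23_graph cGv sylT qT cT fT oG].
  right; left; have [q [d [y [_ R gen]]]] := sylow_quat_SL25 cGv sylT qT cT fT oG.
  by split; [exact: SL25_isog R gen oG | exact: SL25_graph cGv sylT qT cT fT oG].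
have G16 : (#|G|`_2 = 16)%N by rewrite -(card_Hall sylT).
have [N [nNG oN iN [a [b [Ya Yb R gen]]]]] := quat_odd_generators cGv nQG qQ vQ fus G16.
have [N1|ntN] := eqVneq (N : {set gT}) 1.
  have oG : #|G| = 48 by rewrite -iN N1 indexg1.
  do 2 right; left; split; last exact: FortyEight_graph cGv nQG qQ vQ fus oG.
  (* The generators [a] and [b] live in the quotient by the trivial group; generators in [G] itself
     come from a second use of [quat_rel48]. *)
  have [c [d [_ _ R' gen']]] := quat_rel48 cGv nQG qQ vQ fus oG.
  have [v2|v2] := rel48_sqr R'; [left | right].
    by have [f /isom_isog isof _] := GL23_isom R' gen' oG v2; apply: isof.
  exact: isog_J_rel48 R' gen' oG v2.
have invN := cent4_odd_inversion cGv nNG oN.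
do 5 right; left; exists N; split=> //.
- by split=> //; apply: inversion_abelian invN.
- exact: quotient_GL23_or_J cGv nNG oN iN Ya Yb R gen.
exact: ext48_graph cGv nQG qQ vQ fus nNG oN iN ntN Ya R gen.
Qed.
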